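(* Let $\Lambda=\{(x_k,y_k)\in\mathbb{Z}^d\times\mathbb{Z}^d:1\le k\le N-1\}\cup\{(\alpha,\beta)\}$ be a set of $N$ distinct points of $\mathbb{R}^d\times\mathbb{R}^d$ with $(\alpha,\beta)\notin\mathbb{Z}^d\times\mathbb{Z}^d$. Suppose that there exists a nonzero Schwartz function $f\in\mathcal{S}(\mathbb{R}^d)$ for which the family $\{M_yT_xf:(x,y)\in\Lambda\}$ is linearly dependent. Then there are $c_1,\dots,c_{N-1}\in\mathbb{C}$ with $\sum_{k=1}^{N-1}c_kM_{y_k}T_{x_k}f=M_\beta T_\alpha f$, and, with $p(t,\xi)=\sum_{k=1}^{N-1}c_ke^{-2\pi i\langle y_k,t\rangle}e^{-2\pi i\langle\xi,x_k\rangle}$, the following hold: (i) the orbit closure $H=\overline{\{n(-\alpha,\beta)\bmod\mathbb{Z}^{2d}:n\in\mathbb{Z}\}}\subset\mathbb{T}^{2d}$ is infinite and proper; (ii) with $S=\{z\in\mathbb{T}^{2d}:Zf(z)\ne0\}$, the function $$\Theta(z)=\int_H\log|p(z+h)|\,dm_H(h)$$ is well defined on $S$ and vanishes identically there; (iii) if $H_0$ denotes the identity component of $H$, $m=|H/H_0|$, $\gamma=(-\alpha,\beta)$, and $\Phi:H_0\to\mathbb{T}^r$ is a Lie group isomorphism ($r=\dim H_0$) carrying $m\gamma$ to $\omega\in\mathbb{T}^r$, then for every $\lambda\in S$ and every integer $M\ge0$, $$\sup_{k\in\mathbb{Z}^r\setminus\{0\}}(1+|k|)^M\frac{|\widehat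 b_\lambda(k)|}{\|\langle k,\omega\rangle\|_{\mathbb{T}}}<\infty,$$ where $b_\lambda(x)=\log\prod_{j=0}^{m-1}|p(\lambda+\Phi^{-1}(x)+j\gamma)|$ for $x\in\mathbb{T}^r$; (iv) with $H_0$ and $m$ as in (iii), $$m\bigl(\langle a_t,\beta\rangle+\langle a_\omega,\alpha\rangle\bigr)\in\mathbb{Z}\qquad\text{for every }a=(a_t,a_\omega)\in T_0H_0\cap\mathbb{Z}^{2d}.$$
   Context: Here $d\ge1$, $N\ge2$ are integers, $\langle\cdot,\cdot\rangle$ is the standard inner product, $\mathcal{S}(\mathbb{R}^d)$ is the Schwartz space, and $\mathbb{T}^n=\mathbb{R}^n/\mathbb{Z}^n$. Periodic functions on $\mathbb{R}^n$ are identified with functions on $\mathbb{T}^n$; vectors of $\mathbb{R}^{2d}$ act on $\mathbb{T}^{2d}$ by translation modulo $\mathbb{Z}^{2d}$. Time-frequency shifts: $T_xf(t)=f(t-x)$, $M_yf(t)=e^{-2\pi i\langle y,t\rangle}f(t)$. Zak transform: $Zf(t,\xi)=\sum_{\kappa\in\mathbb{Z}^d}e^{-2\pi i\langle\xi,\kappa\rangle}f(t+\kappa)$ on $\mathbb{R}^d\times\mathbb{R}^d$. Its modulus is $\mathbb{Z}^{2d}$-periodic, so the condition $Zf(z)\neq0$ makes sense for $z\in\mathbb{T}^{2d}$. $H$ is a closed subgroup of $\mathbb{T}^{2d}$, hence a compact abelian Lie group; $m_H$ is its normalized Haar measure; ''proper'' means $H\ne\mathbb{T}^{2d}$. $H_0$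 is a torus, $H/H_0$ is finite cyclic (generated by the class of $\gamma$), and the class of $m\gamma$ lies in $H_0$. $T_0H_0\subset\mathbb{R}^{2d}$ is the tangent space (Lie algebra) of $H_0$ at the identity, viewed as a linear subspace of $\mathbb{R}^{2d}$, and $a=(a_t,a_\omega)\in\mathbb{R}^d\times\mathbb{R}^d$. Fourier coefficients: $\widehat b(k)=\int_{\mathbb{T}^r}b(x)e^{-2\pi i\langle k,x\rangle}\,dx$. For real $t$ (or $t\in\mathbb{R}/\mathbb{Z}$), $\|t\|_{\mathbb{T}}=\inf_{n\in\mathbb{Z}}|t-n|$. $|k|$ is the Euclidean norm. *)

(* Defs.v *)
From HB Require Import structures.
From mathcomp Require Import all_boot all_order all_algebra generic_quotient.
From mathcomp Require Import ring_quotient complex.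
From mathcomp Require Import all_classical all_reals all_analysis.
From mathcomp.analysis.showcase Require summability.

Set Implicit Arguments.
Unset Strict Implicit.
Unset Printing Implicit Defensive.

Import Order.TTheory GRing.Theory Num.Theory.
Import numFieldNormedType.Exports.

Local Open Scope classical_set_scope.
Local Open Scope complex_scope.
Local Open Scope ring_scope.

Section Torus.
Variables (R : realType) (n : nat).

Definition int_vec : {pred 'rV[R]_n} :=
  fun v => [forall i, v 0 i \is a Num.int].

Lemma int_vec_zmod_closed : zmod_closed int_vec.
Proof.
split=> [|u v /forallP uZ /forallP vZ]; apply/forallP => i.
  by rewrite mxE rpred0.
by rewrite !mxE rpredB.
Qed.

HB.instance Definition _ :=
  GRing.isZmodClosed.Build 'rV[R]_n int_vec int_vec_zmod_closed.

Definition int_lattice : zmodClosed 'rV[R]_n :=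
  GRing.ZmodClosed.clone _ int_vec _.

Local Notation rn_mod_zn := (Quotient.quot int_lattice).

(* Topology from [quotient_topology], group law from the quotient group. *)
Definition torus : Type := quotient_topology rn_mod_zn.

HB.instance Definition _ := Topological.on torus.
HB.instance Definition _ := GRing.isZmodule.Build torus
  (@Quotient.addqA _ int_lattice) (@Quotient.addqC _ int_lattice)
  (@Quotient.add0q _ int_lattice) (@Quotient.addNq _ int_lattice).
HB.instance Definition _ := isPointed.Build torus (0 : torus).

Definition to_torus (x : 'rV[R]_n) : torus := \pi_rn_mod_zn%qT x.
(* A Z^n-periodic function F on R^n is the function [F \o of_torus] on R^n/Z^n. *)
Definition of_torus (z : torus) : 'rV[R]_n := repr (z : rn_mod_zn).

Lemma to_torus_eq (x y : 'rV[R]_n) : to_torus x = to_torus y <-> int_vec (x - y).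
Proof.
have e : int_vec (x - y) = (x == y %[mod rn_mod_zn])%qT.
  exact: Quotient.idealrBE.
by rewrite e; split=> [h|/eqP]; [apply/eqP|].
Qed.

Lemma of_torusK : cancel of_torus to_torus.
Proof. exact: reprK. Qed.

Lemma to_torusD : {morph to_torus : x y / x + y}.
Proof. by move=> x y; rewrite /to_torus Quotient.pi_add. Qed.

Lemma to_torus_continuous : continuous to_torus.
Proof. exact: pi_continuous. Qed.

Definition borel_torus : Type := g_sigma_algebraType (@open torus).
End Torus.

Section Vectors.
Variables (R : realType) (n : nat).

Definition zvec (k : 'rV[int]_n) : 'rV[R]_n := map_mx intr k.
Definition dotp (u v : 'rV[R]_n) : R := \sum_i u 0 i * v 0 i.
Definition enorm (u : 'rV[R]_n) : R := Num.sqrt (dotp u u).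

Definition expi2pi (s : R) : R[i] := cos (2 * pi * s) +i* sin (2 * pi * s).

(* The distance ||t||_T from t to Z. *)
Definition dist_int (t : R) : R := inf [set `|t - m%:~R| | m in [set: int]].
End Vectors.

Section Schwartz.
Variables (R : realType) (n : nat).

Definition iter_partial (s : seq 'I_n) (g : 'rV[R]_n -> R) : 'rV[R]_n -> R :=
  foldr (fun i h => 'D_(delta_mx 0 i) h) g s.

Definition smooth (g : 'rV[R]_n -> R) : Prop :=
  forall s x, differentiable (iter_partial s g) x.

Definition rapidly_decreasing (g : 'rV[R]_n -> R) : Prop :=
  forall (s : seq 'I_n) (e : 'I_n -> nat), exists C : R, forall x : 'rV[R]_n,
    `|(\prod_i x 0 i ^+ e i) * iter_partial s g x| <= C.

Definition schwartz (f : 'rV[R]_n -> R[i]) : Prop :=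
  [/\ smooth (fun x => complex.Re (f x)), smooth (fun x => complex.Im (f x)),
      rapidly_decreasing (fun x => complex.Re (f x)) &
      rapidly_decreasing (fun x => complex.Im (f x))].
End Schwartz.

Section TimeFrequency.
Variables (R : realType) (d : nat).
Implicit Types (x y t xi : 'rV[R]_d) (f : 'rV[R]_d -> R[i]).

Definition transl x f : 'rV[R]_d -> R[i] := fun t => f (t - x).
Definition modul y f : 'rV[R]_d -> R[i] := fun t => expi2pi (- dotp y t) * f t.

(* The sum over Z^d is unconditional: the limit of the partial sums along the
   finite subsets of Z^d. *)
Definition zak f (z : 'rV[R]_(d + d)) : R[i] :=
  summability.sum (fun k : 'rV[int]_d =>
    expi2pi (- dotp (rsubmx z) (zvec R k)) * f (lsubmx z + zvec R k) : R[i]^o).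

Definition lin_dependent (I : finType) (F : I -> 'rV[R]_d -> R[i]) : Prop :=
  exists c : I -> R[i],
    (exists i, c i != 0) /\ forall t, \sum_i c i * F i t = 0.

(* The points of Lambda, with (alpha, beta) in position [None]. *)
Definition tf_point (n : nat) (x y : 'I_n -> 'rV[int]_d)
    (alpha beta : 'rV[R]_d) (i : option 'I_n) : 'rV[R]_d * 'rV[R]_d :=
  if i is Some k then (zvec R (x k), zvec R (y k)) else (alpha, beta).

Definition tf_poly (n : nat) (x y : 'I_n -> 'rV[int]_d) (c : 'I_n -> R[i])
    (z : 'rV[R]_(d + d)) : R[i] :=
  \sum_k c k * expi2pi (- dotp (zvec R (y k)) (lsubmx z))
             * expi2pi (- dotp (rsubmx z) (zvec R (x k))).
End TimeFrequency.

Section TorusSubgroups.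
Variables (R : realType) (n : nat).
Implicit Types (H K : set (torus R n)).

Definition orbit_closure (g : torus R n) : set (torus R n) :=
  closure [set g *~ m | m in [set: int]].

Definition identity_component H : set (torus R n) := connected_component H 0.

Definition cosets H K : set (set (torus R n)) :=
  [set [set h + k | k in K] | h in H].

(* Normalized Haar measure of a closed subgroup H, as a Borel probability
   measure on the torus carried by H. *)
Definition is_haar H (mu : probability (borel_torus R n) R) : Prop :=
  mu H = 1%E /\
  forall h, H h -> forall A : set (borel_torus R n), measurable A ->
    mu [set z : torus R n | A (h + z)] = mu A.

(* Velocities at 0 of smooth curves through the identity in K. *)
Definition tangent_space K : set 'rV[R]_n :=
  [set v | exists c : R -> 'rV[R]_n,
    [/\ forall j t, derivable (derive1n j c) t 1,
        c 0 = 0,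
        \forall t \near (0 : R), K (to_torus (c t)) &
        derive1 c 0 = v]].
End TorusSubgroups.

(* F is smooth on the subset A of R^n/Z^n: it lifts, near each point of A, to a
   smooth map from R^n to R^r. *)
Definition smooth_on (R : realType) (n r : nat) (A : set (torus R n))
    (F : torus R n -> torus R r) : Prop :=
  forall x : 'rV[R]_n, A (to_torus x) ->
    exists g : 'rV[R]_n -> 'rV[R]_r,
      (forall j, smooth (fun y => g y 0 j)) /\
      \forall y \near x, A (to_torus y) -> to_torus (g y) = F (to_torus y).

(* Phi restricts to a Lie group isomorphism from the subgroup K onto R^r/Z^r,
   with inverse Psi. *)
Definition lie_isomorphism (R : realType) (n r : nat) (K : set (torus R n))
    (Phi : torus R n -> torus R r) (Psi : torus R r -> torus R n) : Prop :=
  [/\ forall x, K (Psi x),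
      forall z, K z -> Psi (Phi z) = z,
      forall x, Phi (Psi x) = x,
      forall z w, K z -> K w -> Phi (z + w) = Phi z + Phi w &
      smooth_on K Phi /\ smooth_on setT Psi].

(* The k-th Fourier coefficient of b; in use, nu is the Haar measure dx. *)
Definition fourier_coef (R : realType) (r : nat)
    (nu : probability (borel_torus R r) R) (b : torus R r -> \bar R)
    (k : 'rV[int]_r) : R[i] :=
  let e (x : torus R r) := expi2pi (- dotp (zvec R k) (of_torus x)) in
  fine (\int[nu]_x (b x * (complex.Re (e x))%:E)%E) +i*
  fine (\int[nu]_x (b x * (complex.Im (e x))%:E)%E).

(* Main.v *)
Require Import Defs.
From mathcomp Require Import all_boot all_order all_algebra complex.
From mathcomp Require Import all_classical all_reals all_analysis.
From mathcomp Require Import measurable_realfun ring lra zify.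
Import Order.TTheory GRing.Theory Num.Theory.
Import numFieldNormedType.Exports.
Local Open Scope classical_set_scope.
Local Open Scope complex_scope.
Local Open Scope ring_scope.

(** Write [F] for the Zak transform of [f].  It carries [modul y (transl x f)] to
    [F] translated by [(-x, y)], up to a unimodular factor, and an integral
    translation only multiplies [F] by a character.  So the linear relation becomes
    the cocycle equation [|p z| |F z| = |F (z + gamma)|] on the torus ([zak_cocycle],
    [absPF]), where [F] is continuous and not identically zero ([zak_neq0]).
    The coefficient of the nonintegral shift can be normalized to one, because a
    relation between integral shifts alone reads [p F = 0] and kills the
    trigonometric polynomial [p] on an open set ([integral_shifts_independent]).

    The zero set of [F] is closed and stable under translation by [gamma], hence
    under the orbit closure [H], by Poincare recurrence ([coset_nonzero]).
    Therefore [ln |F|] is continuous on the coset [z + H] of a nonzero [z], and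
    [ln |p|] is there the coboundary of [ln |F|]: its mean over [H] is zero
    ([log_mean_zero]).  Adding [m] consecutive values gives [b x = u (x + omega) - u x]
    with [u x = ln |F (lambda + Psi x)|], so the [k]-th Fourier coefficient of [b] is
    that of [u] times [expi2pi <k, omega> - 1], whose modulus is at most a constant
    times the distance of [<k, omega>] to the integers.  The function [u] is smooth
    along the coordinate directions, as [|F|^2] is and [Psi] is linear on universal
    covers ([lie_isomorphism_linear]), so its Fourier coefficients decay rapidly
    ([fourier_decay], [small_divisors_bounded]).  The distance does not vanish for
    nonzero [k], since the kernel of a resonant character would be a subgroup of
    finite index of the connected group [H0] ([no_resonance]).

    The other statements rest on the curvature of the line bundle of which [F] is a
    section.  Let [a] be integral with all of its line in [H], and let [F] have no
    zero on [z0 + H].  Cut the closed loop [s |-> s a] into [N] short steps and add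
    the phases of [F] along them, corrected for the quasi-periodicity.  Moving the
    loop by a small [u] in [H] changes this total phase by exactly [symp a u]; moving
    it [k] times changes it by [k] times as much, but the total phase is bounded by
    [N], so [symp a u = 0] ([curvature_vanishes]).  If [H] were the whole torus, [F]
    would have no zero, and [symp a] would vanish near the origin for every
    integral [a], which is absurd ([zak_has_zero], [orbit_proper]).  In general the
    elements of [H] with a lift orthogonal to [a] form an open subgroup of [H]; it
    contains [H0] and so [m gamma], which is the last statement
    ([component_curvature]).

    If [H] were finite, [gamma] would have a finite order and the moduli of [p] would
    multiply to one along each orbit.  On a generic integral line the factors are
    Laurent polynomials on the unit circle, so they would be units, and [p] would be
    a monomial ([trig_poly_monomial]).  The relation would say that two
    time-frequency shifts of [f] are proportional, which the decay of [f] excludes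
    unless the shifts are the same ([shift_rigidity]); but one is integral and the
    other is not ([orbit_infinite]). *)

Set Implicit Arguments.
Unset Strict Implicit.
Unset Printing Implicit Defensive.

(** * Characters and phases *)
Section Phases.
Variable R : realType.
Implicit Types (s t : R) (w z : R[i]).

Lemma expi2piD s t : expi2pi (s + t) = expi2pi s * expi2pi t.
Proof. by rewrite /expi2pi mulrDr cosD sinD; congr (_ +i* _); rewrite addrC. Qed.

Lemma expi2pi0 : expi2pi 0 = 1 :> R[i].
Proof. by rewrite /expi2pi mulr0 cos0 sin0. Qed.

Lemma expi2piN s : expi2pi (- s) = (expi2pi s)^*%C.
Proof. by rewrite /expi2pi mulrN cosN sinN. Qed.

Lemma normc_expi2pi s : Normc.normc (expi2pi s) = 1.
Proof. by rewrite /Normc.normc /expi2pi cos2Dsin2 sqrtr1. Qed.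

Lemma expi2pi_neq0 s : expi2pi s != 0.
Proof.
by apply/eqP => /(congr1 (@Normc.normc R)); rewrite normc_expi2pi Normc.normc0 => /eqP; rewrite oner_eq0.
Qed.

Lemma expi2piM_nat s (n : nat) : expi2pi (n%:R * s) = expi2pi s ^+ n.
Proof.
elim: n => [|n IH]; first by rewrite mul0r expi2pi0 expr0.
by rewrite -addn1 natrD mulrDl mul1r expi2piD IH addn1 exprSr.
Qed.

Lemma expi2pi_int s : s \is a Num.int -> expi2pi s = 1.
Proof.
have h1 : expi2pi 1 = 1 :> R[i].
  by rewrite /expi2pi mulr1 mulr_natl cos2pi sin2pi.
move=> /intrP[[n|n] ->]; first by rewrite -pmulrn -(mulr1 n%:R) expi2piM_nat h1 expr1n.
by rewrite NegzE mulrNz expi2piN -pmulrn -(mulr1 n.+1%:R) expi2piM_nat h1 expr1n conjc1.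
Qed.

Lemma expi2pi_eq1 s : expi2pi s = 1 -> s \is a Num.int.
Proof.
move=> es; set r := s - (Num.floor s)%:~R.
have er : expi2pi r = 1.
  by rewrite expi2piD es expi2pi_int ?mulr1// rpredN intr_int.
have [r0 r1] : 0 <= r /\ r < 1.
  by rewrite /r subr_ge0 ltrBlDl floor_le -intrD1 floorD1_gt.
have pi0 := pi_gt0 R.
have c1 : cos (2 * pi * r) = 1 by case: er.
have r00 : r = 0.
  have [rh|rh] := lerP r (1/2).
    have : 2 * pi * r = 0.
      apply: cos_inj; rewrite ?c1 ?cos0// in_itv/=; last by rewrite lexx ltW.
      by apply/andP; split; nra.
    by move/eqP; rewrite !mulf_eq0 (gt_eqF pi0) pnatr_eq0 /= => /eqP.
  have : 2 * pi * (1 - r) = 0.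
    apply: cos_inj; rewrite ?cos0// ?in_itv/=.
    - by apply/andP; split; nra.
    - by rewrite lexx ltW.
    - by rewrite mulrBr mulr1 addrC mulr_natl cosD2pi cosN -mulr_natl c1.
  by move/eqP; rewrite !mulf_eq0 (gt_eqF pi0) pnatr_eq0 /= subr_eq0 => /eqP h; move: r1; rewrite -h ltxx.
by move/eqP: r00; rewrite subr_eq0 => /eqP ->; exact: intr_int.
Qed.

Lemma normc_ge0 z : 0 <= Normc.normc z.
Proof. by case: z => a b; exact: sqrtr_ge0. Qed.

Lemma normc_gt0 z : (0 < Normc.normc z) = (z != 0).
Proof.
rewrite lt_neqAle normc_ge0 andbT eq_sym; congr negb.
by apply/eqP/eqP => [/Normc.eq0_normc|->]; rewrite ?Normc.normc0.
Qed.

Lemma sqr_normc_real z : Normc.normc z ^+ 2 = complex.Re z ^+ 2 + complex.Im z ^+ 2.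
Proof. by case: z => a b; rewrite /= sqr_sqrtr// addr_ge0 ?sqr_ge0. Qed.

Lemma ReM w z : complex.Re (w * z) =
  complex.Re w * complex.Re z - complex.Im w * complex.Im z.
Proof. by case: w z => a b []. Qed.

Lemma ImM w z : complex.Im (w * z) =
  complex.Re w * complex.Im z + complex.Im w * complex.Re z.
Proof. by case: w z => a b []. Qed.

Lemma mulc_conj z : z * z^*%C = (Normc.normc z ^+ 2)%:C.
Proof.
rewrite sqr_normc_real; case: z => a b /=; simpc.
by rewrite -!expr2 mulrC addNr.
Qed.

Lemma abs_sin_le s : `|sin s| <= `|s|.
Proof.
wlog s0 : s / 0 < s => [H|].
  have [->|/lt_total/orP[sl|]] := eqVneq s 0; first by rewrite sin0.
  - by rewrite -(normrN s) -(normrN (sin s)) -sinN H// oppr_gt0.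
  - exact: H.
have [c _] := @MVT R sin cos 0 s s0 (fun x _ => is_derive_sin x)
  (continuous_subspaceT (@continuous_sin R)).
rewrite sin0 !subr0 => ->; rewrite normrM ler_piMl// ler_norml.
by rewrite cos_geN1 cos_le1.
Qed.

Lemma abs_cos_sub1_le s : `|cos s - 1| <= `|s|.
Proof.
wlog s0 : s / 0 < s => [H|].
  have [->|/lt_total/orP[sl|]] := eqVneq s 0; first by rewrite cos0 subrr.
  - by rewrite -(normrN s) -cosN H// oppr_gt0.
  - exact: H.
have [c _] := @MVT R cos (fun x => - sin x) 0 s s0 (fun x _ => is_derive_cos x)
  (continuous_subspaceT (@continuous_cos R)).
rewrite cos0 !subr0 => ->; rewrite normrM ler_piMl// normrN ler_norml.
by rewrite sin_geN1 sin_le1.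
Qed.

Lemma normc_le_ReIm z : Normc.normc z <= `|complex.Re z| + `|complex.Im z|.
Proof.
rewrite -(ler_pXn2r (n := 2)) ?nnegrE ?normc_ge0 ?addr_ge0//.
rewrite sqr_normc_real sqrrD !real_normK ?num_real// lerD2r lerDl.
by rewrite mulrn_wge0// mulr_ge0.
Qed.

Lemma normRe_le_normc z : `|complex.Re z| <= Normc.normc z.
Proof.
by rewrite -(ler_pXn2r (n := 2)) ?nnegrE ?normc_ge0// sqr_normc_real
  real_normK ?num_real// lerDl sqr_ge0.
Qed.

Lemma normIm_le_normc z : `|complex.Im z| <= Normc.normc z.
Proof.
by rewrite -(ler_pXn2r (n := 2)) ?nnegrE ?normc_ge0// sqr_normc_real
  real_normK ?num_real// lerDr sqr_ge0.
Qed.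

(** The character [expi2pi] is Lipschitz and kills [Z], so its distance to [1]
    is controlled by the distance to the nearest integer. *)
Lemma normc_expi2pi_sub1_le s :
  Normc.normc (expi2pi s - 1) <= 4 * pi * dist_int s.
Proof.
have h m : Normc.normc (expi2pi s - 1) <= 4 * pi * `|s - m%:~R|.
  have -> : expi2pi s = expi2pi (s - m%:~R).
    by rewrite expi2piD [X in _ * X]expi2pi_int ?mulr1// rpredN intr_int.
  set t := s - _; apply: le_trans (normc_le_ReIm _) _.
  rewrite /expi2pi /= subr0.
  have := abs_cos_sub1_le (2 * pi * t); have := abs_sin_le (2 * pi * t).
  rewrite !normrM (ger0_norm (pi_ge0 R)) ger0_norm//; lra.
have p0 : 0 < 4 * pi :> R by rewrite mulr_gt0// pi_gt0.
rewrite mulrC -ler_pdivrMr//; apply: lb_le_inf; first by exists `|s - 0%:~R|, 0.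
by move=> _ [m _ <-]; rewrite ler_pdivrMr// mulrC h.
Qed.

Lemma dist_int_ge0 s : 0 <= dist_int s.
Proof.
have p0 : 0 < 4 * pi :> R by rewrite mulr_gt0// pi_gt0.
by rewrite -(pmulr_rge0 _ p0); apply: le_trans (normc_ge0 _) (normc_expi2pi_sub1_le s).
Qed.

Lemma dist_int_neq0 s : s \isn't a Num.int -> dist_int s != 0.
Proof.
move=> sN; apply: contra sN => /eqP d0; apply: expi2pi_eq1; apply/eqP.
rewrite -subr_eq0 -[_ == 0]negbK -normc_gt0 -leNgt.
by have := normc_expi2pi_sub1_le s; rewrite d0 mulr0.
Qed.

(** The condition on [w] defines the open sector of one quarter turn around the
    positive half-line; there the argument is the arctangent of the slope. *)
Lemma exists_phase w : `|complex.Im w| < complex.Re w ->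
  exists l, `|l| < 8^-1 /\ w = (Normc.normc w)%:C * expi2pi l.
Proof.
case: w => a b /= hab.
have a0 : 0 < a by apply: le_lt_trans hab.
have p0 := pi_gt0 R.
set th := atan (b / a).
have c0 : 0 < cos th.
  by apply: cos_gt0_pihalf; rewrite atan_gtNpi2 atan_ltpi2.
have st : sin th = cos th * (b / a).
  by rewrite -(atanK (b / a)) -/th /tan mulrC divfK// gt_eqF.
have ba1 : `|b / a| < 1 by rewrite normrM normfV (gtr0_norm a0) ltr_pdivrMr// mul1r.
have t4 : `|th| < pi / 4.
  have h y : y < 1 -> atan y < pi / 4 by rewrite -atan1; exact: lt_atan.
  rewrite ltr_norml; move: ba1; rewrite ltr_norml => /andP[h1 h2]; apply/andP; split; last exact: h.
  by rewrite ltrNl -atanN h// ltrNl.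
exists (th / (2 * pi)); split.
  rewrite normrM normfV (gtr0_norm (x := 2 * pi)) ?mulr_gt0// ltr_pdivrMr ?mulr_gt0//; lra.
have -> : Num.sqrt (a ^+ 2 + b ^+ 2) = a / cos th.
  apply/eqP; rewrite -(eqrXn2 (n := 2)) ?sqrtr_ge0 ?divr_ge0 ?ltW// sqr_sqrtr ?addr_ge0 ?sqr_ge0//.
  have := cos2Dsin2 th; rewrite st => h.
  have ac : a != 0 by rewrite gt_eqF.
  have cn : cos th != 0 by rewrite gt_eqF.
  apply/eqP; rewrite expr_div_n.
  apply: (mulIf (expf_neq0 2 cn)); rewrite divfK ?expf_neq0//.
  rewrite -[RHS]mulr1 -h; field.
  exact: ac.
have cn : cos th != 0 by rewrite gt_eqF.
rewrite /expi2pi mulrC [th / _]mulrC mulrA mulfV ?mul1r ?mulf_neq0 ?gt_eqF//.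
rewrite st; simpc; congr (_ +i* _); field; rewrite ?cn ?gt_eqF//.
Qed.

End Phases.

(** * Topology of the torus *)
Section ContinuousFunctions.
Variables (R : realType) (X : topologicalType).
Implicit Types f g : X -> R.

Lemma contD (W : normedModType R) (f g : X -> W) :
  continuous f -> continuous g -> continuous (fun x => f x + g x).
Proof. by move=> cf cg x; apply: cvgD; [exact: cf|exact: cg]. Qed.

Lemma contN (W : normedModType R) (f : X -> W) :
  continuous f -> continuous (fun x => - f x).
Proof. by move=> cf x; apply: cvgN; exact: cf. Qed.

Lemma contB (W : normedModType R) (f g : X -> W) :
  continuous f -> continuous g -> continuous (fun x => f x - g x).
Proof. by move=> cf cg; apply: contD => //; exact: contN. Qed.

Lemma contM f g : continuous f -> continuous g -> continuous (fun x => f x * g x).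
Proof. by move=> cf cg x; apply: cvgM; [exact: cf|exact: cg]. Qed.

Lemma contZ (W : normedModType R) f (g : X -> W) :
  continuous f -> continuous g -> continuous (fun x => f x *: g x).
Proof. by move=> cf cg x; apply: cvgZ; [exact: cf|exact: cg]. Qed.

Lemma cont_cst (Y : topologicalType) (y : Y) : continuous (fun _ : X => y).
Proof. exact: cst_continuous. Qed.

Lemma cont_id : continuous (fun x : X => x).
Proof. by move=> x; exact: cvg_id. Qed.

Lemma cont_comp (Y Z : topologicalType) (f : X -> Y) (g : Y -> Z) :
  continuous f -> continuous g -> continuous (fun x => g (f x)).
Proof. by move=> cf cg x; apply: continuous_comp; [exact: cf|exact: cg]. Qed.

Lemma cont_sum (W : normedModType R) (I : Type) (r : seq I) (P : pred I) (f : I -> X -> W) :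
  (forall i, continuous (f i)) -> continuous (fun x => \sum_(i <- r | P i) f i x).
Proof. by move=> cf; apply: continuous_big => // -[a b]; exact: add_continuous. Qed.

End ContinuousFunctions.

Section TorusTopology.
Variables (R : realType) (n : nat).
Local Notation V := 'rV[R]_n.
Local Notation T := (torus R n).
Implicit Types (x y : V) (z w : T).

Lemma to_torus_surj z : exists x : V, to_torus x = z.
Proof. by exists (of_torus z); exact: of_torusK. Qed.

Lemma to_torus0 : to_torus 0 = 0 :> T.
Proof. by apply: (addrI (to_torus 0)); rewrite -to_torusD !addr0. Qed.

Lemma to_torusN x : to_torus (- x) = - to_torus x :> T.
Proof. by apply: (addrI (to_torus x)); rewrite -to_torusD !subrr to_torus0. Qed.

Lemma to_torusB x y : to_torus (x - y) = to_torus x - to_torus y :> T.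
Proof. by rewrite to_torusD to_torusN. Qed.

Lemma to_torusMn x k : to_torus (x *+ k) = to_torus x *+ k :> T.
Proof.
elim: k => [|k IH]; first by rewrite !mulr0n to_torus0.
by rewrite !mulrS to_torusD IH.
Qed.

Lemma int_vecN x : int_vec x -> int_vec (- x).
Proof. by move=> hx; rewrite -[int_vec _]/(_ \in int_lattice R n) rpredN. Qed.

Lemma int_vec_zvec (k : 'rV[int]_n) : int_vec (zvec R k).
Proof. by apply/forallP => i; rewrite mxE intr_int. Qed.

Lemma int_vecE x : int_vec x -> exists k : 'rV[int]_n, x = zvec R k.
Proof.
move=> /forallP hx; exists (\row_i Num.floor (x 0 i)).
by apply/rowP => i; rewrite !mxE; apply/esym/eqP; rewrite -intrEfloor.
Qed.

Lemma to_torus_int x : int_vec x -> to_torus x = 0 :> T.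
Proof. by move=> hx; rewrite -to_torus0; apply/to_torus_eq; rewrite subr0. Qed.

Lemma of_to_torus x : int_vec (of_torus (to_torus x) - x).
Proof. by apply/to_torus_eq; rewrite of_torusK. Qed.

Lemma abs_coord_le x i : `|x 0 i| <= `|x|.
Proof.
rewrite [leRHS]/Num.norm/= mx_normrE.
exact: (le_bigmax _ (fun ij : 'I_1 * 'I_n => `|x ij.1 ij.2|) (0, i)).
Qed.

Lemma norm_row_lt x e : 0 < e -> (forall i, `|x 0 i| < e) -> `|x| < e.
Proof.
move=> e0 h; rewrite [ltLHS]/Num.norm/= mx_normrE.
by apply/bigmax_ltP; split=> // -[i j] _ /=; rewrite ord1.
Qed.

Lemma to_torus_open (U : set V) : open U -> open (@to_torus R n @` U).
Proof.
move=> oU; rewrite [open _]/open /= /quotient_open.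
set W := _ @^-1` _.
suff -> : W = \bigcup_(k in [set k : V | int_vec k]) [set x | U (x + k)].
  apply: bigcup_open => k _.
  apply: (@open_comp _ _ (fun x => x + k)) => // x _.
  by apply: contD; [exact: cont_id|exact: cont_cst].
apply/seteqP; split=> x /=.
  move=> [u Uu /to_torus_eq h]; exists (u - x) => //=.
  by rewrite addrC subrK.
move=> [k hk Uk]; exists (x + k) => //.
by rewrite -[RHS]addr0 -[in RHS](to_torus_int hk) -to_torusD.
Qed.

Lemma nbhs_to_torus x (A : set V) : nbhs x A -> nbhs (to_torus x : T) (@to_torus R n @` A).
Proof.
rewrite nbhsE => -[U [oU Ux] UA]; apply: (@filterS _ _ _ (@to_torus R n @` U)).
  exact: image_subset.
by apply: open_nbhs_nbhs; split; [exact: to_torus_open|exists x].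
Qed.

Lemma continuous_torus (Z : topologicalType) (g : T -> Z) :
  continuous (g \o @to_torus R n) -> continuous g.
Proof. by move=> h; apply/quotient_continuous. Qed.

Lemma torusD_continuous w : continuous (fun z => w + z : T).
Proof.
apply: continuous_torus => x; rewrite /comp.
have [y <-] := to_torus_surj w.
have -> : (fun x => to_torus y + to_torus x : T) = @to_torus R n \o (fun x => y + x).
  by apply/funext => u; rewrite /= to_torusD.
apply: continuous_comp; last exact: to_torus_continuous.
by apply: contD; [exact: cont_cst|exact: cont_id].
Qed.

Lemma torusDr_continuous w : continuous (fun z => z + w : T).
Proof.
by rewrite (_ : (fun z => _) = (fun z => w + z)); [exact: torusD_continuous|apply/funext => z; rewrite addrC].
Qed.

Lemma torusN_continuous : continuous (fun z => - z : T).
Proof.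
apply: continuous_torus => x; rewrite /comp.
rewrite (_ : (fun x => - to_torus x) = @to_torus R n \o -%R); last first.
  by apply/funext => u; rewrite /= to_torusN.
by apply: continuous_comp; [exact: opp_continuous|exact: to_torus_continuous].
Qed.

Lemma periodic_of_torus (Z : Type) (g : V -> Z) x :
  (forall x k, int_vec k -> g (x + k) = g x) -> g (of_torus (to_torus x)) = g x.
Proof.
by move=> h; rewrite -[in RHS](h x _ (of_to_torus x)) addrC subrK.
Qed.

Lemma continuous_of_torus (Z : topologicalType) (g : V -> Z) :
  continuous g -> (forall x k, int_vec k -> g (x + k) = g x) ->
  continuous (g \o @of_torus R n).
Proof.
move=> cg pg; apply: continuous_torus.
by rewrite (_ : _ \o _ = g)//; apply/funext => x /=; exact: periodic_of_torus.
Qed.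

Lemma torus_repr_unit z : exists2 x : V, to_torus x = z & forall i, 0 <= x 0 i <= 1.
Proof.
have [y <-] := to_torus_surj z.
exists (\row_i (y 0 i - (Num.floor (y 0 i))%:~R)); last first.
  by move=> i; rewrite mxE subr_ge0 floor_le lerBlDl -intrD1 ltW ?floorD1_gt.
apply/to_torus_eq/forallP => i; rewrite !mxE addrAC subrr add0r.
by rewrite rpredN intr_int.
Qed.

Definition unit_box : set V := [set x | forall i, 0 <= x 0 i <= 1].

Lemma unit_box_compact : compact unit_box.
Proof.
have := @rV_compact R n (fun=> `[0, 1]%classic) (fun=> @segment_compact R 0 1).
by congr (compact _); apply/seteqP; split => x /= h i; have := h i; rewrite in_itv.
Qed.

Lemma torus_compact : compact [set: T].
Proof.
have -> : [set: T] = @to_torus R n @` unit_box.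
  apply/seteqP; split=> // z _; have [x <- hx] := torus_repr_unit z.
  by exists x.
apply: continuous_compact; last exact: unit_box_compact.
exact/continuous_subspaceT/to_torus_continuous.
Qed.

Lemma dotpDl (u v x : V) : dotp (u + v) x = dotp u x + dotp v x.
Proof. by rewrite /dotp -big_split; apply: eq_bigr => i _; rewrite mxE mulrDl. Qed.

Lemma dotpC (u v : V) : dotp u v = dotp v u.
Proof. by apply: eq_bigr => i _; rewrite mulrC. Qed.

Lemma dotpDr (u v x : V) : dotp x (u + v) = dotp x u + dotp x v.
Proof. by rewrite dotpC dotpDl !(dotpC x). Qed.

Lemma dotpNl (u v : V) : dotp (- u) v = - dotp u v.
Proof. by rewrite /dotp -sumrN; apply: eq_bigr => i _; rewrite mxE mulNr. Qed.

Lemma dotpNr (u v : V) : dotp u (- v) = - dotp u v.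
Proof. by rewrite dotpC dotpNl dotpC. Qed.

Lemma dotpZl a (u v : V) : dotp (a *: u) v = a * dotp u v.
Proof. by rewrite /dotp big_distrr; apply: eq_bigr => i _; rewrite mxE -mulrA. Qed.

Lemma dotpZr a (u v : V) : dotp u (a *: v) = a * dotp u v.
Proof. by rewrite dotpC dotpZl dotpC. Qed.

Lemma dotp0r (u : V) : dotp u 0 = 0.
Proof. by rewrite /dotp big1// => i _; rewrite mxE mulr0. Qed.

Lemma dotp_delta (u : V) i : dotp u (delta_mx 0 i) = u 0 i.
Proof.
rewrite /dotp (bigD1 i)//= mxE !eqxx mulr1 big1 ?addr0// => j /negPf ji.
by rewrite mxE ji andbF mulr0.
Qed.

Lemma dotp_int (u v : V) : int_vec u -> int_vec v -> dotp u v \is a Num.int.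
Proof.
move=> /forallP hu /forallP hv; apply: rpred_sum => i _; exact: rpredM.
Qed.

Lemma dotp_continuous (u : V) : continuous (dotp u).
Proof.
apply: cont_sum => i.
by apply: contM; [exact: cont_cst|exact: coord_continuous].
Qed.

Lemma continuous_cos2pi (g : V -> R) : continuous g -> continuous (fun x => complex.Re (expi2pi (g x))).
Proof.
move=> cg; apply: (cont_comp (f := fun x => 2 * pi * g x)); last exact: continuous_cos.
by apply: contM => //; exact: cont_cst.
Qed.

Lemma continuous_sin2pi (g : V -> R) : continuous g -> continuous (fun x => complex.Im (expi2pi (g x))).
Proof.
move=> cg; apply: (cont_comp (f := fun x => 2 * pi * g x)); last exact: continuous_sin.
by apply: contM => //; exact: cont_cst.
Qed.

Lemma expi2pi_dotp_periodic (u x k : V) : int_vec u -> int_vec k ->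
  expi2pi (dotp u (x + k)) = expi2pi (dotp u x).
Proof. by move=> hu hk; rewrite dotpDr expi2piD [X in _ * X]expi2pi_int ?mulr1// dotp_int. Qed.

(** The coordinate characters are continuous and separate the points. *)
Lemma torus_hausdorff : hausdorff_space T.
Proof.
move=> z w; have [x <-] := to_torus_surj z; have [y <-] := to_torus_surj w => clu.
have sep (f : T -> R) : continuous f -> f (to_torus x) = f (to_torus y).
  move=> cf; apply: (@Rhausdorff R) => A B fA fB.
  have [u [Au Bu]] := clu _ _ (cf _ _ fA) (cf _ _ fB).
  by exists (f u).
apply/to_torus_eq/forallP => i; rewrite !mxE.
pose e : V := delta_mx 0 i.
have he : int_vec e by apply/forallP => j; rewrite mxE natr_int.
pose c (v : V) := expi2pi (dotp e v).
have per v k : int_vec k -> c (v + k) = c v by exact: expi2pi_dotp_periodic.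
have pc (v : V) : c (of_torus (to_torus v)) = c v by exact: periodic_of_torus.
have hre : complex.Re (c x) = complex.Re (c y).
  rewrite -(pc x) -(pc y); apply: (sep (fun z => complex.Re (c (of_torus z)))).
  apply: (@continuous_of_torus _ (fun v => complex.Re (c v))) => [|v k hk]; last by rewrite per.
  exact/continuous_cos2pi/dotp_continuous.
have him : complex.Im (c x) = complex.Im (c y).
  rewrite -(pc x) -(pc y); apply: (sep (fun z => complex.Im (c (of_torus z)))).
  apply: (@continuous_of_torus _ (fun v => complex.Im (c v))) => [|v k hk]; last by rewrite per.
  exact/continuous_sin2pi/dotp_continuous.
have cxy : c x = c y by move: hre him; case: (c x) (c y) => ? ? [? ?] /= -> ->.
apply: expi2pi_eq1; have -> : x 0 i - y 0 i = dotp e x - dotp e y.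
  by rewrite !(dotpC e) !dotp_delta.
rewrite expi2piD -/(c x) cxy /c -expi2piD subrr; exact: expi2pi0.
Qed.

(** By compactness two of the multiples of an element are close, and so some
    positive multiple is close to the identity. *)
Lemma torus_recurrence z (A : set T) : nbhs (0 : T) A -> exists k, A (z *+ k.+1).
Proof.
move=> A0.
have [c [_ hc]] : [set: T] `&` cluster ((fun k => z *+ k) @ \oo) !=set0.
  by apply: torus_compact; exact: filterT.
have [x ex] := to_torus_surj c.
have : nbhs (0 : V) (@to_torus R n @^-1` A).
  by apply: to_torus_continuous; rewrite to_torus0.
move=> /nbhs_ballP[e /= e0 eA].
set U := @to_torus R n @` ball x (e / 2).
have U1 : nbhs c U by rewrite -ex; apply/nbhs_to_torus/nbhsx_ballx; rewrite divr_gt0.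
have hit N : exists2 k, (N <= k)%N & U (z *+ k).
  have [|_ [[k /= Nk <-] Uk]] := hc [set z *+ k | k in [set k | (N <= k)%N]] U _ U1.
    by exists N => // k /= Nk; exists k.
  by exists k.
have [k1 _ [x1 bx1 e1]] := hit 0%N; have [k2 k12 [x2 bx2 e2]] := hit k1.+1.
exists (k2 - k1).-1; rewrite prednK ?subn_gt0//.
have -> : z *+ (k2 - k1) = to_torus (x2 - x1).
  by rewrite to_torusB e1 e2 mulrnBr// ltnW.
apply: eA; rewrite -ball_normE /= sub0r normrN.
have -> : x2 - x1 = (x - x1) - (x - x2) by rewrite opprB [RHS]addrC subrKA.
apply: le_lt_trans (ler_normB _ _) _; rewrite (splitr e).
by apply: ltrD; move: bx1 bx2; rewrite -!ball_normE.
Qed.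

End TorusTopology.

(** * Closed subgroups and orbit closures *)
Section OrbitClosure.
Variables (R : realType) (n : nat).
Local Notation T := (torus R n).
Implicit Types (z w g h : T) (H K Z : set T).

Definition additive_subgroup H :=
  [/\ H 0, forall z w, H z -> H w -> H (z + w) & forall z, H z -> H (- z)].

Lemma subgroup_mulrn H z k : additive_subgroup H -> H z -> H (z *+ k).
Proof.
move=> [H0 HD _] Hz; elim: k => [|k IH]; first by rewrite mulr0n.
by rewrite mulrS; exact: HD.
Qed.

Lemma closed_translate Z w : closed Z -> closed [set z | Z (w + z)].
Proof.
by move=> cZ; have /continuous_closedP := @torusD_continuous R n w; apply.
Qed.

Lemma closure_sub_closed (S Z : set T) : closed Z -> S `<=` Z -> closure S `<=` Z.
Proof. by move=> cZ SZ; rewrite [Z](proj1 (closure_id Z) cZ); exact: closure_subset. Qed.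

(** By recurrence the inverse of [g] is a limit of positive multiples of [g], so
    stability under [g] already gives stability under the group it generates. *)
Lemma orbit_closure_stable g Z : closed Z -> (forall z, Z z -> Z (z + g)) ->
  forall z h, Z z -> orbit_closure g h -> Z (z + h).
Proof.
move=> cZ sZ; pose A := [set w | forall z, Z z -> Z (z + w)].
have A0 : A 0 by move=> z; rewrite addr0.
have AD w1 w2 : A w1 -> A w2 -> A (w1 + w2).
  by move=> h1 h2 z Zz; rewrite addrA; apply/h2/h1.
have Ak k : A (g *+ k).
  elim: k => [|k IH]; first by rewrite mulr0n.
  by rewrite mulrSr; exact: AD.
have cA : closed A.
  have -> : A = \bigcap_(z in Z) [set w | Z (z + w)] by [].
  by apply: closed_bigI => z _; exact: closed_translate.
have AN : A (- g).
  apply: cA => B nB.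
  have : nbhs (0 : T) [set z | B (- g + z)].
    by apply: (@torusD_continuous _ _ (- g) 0); rewrite addr0.
  move=> /(torus_recurrence g)[k /= Bk].
  by exists (g *+ k); split; [exact: Ak|move: Bk; rewrite mulrS addKr].
have ANk k : A (- g *+ k).
  elim: k => [|k IH]; first by rewrite mulr0n.
  by rewrite mulrSr; exact: AD.
move=> z h Zz Hh; suff : A h by exact.
move: h Hh; apply: closure_sub_closed => // _ [[k|k] _ <-].
  by rewrite -pmulrn.
by rewrite NegzE mulrNz -pmulrn -mulNrn.
Qed.

Lemma orbit_closure_closed g : closed (orbit_closure g).
Proof. exact: closed_closure. Qed.

Lemma orbit_sub g (k : int) : orbit_closure g (g *~ k).
Proof. by apply: subset_closure; exists k. Qed.

Lemma orbit_closure_gen g : orbit_closure g g.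
Proof. by rewrite -[X in orbit_closure _ X]mulr1z; exact: orbit_sub. Qed.

Lemma orbit_closure_subgroup g : additive_subgroup (orbit_closure g).
Proof.
have c0 := @orbit_closure_closed g.
split; first by rewrite -(mulr0z g); exact: orbit_sub.
- move=> z w Hz; apply: orbit_closure_stable => // {z}Hz.
  suff : orbit_closure g `<=` [set z | orbit_closure g (g + z)].
    by move=> h; rewrite addrC; apply: h; exact: Hz.
  apply: closure_sub_closed; first exact: closed_translate.
  move=> _ [k _ <-] /=; have -> : g + g *~ k = g *~ (1 + k) by rewrite mulrzDr mulr1z.
  exact: orbit_sub.
- suff : orbit_closure g `<=` [set z | orbit_closure g (- z)] by apply.
  apply: closure_sub_closed.
    by have /continuous_closedP := @torusN_continuous R n; apply; exact: orbit_closure_closed.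
  by move=> _ [k _ <-] /=; rewrite -mulrNz; exact: orbit_sub.
Qed.

Section IdentityComponent.
Variable H : set T.
Hypotheses (cH : closed H) (sH : additive_subgroup H).
Local Notation H0 := (identity_component H).

Lemma identity_component_sub : H0 `<=` H.
Proof. exact: connected_component_sub. Qed.

Lemma identity_component_closed : closed H0.
Proof. exact: component_closed. Qed.

Lemma identity_component_subgroup : additive_subgroup H0.
Proof.
have [HO HD HN] := sH.
have o0 : H0 0 by exact: connected_component_refl.
split=> //.
  move=> z w hz hw.
  have : [set z + u | u in H0] `<=` connected_component H z.
    apply: connected_component_max.
    - by exists 0; rewrite ?addr0.
    - move=> _ [u hu <-]; apply: HD; exact: identity_component_sub.
    - apply: connected_continuous_connected; first exact: component_connected.
      exact/continuous_subspaceT/torusD_continuous.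
  move=> sub; have : connected_component H z (z + w) by apply: sub; exists w.
  by rewrite -(same_connected_component hz).
move=> z hz.
have : [set - u | u in H0] `<=` H0.
  apply: connected_component_max.
  - by exists 0; rewrite ?oppr0.
  - move=> _ [u hu <-]; apply: HN; exact: identity_component_sub.
  - apply: connected_continuous_connected; first exact: component_connected.
    exact/continuous_subspaceT/torusN_continuous.
by apply; exists z.
Qed.

(** A subgroup that is a neighbourhood of the identity in [H] is open in [H], and
    closed as the complement of its other cosets. *)
Lemma identity_component_min K (U : set T) : additive_subgroup K -> K `<=` H ->
  nbhs (0 : T) U -> H `&` U `<=` K -> H0 `<=` K.
Proof.
have [HO HD HN] := sH.
move=> [K0 KD KN] KH; rewrite nbhsE => -[W [oW W0] WU] HUK.
have HW u : H u -> W u -> K u by move=> Hu Wu; apply: HUK; split => //; exact: WU.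
pose tr (A : set T) := \bigcup_(a in A) [set z | W (- a + z)].
have otr A : open (tr A).
  apply: bigcup_open => a _.
  by have /continuousP := @torusD_continuous R n (- a); apply.
have trs A : A `<=` tr A by move=> a Aa; exists a => //=; rewrite addNr.
have H0H := identity_component_sub.
have HB a z : H a -> H z -> W (- a + z) -> K (- a + z).
  by move=> Ha Hz; apply: HW; apply: HD => //; exact: HN.
have e1 : H0 `&` K = H0 `&` tr K.
  apply/seteqP; split=> z [h k]; split=> //; first exact: trs.
  case: k => a Ka /= Wz; rewrite -(addNKr a z); apply: KD => //.
  by apply: HB => //; [exact: KH|exact: H0H].
have e2 : H0 `&` K = H0 `&` ~` tr (H `\` K).
  apply/seteqP; split=> z [h k]; split=> //.
    move=> [a [Ha Ka] /= Wz]; apply: Ka.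
    rewrite -[a]opprK -(addrK z (- a)) opprD opprK addrC.
    by apply: KD => //; apply/KN/HB => //; exact: H0H.
  by apply: contrapT => Kz; apply: k; apply: trs; split => //; exact: H0H.
have -> : H0 = H0 `&` K.
  apply/esym/component_connected.
  - by exists 0; split => //; exact: connected_component_refl.
  - by exists (tr K).
  - by exists (~` tr (H `\` K)) => //; exact: open_closedC.
by move=> z [].
Qed.

End IdentityComponent.

(** Finitely many cosets cover the orbit closure as soon as they cover the orbit. *)
Lemma cosets_cover g K e : closed K -> additive_subgroup K -> (0 < e)%N -> K (g *+ e) ->
  forall h, orbit_closure g h -> exists j, (j < e)%N /\ K (- (g *+ j) + h).
Proof.
move=> cK [K0 KD KN] e0 Ke h Hh.
pose Z := \bigcup_(j in `I_e) [set z | K (- (g *+ j) + z)].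
have cZ : closed Z by apply: closed_bigcup => // j _; exact: closed_translate.
have Z0 : Z 0 by exists 0%N => //=; rewrite mulr0n oppr0 addr0.
have sZ z : Z z -> Z (z + g).
  move=> [j /= je Kz]; have [je'|] := ltnP j.+1 e.
    by exists j.+1 => //=; rewrite mulrSr opprD -addrA (addrCA (- g)) addrA addNr addr0.
  move=> ej; have ee : e = j.+1 by apply/eqP; rewrite eqn_leq je ej.
  exists 0%N => //=; rewrite mulr0n oppr0 add0r.
  have -> : z + g = g *+ e + (- (g *+ j) + z).
    by rewrite ee mulrSr addrAC addrA addrN add0r.
  exact: KD.
have [j /= je Kj] := orbit_closure_stable cZ sZ Z0 Hh.
by exists j; split=> //; move: Kj; rewrite add0r.
Qed.

(** The class of [g] generates the quotient of the orbit closure by [K], which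
    has [m] elements, so its order is [m] and its first [m] multiples
    represent all the cosets. *)
Lemma cosets_orbit_closure g K m : closed K -> additive_subgroup K ->
  (cosets (orbit_closure g) K #= `I_m)%card ->
  K (g *+ m) /\
  forall h, orbit_closure g h -> exists j k, [/\ (j < m)%N, K k & h = g *+ j + k].
Proof.
move=> cK [K0 KD KN] card_m.
set H := orbit_closure g.
have [HO HD HN] := orbit_closure_subgroup g.
pose C z := [set z + k | k in K].
have Ceq z w : C z = C w -> K (z - w).
  move=> e; have : C z z by exists 0; rewrite ?addr0.
  by rewrite e => -[k Kk <-]; rewrite addrC addKr.
have Hm j : H (g *+ j) by exact: (subgroup_mulrn j (orbit_closure_subgroup g) (orbit_closure_gen (g := g))).
have [d d0 /andP[dm Kd]] : exists2 d, (0 < d)%N & (d <= m)%N && `[<K (g *+ d)>].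
  apply: contrapT => hN.
  have inj : {in `I_m.+1 &, injective (fun j => C (g *+ j))}.
    move=> i j; rewrite !inE /= !ltnS => im jm e.
    wlog ij : i j im jm e / (i <= j)%N => [hw|].
      by case/orP: (leq_total i j) => ij; [|apply/esym]; apply: hw.
    apply/eqP; rewrite eqn_leq ij /= leqNgt; apply/negP => lij; apply: hN.
    exists (j - i)%N; first by rewrite subn_gt0.
    rewrite (leq_trans (leq_subr _ _) jm); apply/asboolP; rewrite mulrnBr//.
    exact/Ceq/esym.
  have : (`I_m.+1 #<= `I_m)%card.
    rewrite -(card_le_eqr card_m) -(card_le_eql (inj_card_eq inj)).
    apply: subset_card_le => _ [j _ <-].
    by exists (g *+ j) => //; exact: Hm.
  by rewrite card_le_II ltnn.
pose P d := (0 < d)%N && `[<K (g *+ d)>].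
have exP : exists d, P d by exists d; rewrite /P d0 Kd.
case: (ex_minnP exP) => e /andP[e0 /asboolP Ke] emin.
have em : (e <= m)%N by apply: leq_trans dm; apply: emin; rewrite /P d0 Kd.
have cov h : H h -> exists j k, [/\ (j < e)%N, K k & h = g *+ j + k].
  move=> Hh; have [j [je Kj]] := cosets_cover cK (And3 K0 KD KN) e0 Ke Hh.
  by exists j, (- (g *+ j) + h); split=> //; rewrite addNKr.
have -> : m = e.
  apply/eqP; rewrite eqn_leq em andbT -card_le_II -(card_le_eql card_m).
  apply: (@card_le_trans _ _ _ [set C (g *+ j) | j in `I_e]); last exact: card_image_le.
  apply: subset_card_le => _ [h Hh <-].
  have [j [k [je Kk ->]]] := cov h Hh; exists j => //.
  apply/seteqP; split=> _ [k' Kk' <-].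
    exists (- k + k'); first by apply: KD => //; exact: KN.
    by rewrite -addrA addNKr.
  by exists (k + k'); [exact: KD|rewrite addrA].
by split.
Qed.

End OrbitClosure.

(** * Curvature of a quasi-periodic function *)
Section ComplexContinuity.
Variables (R : realType) (X : topologicalType).
Implicit Types g h : X -> R[i].

(** Continuity of a complex function is expressed through its real coordinates,
    where all the analysis takes place. *)
Definition ccont g :=
  continuous (fun x => complex.Re (g x)) /\ continuous (fun x => complex.Im (g x)).

Lemma ccontM g h : ccont g -> ccont h -> ccont (fun x => g x * h x).
Proof.
move=> [gr gi] [hr hi].
have e x : g x * h x = (complex.Re (g x) * complex.Re (h x) - complex.Im (g x) * complex.Im (h x))
   +i* (complex.Re (g x) * complex.Im (h x) + complex.Im (g x) * complex.Re (h x)).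
  by case: (g x) (h x) => a b [c e].
split.
- rewrite (_ : (fun x => _) = fun x => complex.Re (g x) * complex.Re (h x) - complex.Im (g x) * complex.Im (h x)); last by apply/funext => x; rewrite e.
  by apply: contB; exact: contM.
- rewrite (_ : (fun x => _) = fun x => complex.Re (g x) * complex.Im (h x) + complex.Im (g x) * complex.Re (h x)); last by apply/funext => x; rewrite e.
  by apply: contD; exact: contM.
Qed.

Lemma ccontJ g : ccont g -> ccont (fun x => (g x)^*%C).
Proof.
move=> [gr gi]; split.
- by rewrite (_ : (fun x => _) = fun x => complex.Re (g x))//; apply/funext => x; case: (g x).
- rewrite (_ : (fun x => _) = fun x => - complex.Im (g x)); first exact: contN.
  by apply/funext => x; case: (g x).
Qed.

Lemma ccont_expi2pi (h : X -> R) : continuous h -> ccont (fun x => expi2pi (h x)).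
Proof.
move=> ch; have ch2 : continuous (fun x => 2 * pi * h x) by apply: contM => //; exact: cont_cst.
split.
- by apply: (cont_comp (f := fun x => 2 * pi * h x)); last exact: continuous_cos.
- by apply: (cont_comp (f := fun x => 2 * pi * h x)); last exact: continuous_sin.
Qed.

Lemma ccont_normc g : ccont g -> continuous (fun x => Normc.normc (g x)).
Proof.
move=> [gr gi].
rewrite (_ : (fun x => _) = fun x => Num.sqrt (complex.Re (g x) * complex.Re (g x) + complex.Im (g x) * complex.Im (g x))); last first.
  by apply/funext => x; case: (g x) => a b; rewrite /= -!expr2.
apply: cont_comp; last exact: sqrt_continuous.
by apply: contD; exact: contM.
Qed.

End ComplexContinuity.

Lemma ccont_comp (R : realType) (X Y : topologicalType) (f : X -> Y) (g : Y -> R[i]) :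
  continuous f -> ccont g -> ccont (fun x => g (f x)).
Proof.
move=> cf [gr gi]; split.
- exact: (cont_comp (g := fun y => complex.Re (g y))).
- exact: (cont_comp (g := fun y => complex.Im (g y))).
Qed.

Section Curvature.
Variables (R : realType) (d : nat).
Local Notation V := 'rV[R]_(d + d).
Implicit Types (z u v k : V) (F : V -> R[i]).

(** The functional equation of Zak transforms: [F] is a section of a line bundle
    over the torus. *)
Definition quasi_periodic F := forall z k, int_vec k ->
  F (z + k) = expi2pi (dotp (rsubmx z) (lsubmx k)) * F z.

(** The standard symplectic form, which is the curvature of the line bundle. *)
Definition symp v u := dotp (rsubmx v) (lsubmx u) - dotp (rsubmx u) (lsubmx v).

(** A discrete parallel transport: the argument of the first two factors is the
    change of phase of [F] from [z] to [z + v], and the character makes the product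
    periodic in [z]. *)
Definition link F z v :=
  F (z + v) * (F z)^*%C * expi2pi (- dotp (rsubmx v) (lsubmx z)).

(** The argument of [w], in turns, chosen in the sector where it is determined
    by [w]; elsewhere any bounded value serves. *)
Definition phase (w : R[i]) : R :=
  xget 0 [set l | `|l| < 8^-1 /\ w = (Normc.normc w)%:C * expi2pi l].

Lemma phaseP w : `|complex.Im w| < complex.Re w ->
  `|phase w| < 8^-1 /\ w = (Normc.normc w)%:C * expi2pi (phase w).
Proof. move=> /exists_phase[l hl].
exact: (@xgetPex R 0 [set l | `|l| < 8^-1 /\ w = (Normc.normc w)%:C * expi2pi l] (ex_intro _ l hl)). Qed.

Lemma phase_lt w : `|phase w| < 8^-1.
Proof. by rewrite /phase; case: xgetP => [l _ []//|_]; rewrite normr0. Qed.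

Lemma int_vec_lsub k : int_vec k -> int_vec (lsubmx k).
Proof. by move=> /forallP h; apply/forallP => i; rewrite mxE. Qed.

Lemma int_vec_rsub k : int_vec k -> int_vec (rsubmx k).
Proof. by move=> /forallP h; apply/forallP => i; rewrite mxE. Qed.

Lemma lsubmxD z v : lsubmx (z + v) = lsubmx z + lsubmx v.
Proof. by apply/rowP => i; rewrite !mxE. Qed.

Lemma rsubmxD z v : rsubmx (z + v) = rsubmx z + rsubmx v.
Proof. by apply/rowP => i; rewrite !mxE. Qed.

Lemma lsubmxZ (s : R) v : lsubmx (s *: v) = s *: lsubmx v.
Proof. by apply/rowP => i; rewrite !mxE. Qed.

Lemma rsubmxZ (s : R) v : rsubmx (s *: v) = s *: rsubmx v.
Proof. by apply/rowP => i; rewrite !mxE. Qed.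

Lemma sympZl (s : R) v u : symp (s *: v) u = s * symp v u.
Proof. by rewrite /symp lsubmxZ rsubmxZ dotpZl dotpZr mulrBr. Qed.

Lemma sympDr v u1 u2 : symp v (u1 + u2) = symp v u1 + symp v u2.
Proof. by rewrite /symp lsubmxD rsubmxD dotpDl dotpDr opprD addrACA. Qed.

Lemma sympC v u : symp v u = - symp u v.
Proof. by rewrite /symp opprB. Qed.

Lemma conjcM (a b : R[i]) : (a * b)^*%C = a^*%C * b^*%C.
Proof. by case: a b => a1 a2 [b1 b2]; simpc; congr (_ +i* _); rewrite ?opprD. Qed.

Lemma realcM (a b : R) : (a * b)%:C = a%:C * b%:C :> R[i].
Proof. exact: (rmorphM (real_complex R)). Qed.

Lemma link_periodic F z v k : quasi_periodic F -> int_vec k ->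
  link F (z + k) v = link F z v.
Proof.
move=> qp hk; rewrite /link addrAC (qp (z + v) k hk) (qp z k hk) conjcM -expi2piN rsubmxD lsubmxD.
rewrite dotpDl dotpDr opprD !expi2piD.
set A := expi2pi (dotp (rsubmx z) _); set B := expi2pi (dotp (rsubmx v) _).
set A' := expi2pi (- dotp _ _); set C := expi2pi _; set B' := expi2pi _.
have hA : A * A' = 1 by rewrite -expi2piD subrr expi2pi0.
have hB : B * B' = 1 by rewrite -expi2piD subrr expi2pi0.
transitivity ((A * A') * (B * B') * (F (z + v) * (F z)^*%C * C)); first by ring.
by rewrite hA hB !mul1r.
Qed.

Lemma link0 F z : link F z 0 = (Normc.normc (F z) ^+ 2)%:C.
Proof.
rewrite /link addr0 mulc_conj (_ : rsubmx 0 = 0); last by apply/rowP => i; rewrite !mxE.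
by rewrite dotpC dotp0r oppr0 expi2pi0 mulr1.
Qed.

Lemma int_small (s : R) : s \is a Num.int -> `|s| < 1 -> s = 0.
Proof. by move=> /intrP[k ->]; rewrite -intr_norm ltrz1; case: k => [[|k]|k]. Qed.

Lemma realcM_inj (a b : R) (v w : R[i]) : 0 < a -> 0 < b ->
  Normc.normc v = 1 -> Normc.normc w = 1 -> a%:C * v = b%:C * w -> v = w.
Proof.
move=> a0 b0 v1 w1 e.
have nr c : 0 < c -> Normc.normc c%:C = c.
  by move=> c0; rewrite /= expr0n addr0 sqrtr_sqr gtr0_norm.
have ab : a = b.
  by have := congr1 (@Normc.normc R) e; rewrite !Normc.normcM !nr// v1 w1 !mulr1.
move: e; rewrite ab => /mulfI; apply.
by rewrite -normc_gt0 nr.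
Qed.

(** Around a small parallelogram the phases add up to its symplectic area: the
    line bundle has constant curvature.  The moduli cancel, so the equality
    holds modulo integers, and smallness makes it exact. *)
Lemma plaquette F z u v (ok := fun z v => `|complex.Im (link F z v)| < complex.Re (link F z v)) :
  F z != 0 -> F (z + u) != 0 -> F (z + v) != 0 -> F (z + v + u) != 0 ->
  ok z v -> ok (z + v) u -> ok (z + u) v -> ok z u -> `|symp v u| < 2^-1 ->
  phase (link F (z + u) v) - phase (link F z v) =
  phase (link F (z + v) u) - phase (link F z u) - symp v u.
Proof.
move=> F0 F1 F2 F3 /phaseP[s1 e1] /phaseP[s2 e2] /phaseP[s3 e3] /phaseP[s4 e4] s5.
have prod : link F z v * link F (z + v) u * (link F (z + u) v)^*%C * (link F z u)^*%C =
    ((Normc.normc (F z) ^+ 2) * (Normc.normc (F (z + u)) ^+ 2) *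
     (Normc.normc (F (z + v)) ^+ 2) * (Normc.normc (F (z + v + u)) ^+ 2))%:C * expi2pi (symp v u).
  rewrite 3!realcM -!mulc_conj /link !conjcM !conjcK -!expi2piN !opprK (addrAC z u v).
  have -> : symp v u = - dotp (rsubmx v) (lsubmx z) + (- dotp (rsubmx u) (lsubmx (z + v)) +
      (dotp (rsubmx v) (lsubmx (z + u)) + dotp (rsubmx u) (lsubmx z))).
    rewrite /symp !lsubmxD !dotpDr; ring.
  rewrite !expi2piD; ring.
have n0 w : F w != 0 -> 0 < Normc.normc (F w) by rewrite normc_gt0.
have lk w w' : F w != 0 -> F (w + w') != 0 -> 0 < Normc.normc (link F w w').
  move=> Fw Fw'; rewrite normc_gt0 /link !mulf_neq0 ?expi2pi_neq0//.
  by rewrite conjc_eq0.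
set l1 := phase _ in s1 e1 *; set l2 := phase _ in s2 e2 *.
set l3 := phase _ in s3 e3 *; set l4 := phase _ in s4 e4 *.
have lhs : link F z v * link F (z + v) u * (link F (z + u) v)^*%C * (link F z u)^*%C =
  (Normc.normc (link F z v) * Normc.normc (link F (z + v) u) *
   Normc.normc (link F (z + u) v) * Normc.normc (link F z u))%:C * expi2pi (l1 + l2 - l3 - l4).
  rewrite {1}e1 {1}e2 {1}e3 {1}e4 !conjcM -!expi2piN !conjc_real !realcM !expi2piD.
  ring.
have F3' : F (z + u + v) != 0 by rewrite addrAC.
have eq : expi2pi (l1 + l2 - l3 - l4) = expi2pi (symp v u).
  apply: (realcM_inj _ _ _ _ (etrans (esym lhs) prod)); rewrite ?normc_expi2pi//.
  - by rewrite !mulr_gt0// lk.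
  - have q w : F w != 0 -> 0 < Normc.normc (F w) ^+ 2 by move=> Fw; exact: exprn_gt0 (n0 w Fw).
    exact: (mulr_gt0 (mulr_gt0 (mulr_gt0 (q _ F0) (q _ F1)) (q _ F2)) (q _ F3)).
have : l1 + l2 - l3 - l4 - symp v u = 0.
  apply: int_small.
    by apply: expi2pi_eq1; rewrite expi2piD eq -expi2piD subrr expi2pi0.
  move: s1 s2 s3 s4 s5; rewrite !ltr_norml; lra.
lra.
Qed.

Lemma cont_dotp_sub (X : topologicalType) (f g : X -> V) :
  continuous f -> continuous g ->
  continuous (fun x => dotp (rsubmx (f x)) (lsubmx (g x))).
Proof.
move=> cf cg.
rewrite (_ : (fun x => _) = fun x => \sum_i f x 0 (rshift d i) * g x 0 (lshift d i)); last first.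
  by apply/funext => x; apply: eq_bigr => i _; rewrite !mxE.
apply: cont_sum => i; apply: contM.
- by apply: (cont_comp (g := fun z : V => z 0 (rshift d i)) cf); exact: coord_continuous.
- by apply: (cont_comp (g := fun z : V => z 0 (lshift d i)) cg); exact: coord_continuous.
Qed.

Lemma link_ccont F : ccont F -> ccont (fun p : V * V => link F p.1 p.2).
Proof.
move=> cF; have c1 : continuous (fun p : V * V => p.1) by move=> p; exact: cvg_fst.
have c2 : continuous (fun p : V * V => p.2) by move=> p; exact: cvg_snd.
apply: ccontM; first apply: ccontM.
- by apply: ccont_comp cF; exact: contD.
- by apply: ccontJ; exact: ccont_comp cF.
- by apply: ccont_expi2pi; apply: (contN (W := R)); exact: cont_dotp_sub.
Qed.

(** Uniformity comes from compactness of the unit box, the link being periodic. *)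
Lemma small_link F (D : set V) : ccont F -> quasi_periodic F -> closed D ->
  (forall z k, D z -> int_vec k -> D (z + k)) -> (forall z, D z -> F z != 0) ->
  exists2 e : R, 0 < e & forall z v, D z -> `|v| < e ->
    `|complex.Im (link F z v)| < complex.Re (link F z v).
Proof.
move=> cF qp cD DZ DF.
pose K : set V := @unit_box R (d + d) `&` D.
have cK : compact K by apply: compact_closedI => //; exact: unit_box_compact.
pose P (v z : V) := `|complex.Im (link F z v)| < complex.Re (link F z v).
have : \forall v \near (0 : V), K `<=` P v.
  apply: ((proj1 (compact_near_coveringP _) cK) V (nbhs (0 : V)) P) => z [_ Dz].
  have [cr ci] := link_ccont cF.
  pose G (p : V * V) := complex.Re (link F p.1 p.2) - `|complex.Im (link F p.1 p.2)|.
  have cG : continuous G.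
    apply: contB => //; apply: cont_comp ci _; exact: norm_continuous.
  have G0 : 0 < G (z, 0).
    by rewrite /G /= link0 /= normr0 subr0 exprn_gt0// normc_gt0 DF.
  have : \forall p \near (z, 0 : V), 0 < G p.
    exact: (cG (z, 0) _ (lt_nbhsr G0)).
  by apply: filterS => -[z' v]; rewrite /G /P /= subr_gt0.
move=> /nbhs_ballP[e /= e0 he]; exists e => // z v Dz ve.
have [x xz ux] := torus_repr_unit (to_torus z).
have hk : int_vec (z - x) by apply/to_torus_eq.
have ez : z = x + (z - x) by rewrite addrC subrK.
rewrite ez link_periodic//; apply: he; last first.
  split=> //; have -> : x = z + - (z - x) by rewrite opprB addrC subrK.
  by apply: DZ => //; exact: int_vecN.
by rewrite -ball_normE /= sub0r normrN.
Qed.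

(** If [F] has no zero on a coset of [G], transporting it along the closed loop
    [s |-> s a] changes the total phase by [symp a u] whenever the loop is moved
    by a small [u]; the total phase being bounded, this change is zero. *)
Lemma curvature_vanishes F (G : set V) z0 a : ccont F -> quasi_periodic F ->
  closed [set z | G (z - z0)] ->
  (forall k, int_vec k -> G k) -> (forall u v, G u -> G v -> G (u + v)) ->
  (forall u, G u -> F (z0 + u) != 0) ->
  int_vec a -> (forall s : R, G (s *: a)) ->
  exists2 e : R, 0 < e & forall u, G u -> `|u| < e -> symp a u = 0.
Proof.
move=> cF qp cG GZ GD GF hZa Ga.
have [e e0 he] : exists2 e : R, 0 < e & forall z v, G (z - z0) -> `|v| < e ->
    `|complex.Im (link F z v)| < complex.Re (link F z v).
  apply: (small_link cF qp cG) => [z k Gz hk|z Gz] /=.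
    by rewrite addrAC; apply: GD => //; exact: GZ.
  by have := GF _ Gz; rewrite addrC subrK.
have [N N0 Ne] : exists2 N : nat, (0 < N)%N & `|a| / N%:R < e.
  exists (Num.truncn (`|a| / e)).+1 => //.
  rewrite ltr_pdivrMr// mulrC -ltr_pdivrMr//; exact: truncnS_gt.
pose v := N%:R^-1 *: a.
have Nv : N%:R *: v = a by rewrite scalerA mulfV ?scale1r// pnatr_eq0 -lt0n.
have ve : `|v| < e by rewrite normrZ ger0_norm ?invr_ge0// mulrC.
have Gj (j : nat) : G (v *+ j) by rewrite -scaler_nat scalerA; exact: Ga.
have Gv : G v by rewrite -[v]mulr1n; exact: Gj.
have csy : continuous (symp v).
  apply: (contB (W := R)); apply: cont_dotp_sub; by [exact: cont_cst|exact: cont_id].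
have : \forall u \near (0 : V), `|u| < e /\ `|symp v u| < 2^-1.
  apply: filterI.
    apply/nbhs_ballP; exists e => //= u; by rewrite -ball_normE /= sub0r normrN.
  have h0 : `|symp v 0| < 2^-1.
    have -> : symp v 0 = 0 by have := sympDr v 0 0; rewrite addr0 => /eqP; rewrite -subr_eq subrr => /eqP.
    by rewrite normr0 invr_gt0.
  have ca : continuous (fun u => `|symp v u|).
    by apply: cont_comp csy _; exact: norm_continuous.
  by move/cvgr_lt: (ca 0); apply.
move=> /nbhs_ballP[e' /= e'0 he']; exists e' => // u Gu ue.
have [ue1 sv] : `|u| < e /\ `|symp v u| < 2^-1.
  by apply: he'; rewrite -ball_normE /= sub0r normrN.
(* The total phase along the loop through [z]. *)
pose I z := \sum_(j < N) phase (link F (z + v *+ j) v).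
have step z : G (z - z0) -> I (z + u) = I z - symp a u.
  move=> Gz; apply/eqP; rewrite [eqbRHS]addrC -subr_eq; apply/eqP.
  have Gz' w : G w -> G (z + w - z0) by move=> Gw; rewrite addrAC; exact: GD.
  have Fn w : G w -> F (z + w) != 0.
    by move=> Gw; have := GF _ (Gz' w Gw); rewrite [z0 + _]addrC subrK.
  (* One plaquette per step; the short sides telescope, and the two ends of the
     loop agree because [a] is integral. *)
  rewrite /I -sumrB.
  pose L j := phase (link F (z + v *+ j) u).
  rewrite (eq_bigr (fun j : 'I_N => L j.+1 - L j - symp v u)); last first.
    move=> j _; rewrite /L [z + u + _]addrAC mulrSr addrA.
    have zG := Gz' _ (Gj j).
    have zG1 : G (z + v *+ j + v - z0).
      by have := Gz' _ (Gj j.+1); rewrite mulrSr addrA.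
    have zG2 : G (z + v *+ j + u - z0).
      by have := Gz' _ (GD _ _ (Gj j) Gu); rewrite addrA.
    apply: plaquette; rewrite ?he//.
    - exact: Fn.
    - by rewrite -addrA; apply: Fn; exact: GD.
    - by rewrite -addrA; apply: Fn; exact: GD.
    - by have := Fn _ (GD _ _ (GD _ _ (Gj j) Gv) Gu); rewrite !addrA.
  rewrite sumrB -(big_mkord xpredT (fun j => L j.+1 - L j)) telescope_sumr//.
  rewrite sumr_const card_ord /L mulr0n addr0.
  have -> : v *+ N = a by rewrite -Nv scaler_nat.
  have -> : symp a u = symp v u *+ N by rewrite -mulr_natl -[in RHS]sympZl Nv.
  by rewrite [link F (z + a) u]link_periodic// subrr sub0r.
have iter (k : nat) : I (z0 + u *+ k) = I z0 - symp a u *+ k.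
  elim: k => [|k IH]; first by rewrite !mulr0n addr0 subr0.
  rewrite mulrSr addrA step ?IH ?mulrSr ?opprD ?addrA//.
  rewrite addrAC subrr add0r; elim: k {IH} => [|k IH]; last by rewrite mulrSr; exact: GD.
  by rewrite mulr0n; apply: GZ; apply/forallP => i; rewrite mxE rpred0.
have Ib z : `|I z| <= N%:R.
  apply: le_trans (ler_norm_sum _ _ _) _.
  apply: (@le_trans _ _ (\sum_(j < N) 1)); last by rewrite sumr_const card_ord.
  apply: ler_sum => j _; apply: le_trans (ltW (phase_lt _)) _; rewrite invf_le1//; exact: ler1n.
apply/eqP/negPn/negP => s0.
(* A nonzero change repeated [k] times would exceed the bound of [I]. *)
have s0' : 0 < `|symp a u| by rewrite normr_gt0.
pose k := (Num.truncn ((N%:R + N%:R) / `|symp a u|)).+1.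
have : (N%:R + N%:R) / `|symp a u| < k%:R by exact: truncnS_gt.
rewrite ltr_pdivrMr//; apply/negP; rewrite -leNgt.
have -> : k%:R * `|symp a u| = `|I z0 - I (z0 + u *+ k)|.
  by rewrite iter opprD opprK addrA subrr add0r normrMn mulr_natl.
by apply: le_trans (ler_normB _ _) _; apply: lerD.
Qed.

End Curvature.

(** * Dominated sums over an arbitrary index set *)
Notation psum := summability.partial_sum.
Notation totally := summability.totally.

#[global] Instance totally_proper (I : choiceType) : ProperFilter (@totally I) :=
  summability.totally_filter.

Section DominatedSums.
Import finmap.
Variables (R : realType) (I : choiceType).
Implicit Types (b : I -> R) (A B : {fset I}).

(** A summable family of nonnegative terms, by the bound on its finite partial
    sums. *)
Definition dominating b :=
  (forall i, 0 <= b i) /\ exists M, forall A, psum b A <= M.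

Lemma psumE (x : I -> R) A : psum x A = \sum_(i <- A) x i.
Proof. by rewrite /summability.partial_sum big_seq_fsetE. Qed.

Lemma psumD_sub (x : I -> R) A B : (A `<=` B)%fset -> psum x B - psum x A = psum x (B `\` A)%fset.
Proof.
move=> AB; rewrite !psumE (big_fsetID _ (mem A) B) /=.
have -> : [fset i in B | i \in A]%fset = A.
  by apply/fsetP => i; rewrite !inE andbC; case: (boolP (i \in A)) => //= /(fsubsetP AB).
rewrite addrAC subrr add0r; apply: eq_fbigl => i.
by rewrite !inE andbC.
Qed.

Lemma dominating_tail b (e : R) : dominating b -> 0 < e ->
  exists A0, forall A, (A0 `<=` A)%fset -> psum b A - psum b A0 <= e.
Proof.
move=> [b0 [M hM]] e0.
pose S := [set psum b A | A in [set: {fset I}]].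
have hS : has_sup S.
  by split; [exists (psum b fset0), fset0|exists M => _ [A _ <-]].
have [_ [A0 _ <-] h0] := sup_adherent e0 hS.
exists A0 => A _; rewrite lerBlDr.
have : psum b A <= sup S by apply: ub_le_sup; [exists M => _ [B _ <-]|exists A].
by move: h0; lra.
Qed.

Lemma ler_psum (x : I -> R) b A : (forall i, `|x i| <= b i) -> `|psum x A| <= psum b A.
Proof.
by move=> xb; apply: le_trans (ler_norm_sum _ _ _) _; apply: ler_sum => i _.
Qed.

Lemma psumD_le (x : I -> R) b A B : (forall i, `|x i| <= b i) -> (A `<=` B)%fset ->
  `|psum x B - psum x A| <= psum b B - psum b A.
Proof. by move=> xb AB; rewrite !psumD_sub//; exact: ler_psum. Qed.

Definition rsum (x : I -> R) : R := lim (psum x @ totally).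

Lemma rsum_cvg (x : I -> R) b : dominating b -> (forall i, `|x i| <= b i) ->
  psum x A @[A --> totally] --> rsum x.
Proof.
move=> hb xb; apply: (@cauchy_cvg R); apply/cauchyP.
move=> e e0; have [A0 hA] := dominating_tail hb (divr_gt0 e0 (ltr0Sn R 1)).
exists (psum x A0); exists A0 => // A /= A0A.
rewrite -ball_normE /= distrC; apply: le_lt_trans (psumD_le xb A0A) _.
by apply: le_lt_trans (hA _ A0A) _; rewrite ltr_pdivrMr// ltr_pMr// ltr1n.
Qed.

Lemma rsum_tail (x : I -> R) b A0 (e : R) : dominating b -> (forall i, `|x i| <= b i) ->
  (forall A, (A0 `<=` A)%fset -> psum b A - psum b A0 <= e) ->
  `|rsum x - psum x A0| <= e.
Proof.
move=> hb xb hA.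
have c : `|psum x A - psum x A0| @[A --> totally] --> `|rsum x - psum x A0|.
  by apply: cvg_norm; apply: cvgB; [exact: rsum_cvg hb xb|exact: cvg_cst].
apply: (closed_cvg (fun r => r <= e) (@closed_le R e) _ _ c).
by exists A0 => // A /= A0A; exact: le_trans (psumD_le xb A0A) (hA _ A0A).
Qed.

Lemma rsum_unique (x : I -> R) s : psum x A @[A --> totally] --> s -> rsum x = s.
Proof. by move=> h; apply: cvg_lim => //; exact: Rhausdorff. Qed.

(** Dominated convergence: beyond a finite set of indices everything is small. *)
Lemma rsum_dominated_cvg (T : Type) (F : set_system T) (FF : ProperFilter F)
    (x : I -> T -> R) (l b : I -> R) : dominating b ->
  (\forall t \near F, forall i, `|x i t| <= b i) ->
  (forall i, x i t @[t --> F] --> l i) ->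
  rsum (x^~ t) @[t --> F] --> rsum l.
Proof.
move=> hb xb xl.
have lb i : `|l i| <= b i.
  have c : `|x i t| @[t --> F] --> `|l i| by apply: cvg_norm; exact: xl.
  apply: (closed_cvg (fun r => r <= b i) (@closed_le R (b i)) _ _ c).
  by apply: filterS xb => t; apply.
apply/cvgrPdist_le => e e0.
have e3 : 0 < e / 3 by rewrite divr_gt0.
have [A0 hA] := dominating_tail hb e3.
have c : psum (x^~ t) A0 @[t --> F] --> psum l A0.
  by apply: cvg_big => [|i _]; [exact: add_continuous|exact: xl].
near=> t.
have xbt i : `|x i t| <= b i by move: i; near: t.
have h1 := rsum_tail hb lb hA.
have h2 := rsum_tail hb xbt hA.
have h3 : `|psum l A0 - psum (x^~ t) A0| <= e / 3.
  by near: t; move/cvgrPdist_le : c; apply.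
move: h1 h2 h3; rewrite !ler_norml; lra.
Unshelve. all: by end_near. Qed.

Lemma dominatingZ b (c : R) : 0 <= c -> dominating b -> dominating (fun i => c * b i).
Proof.
move=> c0 [b0 [M hM]]; split=> [i|]; first exact: mulr_ge0.
exists (c * M) => A; rewrite psumE -big_distrr/= -psumE.
exact: ler_wpM2l.
Qed.

Lemma dominatingD b (c : I -> R) : dominating b -> dominating c -> dominating (fun i => b i + c i).
Proof.
move=> [b0 [M hM]] [c0 [N hN]]; split=> [i|]; first exact: addr_ge0.
by exists (M + N) => A; rewrite psumE big_split/= -!psumE lerD.
Qed.

(** Complex families are summed through their real coordinates, so that
    all the estimates remain in the ordered field. *)
Definition hsum (x : I -> R[i]) (s : R[i]) :=
  psum (fun i => complex.Re (x i)) A @[A --> totally] --> complex.Re s /\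
  psum (fun i => complex.Im (x i)) A @[A --> totally] --> complex.Im s.

Lemma hsum_unique (x : I -> R[i]) s t : hsum x s -> hsum x t -> s = t.
Proof.
move=> [h1 h2] [h3 h4].
have e1 : complex.Re s = complex.Re t by exact: (cvg_unique (@Rhausdorff R) h1 h3).
have e2 : complex.Im s = complex.Im t by exact: (cvg_unique (@Rhausdorff R) h2 h4).
by case: s t e1 e2 {h1 h2 h3 h4} => a b [a' b'] /= -> ->.
Qed.

Lemma hsumD (x y : I -> R[i]) s t : hsum x s -> hsum y t -> hsum (fun i => x i + y i) (s + t).
Proof.
move=> [h1 h2] [h3 h4].
have rD (a b : R[i]) : complex.Re (a + b) = complex.Re a + complex.Re b by case: a b => ? ? [].
have iD (a b : R[i]) : complex.Im (a + b) = complex.Im a + complex.Im b by case: a b => ? ? [].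
split.
- rewrite rD (_ : (fun A => _) = fun A => psum (fun i => complex.Re (x i)) A + psum (fun i => complex.Re (y i)) A); first exact: cvgD.
  by apply/funext => A; rewrite !psumE -big_split; apply: eq_bigr => i _; rewrite rD.
- rewrite iD (_ : (fun A => _) = fun A => psum (fun i => complex.Im (x i)) A + psum (fun i => complex.Im (y i)) A); first exact: cvgD.
  by apply/funext => A; rewrite !psumE -big_split; apply: eq_bigr => i _; rewrite iD.
Qed.

Lemma hsumZ (c : R[i]) (x : I -> R[i]) s : hsum x s -> hsum (fun i => c * x i) (c * s).
Proof.
move=> [h1 h2].
split.
- rewrite ReM (_ : (fun A => _) = fun A => complex.Re c * psum (fun i => complex.Re (x i)) A - complex.Im c * psum (fun i => complex.Im (x i)) A).
    by apply: cvgB; apply: cvgM => //; exact: cvg_cst.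
  by apply/funext => A; rewrite !psumE !big_distrr -sumrB; apply: eq_bigr => i _; rewrite ReM.
- rewrite ImM (_ : (fun A => _) = fun A => complex.Re c * psum (fun i => complex.Im (x i)) A + complex.Im c * psum (fun i => complex.Re (x i)) A).
    by apply: cvgD; apply: cvgM => //; exact: cvg_cst.
  by apply/funext => A; rewrite !psumE !big_distrr -big_split; apply: eq_bigr => i _; rewrite ImM.
Qed.

Lemma hsum0 : hsum (fun=> 0) 0.
Proof. 
by split; rewrite (_ : (fun A => _) = fun=> 0); (try exact: cvg_cst);
  apply/funext => A; rewrite psumE big1.
Qed.

Lemma hsum_sum (J : finType) (x : J -> I -> R[i]) (s : J -> R[i]) :
  (forall j, hsum (x j) (s j)) -> hsum (fun i => \sum_j x j i) (\sum_j s j).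
Proof.
move=> h; elim: (index_enum J) => [|j r IH].
  by rewrite big_nil (_ : (fun i => _) = fun=> 0); [exact: hsum0|apply/funext => i; rewrite big_nil].
rewrite big_cons (_ : (fun i => _) = fun i => x j i + \sum_(k <- r) x k i); first exact: hsumD.
by apply/funext => i; rewrite big_cons.
Qed.

Lemma hsum_dominated (x : I -> R[i]) b : dominating b -> (forall i, Normc.normc (x i) <= b i) ->
  hsum x (rsum (fun i => complex.Re (x i)) +i* rsum (fun i => complex.Im (x i))).
Proof.
move=> hb xb; split; apply: (rsum_cvg hb) => i.
- exact: le_trans (normRe_le_normc _) (xb i).
- exact: le_trans (normIm_le_normc _) (xb i).
Qed.

Lemma psum_reindex (f g : I -> I) (x : I -> R) : cancel f g -> cancel g f -> forall s : R,
  psum x A @[A --> totally] --> s -> psum (fun i => x (f i)) A @[A --> totally] --> s.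
Proof.
move=> fK gK s h.
have e A : psum (fun i => x (f i)) A = psum x [fset f i | i in A]%fset.
  by rewrite !psumE big_imfset//= => i j _ _; exact: (can_inj fK).
rewrite (_ : (fun A => _) = psum x \o (fun A => [fset f i | i in A]%fset)); last exact/funext.
apply: cvg_comp h => P [B _ hB]; exists [fset g i | i in B]%fset => // A /= BA.
apply: hB => /=; apply/fsubsetP => i iB; apply/imfsetP; exists (g i) => //=.
by apply: (fsubsetP BA); apply/imfsetP; exists i.
Qed.

Lemma hsum_reindex (f g : I -> I) (x : I -> R[i]) s : cancel f g -> cancel g f ->
  hsum x s -> hsum (fun i => x (f i)) s.
Proof.
move=> fK gK [h1 h2]; split.
- exact: (psum_reindex (x := fun i => complex.Re (x i)) fK gK).
- exact: (psum_reindex (x := fun i => complex.Im (x i)) fK gK).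
Qed.

Lemma sum_hsum (x : I -> R[i]) s : hsum x s ->
  summability.sum (x : I -> R[i]^o) = s.
Proof.
move=> [h1 h2]; apply: cvg_lim; first exact: norm_hausdorff.
apply/cvgrPdist_lt => e e0.
have er : complex.Im e = 0 by apply: ger0_Im; exact: ltW.
have e0' : 0 < complex.Re e by move: e0; rewrite ltcE => /andP[].
have e2 : 0 < complex.Re e / 2 by rewrite divr_gt0.
near=> A.
have g1 : `|complex.Re s - psum (fun i => complex.Re (x i)) A| < complex.Re e / 2.
  by near: A; move/cvgrPdist_lt : h1; apply.
have g2 : `|complex.Im s - psum (fun i => complex.Im (x i)) A| < complex.Re e / 2.
  by near: A; move/cvgrPdist_lt : h2; apply.
have -> : psum (x : I -> R[i]^o) A = psum (fun i => complex.Re (x i)) A +i* psum (fun i => complex.Im (x i)) A.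
  rewrite /summability.partial_sum; elim: (index_enum A) => [|i r IH]; first by rewrite !big_nil.
  by rewrite !big_cons IH; case: (x (val i)) => a b; simpc.
rewrite normc_def ltcE er eqxx /=.
have -> : Num.sqrt (complex.Re (s - (psum (fun i => complex.Re (x i)) A +i* psum (fun i => complex.Im (x i)) A)) ^+ 2 +
  complex.Im (s - (psum (fun i => complex.Re (x i)) A +i* psum (fun i => complex.Im (x i)) A)) ^+ 2) =
  Normc.normc (s - (psum (fun i => complex.Re (x i)) A +i* psum (fun i => complex.Im (x i)) A)).
  by case: (s - _).
apply: le_lt_trans (normc_le_ReIm _) _.
rewrite (splitr (complex.Re e)); apply: ltrD.
- by rewrite (_ : forall (z : R[i]) (a b : R), complex.Re (z - (a +i* b)) = complex.Re z - a)// => -[].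
- by rewrite (_ : forall (z : R[i]) (a b : R), complex.Im (z - (a +i* b)) = complex.Im z - b)// => -[].
Unshelve. all: by end_near. Qed.

End DominatedSums.

(** * Summable weights on the integer lattice *)
Lemma ler_sum_subset (R : realType) (T : eqType) (f : T -> R) (s t : seq T) :
  (forall x, 0 <= f x) -> uniq s -> {subset s <= t} ->
  \sum_(x <- s) f x <= \sum_(x <- t) f x.
Proof.
move=> f0; elim: s t => [|k s IH] t /=; first by move=> _ _; rewrite big_nil sumr_ge0.
move=> /andP[ks us] st; have kt : k \in t by apply: st; rewrite mem_head.
rewrite big_cons [leRHS](big_rem k)//= lerD2l; apply: IH => // j js.
have jt : j \in t by apply: st; rewrite inE js orbT.
have : j \in k :: rem k t by rewrite -(perm_mem (perm_to_rem kt)).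
by rewrite inE => /orP[/eqP jk|//]; rewrite -jk js in ks.
Qed.

Section LatticeWeights.
Import finmap.
Variables (R : realType) (n : nat).
Implicit Types (k : 'rV[int]_n) (x : 'rV[R]_n).

Definition max1 (s : R) : R := Num.max 1 `|s|.

Lemma max1_ge1 s : 1 <= max1 s.
Proof. by rewrite /max1 le_max lexx. Qed.

Lemma max1_gt0 s : 0 < max1 s.
Proof. exact: lt_le_trans (max1_ge1 s). Qed.

Lemma le_max1 s : `|s| <= max1 s.
Proof. by rewrite /max1 le_max lexx orbT. Qed.

(** A product of coordinatewise weights, so that sums over the lattice factor,
    and a Schwartz function is controlled one coordinate at a time. *)
Definition weight x : R := \prod_i max1 (x 0 i).

Lemma weight_ge1 x : 1 <= weight x.
Proof. by rewrite /weight; elim/big_ind : _ => // [a b a1 b1|i _]; [rewrite mulr_ege1|exact: max1_ge1]. Qed.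

Lemma weight_gt0 x : 0 < weight x.
Proof. exact: lt_le_trans (weight_ge1 x). Qed.

Lemma coord_le_weight x i : `|x 0 i| <= weight x.
Proof.
apply: le_trans (le_max1 _) _; rewrite /weight (bigD1 i)//= ler_peMr//; first exact: ltW (max1_gt0 _).
by elim/big_ind : _ => // [a b a1 b1|j _]; [rewrite mulr_ege1|exact: max1_ge1].
Qed.

Lemma sum_inv_sqr (N : nat) : \sum_(j < N) (max1 (j%:R : R)) ^- 2 <= 3.
Proof.
have m2 M : max1 (M.+1%:R : R) = M.+1%:R by rewrite /max1 ger0_norm// max_r// ler1n.
have m0 : max1 (0%:R : R) = 1 by rewrite /max1 normr0 max_l.
(* The bound telescopes from [1 / (a + 1) ^ 2 <= 1 / a - 1 / (a + 1)]. *)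
suff h : forall M, \sum_(j < M.+2) (max1 (j%:R : R)) ^- 2 <= 3 - M.+1%:R^-1.
  case: N => [|[|M]]; [by rewrite big_ord0| |apply: le_trans (h M) _; by rewrite gerBl invr_ge0].
  by rewrite big_ord1 m0 expr1n invr1 ler1n.
elim=> [|M IH].
  by rewrite !big_ord_recr big_ord0 /= m0 m2 expr1n invr1; lra.
rewrite big_ord_recr /=; apply: le_trans (lerD IH (lexx _)) _.
rewrite -addrA lerD2l m2.
set a : R := M.+1%:R; have a0 : 0 < a by rewrite ltr0n.
have -> : M.+2%:R = a + 1 :> R by rewrite /a -natr1.
have a1 : 0 < a + 1 by rewrite addr_gt0.
rewrite -subr_ge0.
have -> : - (a + 1)^-1 - (- a^-1 + (a + 1) ^- 2) = a^-1 * (a + 1) ^- 2.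
  by field; rewrite !gt_eqF.
by rewrite mulr_ge0// invr_ge0 ?exprn_ge0// ltW.
Qed.

Lemma sum_inv_sqr_int (N : nat) :
  \sum_(j < N.+1 + N.+1) (max1 ((j%:Z - N.+1%:Z)%:~R : R)) ^- 2 <= 7.
Proof.
rewrite big_split_ord /=.
have h1 : \sum_(i < N.+1) (max1 ((i%:Z - N.+1%:Z)%:~R : R)) ^- 2 <= 4.
  rewrite (reindex_inj rev_ord_inj) /=.
  apply: (@le_trans _ _ (\sum_(i < N.+2) (max1 (i%:R : R)) ^- 2)); last first.
    apply: le_trans (sum_inv_sqr _) _; lra.
  rewrite [leRHS]big_ord_recl /= -[leLHS]add0r; apply: lerD.
    by rewrite invr_ge0 exprn_ge0// ltW// max1_gt0.
  apply: ler_sum => i _; rewrite le_eqVlt; apply/orP; left; apply/eqP.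
  congr (_ ^- 2); rewrite /max1; congr Num.max.
  have -> : (N.+1 - i.+1)%N%:Z - N.+1%:Z = - (i.+1)%:Z :> int.
    by rewrite -subzn// addrAC subrr add0r.
  by rewrite mulrNz normrN.
have h2 : \sum_(i < N.+1) (max1 (((N.+1 + i)%N%:Z - N.+1%:Z)%:~R : R)) ^- 2 <= 3.
  apply: le_trans (sum_inv_sqr N.+1); apply: ler_sum => i _.
  by rewrite PoszD addrAC subrr add0r.
by move: h1 h2; lra.
Qed.

(** The sum over a box factors into one-dimensional sums. *)
Lemma dominating_weight : dominating (fun k => weight (zvec R k) ^- 2).
Proof.
split=> [k|]; first by rewrite invr_ge0 exprn_ge0// ltW// weight_gt0.
exists (7 ^+ n) => A.
(* The finite set [A] lies in a box, over which the product expands. *)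
pose N := (\max_(k <- A) \max_i `|k ord0 i|)%N.
have hN k i : k \in A -> (`|k ord0 i| <= N)%N.
  move=> kA; apply: (@leq_trans (\max_i `|k ord0 i|)%N); first exact: (leq_bigmax (F := fun i => `|k ord0 i|%N)).
  by rewrite /N (big_rem k)//= leq_maxl.
pose M := (N.+1 + N.+1)%N.
pose h (f : {ffun 'I_n -> 'I_M}) : 'rV[int]_n := \row_i ((f i)%:Z - N.+1%:Z).
have hs : {subset A <= [seq h f | f <- enum {ffun 'I_n -> 'I_M}]}.
  move=> k kA; apply/mapP.
  have lt (z : int) : (`|z| <= N)%N -> (`|(z + N.+1%:Z)%R| < M)%N by rewrite /M; lia.
  have back (z : int) : (`|z| <= N)%N -> z = (`|(z + N.+1%:Z)%R|%N)%:Z - N.+1%:Z by lia.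
  exists [ffun i => Ordinal (lt _ (hN k i kA))]; first by rewrite mem_enum.
  by apply/rowP => i; rewrite mxE ffunE /=; exact/back/hN.
rewrite psumE.
apply: (@le_trans _ _ (\sum_(k <- [seq h f | f <- enum {ffun 'I_n -> 'I_M}]) weight (zvec R k) ^- 2)).
  have p0 k : 0 <= weight (zvec R k) ^- 2 by rewrite invr_ge0 exprn_ge0// ltW// weight_gt0.
  exact: ler_sum_subset p0 (fset_uniq A) hs.
rewrite big_map big_enum /=.
pose w (j : 'I_M) : R := max1 ((j%:Z - N.+1%:Z)%:~R : R) ^- 2.
rewrite (eq_bigr (fun f : {ffun 'I_n -> 'I_M} => \prod_i w (f i))); last first.
  move=> f _; rewrite /weight -prodrXl -prodfV; apply: eq_bigr => i _.
  by rewrite /w !mxE.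
rewrite -(bigA_distr_bigA (fun _ j => w j)) /= prodr_const card_ord.
have w0 j : 0 <= w j by rewrite invr_ge0 exprn_ge0// ltW// max1_gt0.
by apply: lerXn2r; rewrite ?nnegrE ?sumr_ge0//; exact: sum_inv_sqr_int.
Qed.

(** Decay of [g] at [t + k] is decay in [k], locally uniformly in [t]. *)
Lemma weight_shift x k (r : R) : 0 <= r -> (forall i, `|x 0 i| <= r) ->
  weight (zvec R k) <= (1 + r) ^+ n * weight (x + zvec R k).
Proof.
move=> r0 xr; rewrite /weight -[n in _ ^+ n]card_ord -prodr_const -big_split /=.
apply: ler_prod => i _; rewrite (ltW (max1_gt0 _)) /= !mxE.
set a := x 0 i; set b : R := _%:~R.
have := xr i; rewrite -/a => ar.
have m1 := max1_ge1 (a + b); have m2 := le_max1 (a + b).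
rewrite {1}/max1 ge_max; apply/andP; split; first by nra.
have : `|b| <= `|a + b| + `|a| by have := ler_normB (a + b) a; rewrite addrAC subrr add0r.
by nra.
Qed.

End LatticeWeights.

(** * Functions smooth along a direction *)
Section DirectionalDerivative.
Variables (R : realType) (n : nat).
Local Notation V := 'rV[R]_n.
Implicit Types (v z : V) (G H : V -> R).

Lemma is_derive0P (f : R -> R) (l : R) :
  is_derive (0 : R) 1 f l <-> h^-1 * (f h - f 0) @[h --> 0^'] --> l.
Proof.
have e : (fun h : R => h^-1 *: ((f \o shift 0) (h *: (1 : R)) - f 0)) = (fun h : R => h^-1 * (f h - f 0)).
  by apply/funext => h /=; rewrite addr0 [h *: 1]mulr1.
split=> [[df <-]|h].
  by move: df; rewrite /derivable /derive !e.
have df : derivable f 0 1 by rewrite /derivable e; apply/cvg_ex; exists l.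
by apply: DeriveDef df _; rewrite /derive e; apply: cvg_lim h; exact: Rhausdorff.
Qed.

(** Fourier decay uses one direction at a time, so one-dimensional derivatives
    along the lines of direction [v] suffice. *)
Definition derives v G G' := forall z, is_derive (0 : R) 1 (fun s => G (z + s *: v)) (G' z).

Lemma derives_at v G G' z (s : R) : derives v G G' ->
  is_derive s 1 (fun t => G (z + t *: v)) (G' (z + s *: v)).
Proof.
move=> /(_ (z + s *: v)) h.
have hs : is_derive s 1 (fun t : R => t - s) 1.
  have := @is_deriveB R R R id (cst s) s 1 1 0 (is_derive_id _ _) (is_derive_cst _ _ _).
  by rewrite subr0.
have h' : is_derive (s - s) 1 (fun t => G (z + s *: v + t *: v)) (G' (z + s *: v)) by rewrite subrr.
have := @is_derive1_comp R _ (fun t => t - s) s _ _ h' hs; rewrite mulr1.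
congr (is_derive _ _ _ _); apply/funext => t /=.
by rewrite -addrA -scalerDl [s + _]addrC subrK.
Qed.

Lemma derives_MVT v G G' z (h : R) : derives v G G' -> h != 0 ->
  exists2 c, `|c| <= `|h| & G (z + h *: v) - G z = h * G' (z + c *: v).
Proof.
move=> dG h0.
pose g (t : R) := G (z + t *: v).
have dg (t : R) : is_derive t 1 g (G' (z + t *: v)) by exact: derives_at.
have cg : continuous g.
  by move=> t; apply: differentiable_continuous; apply/derivable1_diffP; have [] := dg t.
have [hn|hp] := ltrP h 0.
  have [c cI e] := MVT hn (fun t _ => dg t) (continuous_subspaceT cg).
  move: cI; rewrite in_itv /= => /andP[c1 c2].
  exists c; first by rewrite (ltr0_norm hn) (ltr0_norm c2) lerN2 ltW.
  have <- : g 0 = G z by rewrite /g scale0r addr0.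
  by rewrite -opprB e sub0r mulrN opprK mulrC.
have hp' : 0 < h by rewrite lt_neqAle eq_sym h0.
have [c cI e] := MVT hp' (fun t _ => dg t) (continuous_subspaceT cg).
move: cI; rewrite in_itv /= => /andP[c1 c2].
exists c; first by rewrite (gtr0_norm hp') (gtr0_norm c1) ltW.
have <- : g 0 = G z by rewrite /g scale0r addr0.
by rewrite e subr0 mulrC.
Qed.

(** Smoothness of order [k] in the direction [v]. *)
Fixpoint Ck v k G : Prop := continuous G /\
  (if k is k'.+1 then exists2 G', derives v G G' & Ck v k' G' else True).

Lemma Ck_cont v k G : Ck v k G -> continuous G.
Proof. by case: k => [|k] []. Qed.

Lemma CkW v k G : Ck v k.+1 G -> Ck v k G.
Proof.
elim: k G => [|k IH] G [cG [G' dG hG']]; first by split.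
by split=> //; exists G' => //; exact: IH.
Qed.

Lemma derivesD v G H G' H' : derives v G G' -> derives v H H' ->
  derives v (fun z => G z + H z) (fun z => G' z + H' z).
Proof. by move=> dG dH z; exact: (is_deriveD (dG z) (dH z)). Qed.

Lemma derivesM v G H G' H' : derives v G G' -> derives v H H' ->
  derives v (fun z => G z * H z) (fun z => G z * H' z + H z * G' z).
Proof.
move=> dG dH z; have := is_deriveM (dG z) (dH z).
by rewrite /= scale0r addr0.
Qed.

Lemma derives_comp v G G' (f f' : R -> R) : derives v G G' ->
  (forall z, is_derive (G z) 1 f (f' (G z))) ->
  derives v (fun z => f (G z)) (fun z => f' (G z) * G' z).
Proof.
move=> dG df z; apply: (is_derive1_comp (g := fun s => G (z + s *: v))); last exact: dG.
by rewrite scale0r addr0.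
Qed.

Lemma Ck_cst v k (c : R) : Ck v k (fun=> c).
Proof.
elim: k c => [|k IH] c /=; split=> //; try exact: cont_cst.
by exists (fun=> 0) => // z; exact: is_derive_cst.
Qed.

Lemma CkD v k G H : Ck v k G -> Ck v k H -> Ck v k (fun z => G z + H z).
Proof.
elim: k G H => [|k IH] G H [cG hG] [cH hH]; split=> //; try exact: contD.
case: hG hH => [G' dG hG] [H' dH hH].
by exists (fun z => G' z + H' z); [exact: derivesD|exact: IH].
Qed.

Lemma CkM v k G H : Ck v k G -> Ck v k H -> Ck v k (fun z => G z * H z).
Proof.
elim: k G H => [|k IH] G H hG hH; (split; first by apply: contM; [exact: Ck_cont hG|exact: Ck_cont hH]) => //.
have [G1 H1] := (CkW hG, CkW hH).
case: hG hH => [cG [G' dG hG]] [cH [H' dH hH]].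
exists (fun z => G z * H' z + H z * G' z); first exact: derivesM.
by apply: CkD; exact: IH.
Qed.

Lemma CkV v k G : (forall z, G z != 0) -> Ck v k G -> Ck v k (fun z => (G z)^-1).
Proof.
move=> G0; have cV : continuous G -> continuous (fun z => (G z)^-1).
  by move=> cG z; exact: (cvgV (G0 z) (cG z)).
elim: k => [|k IH] hG; (split; first exact/cV/(Ck_cont hG)) => //.
have hV := IH (CkW hG); case: hG => [cG [G' dG hG]].
exists (fun z => ((G z)^-1 * (G z)^-1) * (-1 * G' z)).
  have dV := derives_comp dG (f := fun x => x^-1) (f' := fun x => - (x ^- 2)).
  have e : (fun z => - (G z) ^- 2 * G' z) = (fun z => ((G z)^-1 * (G z)^-1) * (-1 * G' z)).
    by apply/funext => z; rewrite mulN1r mulrN mulNr expr2 invfM.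
  rewrite -e; apply: dV => z; have := is_deriveV (G0 z) (is_derive_id (G z) 1).
  by rewrite [_ *: 1]mulr1.
by apply: CkM; [exact: CkM|apply: CkM => //; exact: Ck_cst].
Qed.

Lemma Ck_ln v k G : (forall z, 0 < G z) -> Ck v k G -> Ck v k (fun z => ln (G z)).
Proof.
move=> G0 hG.
have cl : continuous (fun z => ln (G z)).
  move=> z; apply: (continuous_comp (Ck_cont hG (x := z))); exact: continuous_ln.
case: k hG => [|k] hG; split=> //.
have hV : Ck v k (fun z => (G z)^-1) by apply: CkV (CkW hG) => z; rewrite gt_eqF.
case: hG => [cG [G' dG hG]].
exists (fun z => (G z)^-1 * G' z); last exact: CkM.
by apply: (derives_comp dG (f := @ln R) (f' := fun x => x^-1)) => z; exact: is_derive1_ln.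
Qed.

End DirectionalDerivative.

Lemma Ck_comp (R : realType) (n m : nat) (A : 'rV[R]_m -> 'rV[R]_n) v w k G :
  continuous A -> (forall u s, A (u + s *: w) = A u + s *: v) ->
  Ck v k G -> Ck w k (fun u => G (A u)).
Proof.
move=> cA hA; elim: k G => [|k IH] G [cG hG]; (split; first exact: cont_comp cA cG) => //.
case: hG => [G' dG hG]; exists (fun u => G' (A u)); last exact: IH.
move=> u; have := dG (A u); congr (is_derive _ _ _ _).
by apply/funext => s; rewrite hA.
Qed.

Section Series.
Variables (R : realType) (n : nat) (I : choiceType).
Local Notation V := 'rV[R]_n.
Implicit Types (v z : V) (phi psi : I -> V -> R).

Definition locally_dominated phi := forall r : R, exists2 b, dominating b &
  forall z i, `|z| <= r -> `|phi i z| <= b i.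

(** The hypotheses under which a series can be differentiated [k] times term by
    term in the direction [v]. *)
Fixpoint Ck_family v k phi : Prop :=
  [/\ locally_dominated phi, forall i, continuous (phi i) &
  if k is k'.+1 then exists2 psi, (forall i, derives v (phi i) (psi i)) & Ck_family v k' psi
  else True].

Lemma Ck_family_dom v k phi : Ck_family v k phi -> locally_dominated phi.
Proof. by case: k => [|k] []. Qed.

Lemma Ck_familyD v k phi psi : Ck_family v k phi -> Ck_family v k psi ->
  Ck_family v k (fun i z => phi i z + psi i z).
Proof.
have ld f g : locally_dominated f -> locally_dominated g ->
    locally_dominated (fun i z => f i z + g i z).
  move=> hf hg r; have [b hb bf] := hf r; have [c hc cg] := hg r.
  exists (fun i => b i + c i); first exact: dominatingD.
  by move=> z i zr; apply: le_trans (ler_normD _ _) _; rewrite lerD ?bf ?cg.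
elim: k phi psi => [|k IH] f g [lf cf hf] [lg cg hg]; split; try exact: ld; try by move=> i; apply: contD.
  by [].
case: hf hg => [f' df hf] [g' dg hg]; exists (fun i z => f' i z + g' i z); last exact: IH.
by move=> i; exact: derivesD.
Qed.

Lemma locally_dominated0 : locally_dominated (fun _ _ => 0).
Proof.
move=> r; exists (fun=> 0); last by move=> z i _; rewrite normr0.
by split=> //; exists 0 => A; rewrite psumE big1.
Qed.

Lemma Ck_family0 v k : Ck_family v k (fun _ _ => 0).
Proof.
elim: k => [|k IH]; (split; [exact: locally_dominated0|by move=> i; exact: cont_cst|]) => //.
by exists (fun _ _ => 0) => // i z; exact: is_derive_cst.
Qed.

Lemma Ck_family_sum v k (J : finType) (phi : J -> I -> V -> R) :
  (forall j, Ck_family v k (phi j)) -> Ck_family v k (fun i z => \sum_j phi j i z).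
Proof.
move=> h; elim: (index_enum J) => [|j r IH].
  rewrite (_ : (fun i z => _) = fun _ _ => 0); first exact: Ck_family0.
  by apply/funext => i; apply/funext => z; rewrite big_nil.
rewrite (_ : (fun i z => _) = fun i z => phi j i z + \sum_(k <- r) phi k i z); first exact: Ck_familyD.
by apply/funext => i; apply/funext => z; rewrite big_cons.
Qed.

Lemma continuous_rsum phi : locally_dominated phi -> (forall i, continuous (phi i)) ->
  continuous (fun z => rsum (phi^~ z)).
Proof.
move=> ld cphi z; have [b hb bphi] := ld (`|z| + 1).
apply: (@rsum_dominated_cvg R I V (nbhs z) _ phi (phi^~ z) b) => //; last by move=> i; exact: cphi.
apply/nbhs_ballP; exists 1 => //= w; rewrite -ball_normE /= => zw i; apply: bphi.
have -> : w = z - (z - w) by rewrite opprB addrC subrK.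
by apply: le_trans (ler_normB _ _) _; rewrite lerD2l ltW.
Qed.

(** Differentiation term by term: by the mean value theorem the difference
    quotients are dominated by a bound for the derivatives. *)
Lemma derives_rsum v phi psi : locally_dominated phi -> locally_dominated psi ->
  (forall i, derives v (phi i) (psi i)) ->
  derives v (fun z => rsum (phi^~ z)) (fun z => rsum (psi^~ z)).
Proof.
move=> lphi lpsi dphi z; apply/is_derive0P.
have [b hb bpsi] := lpsi (`|z| + `|v|).
have [c hc cphi] := lphi (`|z| + `|v|).
pose q i (h : R) := h^-1 * (phi i (z + h *: v) - phi i (z + 0 *: v)).
have small (h : R) : `|h| <= 1 -> `|z + h *: v| <= `|z| + `|v|.
  move=> h1; apply: le_trans (ler_normD _ _) _; rewrite lerD2l normrZ.
  by rewrite ler_piMl.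
have near1 : \forall h \near 0^', `|h : R| <= 1.
  exact: dnbhs0_le.
have lim : rsum (q^~ h) @[h --> (0 : R)^'] --> rsum (psi^~ z).
  apply: (@rsum_dominated_cvg R I R _ _ q (psi^~ z) b) => //.
    near=> h => i; have h0 : h != 0 by near: h; exact: nbhs_dnbhs_neq.
    have h1 : `|h| <= 1 by near: h.
    have [t th e] := derives_MVT z (dphi i) h0.
    rewrite /q scale0r addr0 e mulKf//; apply: bpsi; apply: small.
    exact: le_trans th h1.
  by move=> i; have /is_derive0P := dphi i z.
apply: cvg_trans lim; apply: near_eq_cvg; near=> h.
have h1 : `|h| <= 1 by near: h.
apply: rsum_unique.
rewrite (_ : (fun A => _) = fun A => h^-1 * (psum (phi^~ (z + h *: v)) A - psum (phi^~ (z + 0 *: v)) A)); last first.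
  by apply/funext => A; rewrite !psumE -sumrB big_distrr.
apply: cvgM; first exact: cvg_cst.
apply: cvgB; apply: (rsum_cvg hc) => i; apply: cphi; apply: small => //.
by rewrite normr0.
Unshelve. all: by end_near. Qed.

Lemma Ck_family_rsum v k phi : Ck_family v k phi -> Ck v k (fun z => rsum (phi^~ z)).
Proof.
elim: k phi => [|k IH] phi [ld cphi hphi]; (split; first exact: continuous_rsum) => //.
case: hphi => psi dphi hpsi; exists (fun z => rsum (psi^~ z)); last exact: IH.
exact: derives_rsum (Ck_family_dom hpsi) _.
Qed.

End Series.

(** * Zak transforms of Schwartz functions *)
Lemma cont_row (R : realType) (X : topologicalType) (n : nat) (f : X -> 'rV[R]_n) :
  (forall i, continuous (fun x => f x 0 i)) -> continuous f.
Proof.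
move=> h x; apply/cvgrPdist_lt => e e0.
have : \forall y \near x, forall i, `|f x 0 i - f y 0 i| < e.
  by apply: filter_forall => i; move/cvgrPdist_lt : (h i x); apply.
by apply: filterS => y hy; apply: norm_row_lt => // i; rewrite !mxE.
Qed.

Section SchwartzFunctions.
Variables (R : realType) (n : nat).
Local Notation V := 'rV[R]_n.
Implicit Types (g : V -> R) (x v : V).

Definition real_schwartz g := smooth g /\ rapidly_decreasing g.

Lemma real_schwartz_partial g i : real_schwartz g -> real_schwartz ('D_(delta_mx 0 i) g).
Proof.
move=> [sg rg].
have e s : iter_partial s ('D_(delta_mx 0 i) g) = iter_partial (rcons s i) g.
  by rewrite /iter_partial foldr_rcons.
by split=> [s x|s m]; [rewrite e; exact: sg|have [C hC] := rg (rcons s i) m; exists C; rewrite e].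
Qed.

Lemma smooth_derives g v : smooth g ->
  derives v g (fun z => \sum_i v 0 i * 'D_(delta_mx 0 i) g z).
Proof.
move=> sg z; have dg : differentiable g z by exact: (sg [::]).
have -> : \sum_i v 0 i * 'D_(delta_mx 0 i) g z = 'D_v g z.
  rewrite (deriveE _ dg) [in RHS](row_sum_delta v) linear_sum; apply: eq_bigr => i _.
  by rewrite linearZ /= (deriveE _ dg).
apply/is_derive0P; have : derivable g z v by exact: diff_derivable.
rewrite /derivable /derive.
rewrite (_ : (fun h : R => _) = (fun h : R => h^-1 * (g (z + h *: v) - g (z + 0 *: v))))//.
by apply/funext => h /=; rewrite scale0r addr0 [h *: v + z]addrC.
Qed.

Lemma smooth_continuous g : smooth g -> continuous g.
Proof. by move=> sg x; apply: differentiable_continuous; exact: (sg [::]). Qed.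

(** Each coordinate contributes either the power [M] or the power [0], so only
    finitely many monomials are involved. *)
Lemma real_schwartz_decay g (M : nat) : real_schwartz g ->
  exists2 C : R, 0 <= C & forall x, weight x ^+ M * `|g x| <= C.
Proof.
move=> [_ rg].
pose ex (f : {ffun 'I_n -> bool}) (i : 'I_n) := if f i then M else 0%N.
have /choice [C hC] f : exists C : R, forall x, `|(\prod_i x 0 i ^+ ex f i) * g x| <= C.
  exact: (rg [::] (ex f)).
have C0 f : 0 <= C f by apply: le_trans (hC f 0); exact: normr_ge0.
exists (\sum_f C f); first exact: sumr_ge0.
move=> x; pose f := [ffun i : 'I_n => 1 <= `|x 0 i|].
apply: (@le_trans _ _ (C f)); last by rewrite (bigD1 f)//= lerDl sumr_ge0.
apply: le_trans (hC f x); rewrite normrM ler_wpM2r//.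
rewrite /weight -prodrXl normr_prod le_eqVlt; apply/orP; left; apply/eqP.
apply: eq_bigr => i _; rewrite /max1 /ex ffunE normrX.
by case: leP => h; rewrite ?expr1n ?expr0.
Qed.

End SchwartzFunctions.

Section ZakFamilies.
Variables (R : realType) (d : nat).
Local Notation V := 'rV[R]_(d + d).
Local Notation K := 'rV[int]_d.
Implicit Types (q : K -> R) (theta : R) (g : 'rV[R]_d -> R) (z v : V) (k : K).

(** Polynomial growth on the lattice; the decay of a Schwartz function makes up
    for it. *)
Definition moderate q := exists C : R, exists M : nat,
  0 <= C /\ forall k, `|q k| <= C * weight (zvec R k) ^+ M.

Lemma moderate_cst (c : R) : moderate (fun=> c).
Proof. by exists `|c|, 0%N; split=> // k; rewrite expr0 mulr1. Qed.

Lemma moderateM q q' : moderate q -> moderate q' -> moderate (fun k => q k * q' k).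
Proof.
move=> [C [M [C0 h]]] [C' [M' [C0' h']]]; exists (C * C'), (M + M')%N; split; first exact: mulr_ge0.
by move=> k; rewrite normrM exprD mulrACA ler_pM.
Qed.

Lemma moderate_dotp (u : 'rV[R]_d) : moderate (fun k => dotp u (zvec R k)).
Proof.
exists (\sum_i `|u 0 i|), 1%N; split; first exact: sumr_ge0.
move=> k; rewrite expr1 /dotp big_distrl /=; apply: le_trans (ler_norm_sum _ _ _) _.
by apply: ler_sum => i _; rewrite normrM ler_wpM2l// coord_le_weight.
Qed.

(** Terms of the real and imaginary parts of a Zak transform; the class of these
    families is closed under differentiation, the weight [q] absorbing the
    frequencies and [theta] the passage from cosine to sine. *)
Definition zak_family q theta g k z :=
  q k * cos (2 * pi * (theta - dotp (rsubmx z) (zvec R k))) * g (lsubmx z + zvec R k).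

Lemma cont_lsubmx_shift k : continuous (fun z : V => lsubmx z + zvec R k).
Proof.
apply: cont_row => i.
rewrite (_ : (fun z => _) = fun z : V => z 0 (lshift d i) + zvec R k 0 i); last first.
  by apply/funext => z; rewrite !mxE.
by apply: contD; [exact: coord_continuous|exact: cont_cst].
Qed.

Lemma cont_dotp_rsubmx (u : 'rV[R]_d) : continuous (fun z : V => dotp (rsubmx z) u).
Proof.
rewrite (_ : (fun z => _) = fun z : V => \sum_i z 0 (rshift d i) * u 0 i); last first.
  by apply/funext => z; apply: eq_bigr => i _; rewrite mxE.
by apply: cont_sum => i; apply: contM; [exact: coord_continuous|exact: cont_cst].
Qed.

Lemma zak_family_dominated q theta g : moderate q -> real_schwartz g ->
  locally_dominated (zak_family q theta g).
Proof.
move=> [C [M [C0 hq]]] sg r; have [D D0 hD] := real_schwartz_decay (M + 2) sg.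
pose r' := Num.max 0 r.
pose B := C * ((1 + r') ^+ d) ^+ (M + 2) * D.
have r'0 : 0 <= r' by rewrite /r' le_max lexx.
exists (fun k => B * weight (zvec R k) ^- 2).
  apply: dominatingZ; last exact: dominating_weight.
  by rewrite !mulr_ge0// !exprn_ge0// addr_ge0.
move=> z k zr; rewrite /zak_family !normrM.
set w := weight (zvec R k); set W := weight (lsubmx z + zvec R k).
have w0 : 0 < w by exact: weight_gt0.
have W0 : 0 < W by exact: weight_gt0.
have hw : w <= (1 + r') ^+ d * W.
  apply: weight_shift => // i; rewrite mxE; apply: le_trans (abs_coord_le _ _) _.
  by rewrite /r' le_max zr orbT.
have hc : `|cos (2 * pi * (theta - dotp (rsubmx z) (zvec R k)))| <= 1.
  by rewrite ler_norml cos_geN1 cos_le1.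
have hg := hD (lsubmx z + zvec R k); rewrite -/W in hg.
rewrite ler_pdivlMr ?exprn_gt0//.
set G : R := `|g _| in hg *.
have G0 : 0 <= G by exact: normr_ge0.
apply: (@le_trans _ _ (C * w ^+ M * G * w ^+ 2)).
  apply: ler_wpM2r; first by rewrite exprn_ge0// ltW.
  by apply: ler_wpM2r => //; rewrite -[leRHS]mulr1 ler_pM.
have -> : C * w ^+ M * G * w ^+ 2 = C * (w ^+ (M + 2) * G) by rewrite exprD; ring.
rewrite /B -mulrA ler_wpM2l//.
apply: (@le_trans _ _ (((1 + r') ^+ d * W) ^+ (M + 2) * G)).
  by rewrite ler_wpM2r// lerXn2r ?nnegrE ?mulr_ge0 ?exprn_ge0 ?addr_ge0// ltW.
by rewrite exprMn -mulrA ler_wpM2l// !exprn_ge0// addr_ge0.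
Qed.

Lemma zak_family_continuous q theta g k : continuous g -> continuous (zak_family q theta g k).
Proof.
move=> cg; apply: contM; last exact: (cont_comp (g := g) (@cont_lsubmx_shift k) cg).
apply: contM; first exact: cont_cst.
apply: (cont_comp (g := cos)); last exact: continuous_cos.
apply: contM; first exact: cont_cst.
by apply: contB; [exact: cont_cst|exact: cont_dotp_rsubmx].
Qed.

(** A derivative of the cosine is a cosine shifted by a quarter period, which keeps
    the family of the same form. *)
Lemma derives_cos_dotp theta k v :
  derives v (fun z : V => cos (2 * pi * (theta - dotp (rsubmx z) (zvec R k))))
    (fun z => 2 * pi * dotp (rsubmx v) (zvec R k) *
       cos (2 * pi * (theta - 4^-1 - dotp (rsubmx z) (zvec R k)))).
Proof.
set c := dotp (rsubmx v) (zvec R k).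
have dl : derives v (fun z : V => 2 * pi * (theta - dotp (rsubmx z) (zvec R k))) (fun=> - (2 * pi * c)).
  move=> z; apply/is_derive0P.
  apply: (@cvg_trans _ ((fun=> - (2 * pi * c)) @ (0 : R)^')); last exact: cvg_cst.
  apply: near_eq_cvg; near=> h.
  have h0 : h != 0 by near: h; exact: nbhs_dnbhs_neq.
  by rewrite !rsubmxD !rsubmxZ !dotpDl !dotpZl -/c mul0r; field.
move=> z; have := derives_comp dl (f := cos) (f' := fun x => - sin x) (fun z => is_derive_cos _) z.
congr (is_derive _ _ _ _).
set a := theta - _; have -> : 2 * pi * (theta - 4^-1 - dotp (rsubmx z) (zvec R k)) = 2 * pi * a - pi / 2 by rewrite /a; field.
by rewrite cosBpihalf; ring.
Unshelve. all: by end_near. Qed.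

Lemma derives_shift g g' v k : derives (lsubmx v) g g' ->
  derives v (fun z => g (lsubmx z + zvec R k)) (fun z => g' (lsubmx z + zvec R k)).
Proof.
move=> dg z; have := dg (lsubmx z + zvec R k); congr (is_derive _ _ _ _).
by apply/funext => s; rewrite lsubmxD lsubmxZ addrAC.
Qed.

Lemma zak_family_Ck q theta g v m : moderate q -> real_schwartz g ->
  Ck_family v m (zak_family q theta g).
Proof.
elim: m q theta g => [|m IH] q theta g mq sg.
all: have ld := zak_family_dominated theta mq sg.
all: have cz k : continuous (zak_family q theta g k) by apply/zak_family_continuous/smooth_continuous; case: sg.
  by split.
split=> //.
pose q1 k := q k * (2 * pi * dotp (rsubmx v) (zvec R k)).
pose psi k z := zak_family q1 (theta - 4^-1) g k z +
  \sum_i zak_family (fun k => q k * lsubmx v 0 i) theta ('D_(delta_mx 0 i) g) k z.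
exists psi; last first.
  apply: Ck_familyD; first apply: IH => //.
    by apply: moderateM => //; apply: moderateM; [exact: moderate_cst|exact: moderate_dotp].
  apply: Ck_family_sum => i; apply: IH; last exact: real_schwartz_partial.
  by apply: moderateM => //; exact: moderate_cst.
move=> k; have dc := derives_cos_dotp theta k v.
have dg := derives_shift k (smooth_derives (lsubmx v) sg.1).
have dq : derives v (fun _ : V => q k) (fun=> 0) by move=> z; exact: is_derive_cst.
move=> z; have := derivesM (derivesM dq dc) dg z; congr (is_derive _ _ _ _).
rewrite /psi /zak_family /q1 big_distrr /= addrC; congr (_ + _); first by ring.
by apply: eq_bigr => i _; ring.
Qed.

End ZakFamilies.

Section ZakTransform.
Variables (R : realType) (d : nat).
Local Notation V := 'rV[R]_(d + d).
Local Notation K := 'rV[int]_d.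
Implicit Types (f : 'rV[R]_d -> R[i]) (z v : V) (k : K).

Definition zak_term f z k : R[i] :=
  expi2pi (- dotp (rsubmx z) (zvec R k)) * f (lsubmx z + zvec R k).

Lemma schwartz_re f : schwartz f -> real_schwartz (fun x => complex.Re (f x)).
Proof. by case. Qed.

Lemma schwartz_im f : schwartz f -> real_schwartz (fun x => complex.Im (f x)).
Proof. by case. Qed.

Lemma zak_term_re f z k : complex.Re (zak_term f z k) =
  zak_family (fun=> 1) 0 (fun x => complex.Re (f x)) k z +
  zak_family (fun=> -1) (- 4^-1) (fun x => complex.Im (f x)) k z.
Proof.
rewrite /zak_term /zak_family; set a := dotp _ _; case: (f _) => u w /=.
have -> : 2 * pi * (- 4^-1 - a) = 2 * pi * - a - pi / 2 by field.
by rewrite cosBpihalf sub0r; ring.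
Qed.

Lemma zak_term_im f z k : complex.Im (zak_term f z k) =
  zak_family (fun=> 1) 0 (fun x => complex.Im (f x)) k z +
  zak_family (fun=> 1) (- 4^-1) (fun x => complex.Re (f x)) k z.
Proof.
rewrite /zak_term /zak_family; set a := dotp _ _; case: (f _) => u w /=.
have -> : 2 * pi * (- 4^-1 - a) = 2 * pi * - a - pi / 2 by field.
by rewrite cosBpihalf sub0r; ring.
Qed.

Lemma zak_term_re_Ck f v m : schwartz f ->
  Ck_family v m (fun k z => complex.Re (zak_term f z k)).
Proof.
move=> sf; rewrite (_ : (fun k z => _) = fun k z =>
    zak_family (fun=> 1) 0 (fun x => complex.Re (f x)) k z +
    zak_family (fun=> -1) (- 4^-1) (fun x => complex.Im (f x)) k z); last first.
  by apply/funext => k; apply/funext => z; rewrite zak_term_re.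
apply: Ck_familyD; apply: zak_family_Ck; try exact: moderate_cst.
- exact: schwartz_re.
- exact: schwartz_im.
Qed.

Lemma zak_term_im_Ck f v m : schwartz f ->
  Ck_family v m (fun k z => complex.Im (zak_term f z k)).
Proof.
move=> sf; rewrite (_ : (fun k z => _) = fun k z =>
    zak_family (fun=> 1) 0 (fun x => complex.Im (f x)) k z +
    zak_family (fun=> 1) (- 4^-1) (fun x => complex.Re (f x)) k z); last first.
  by apply/funext => k; apply/funext => z; rewrite zak_term_im.
apply: Ck_familyD; apply: zak_family_Ck; try exact: moderate_cst.
- exact: schwartz_im.
- exact: schwartz_re.
Qed.

Lemma zak_term_dominated f z : schwartz f ->
  exists2 b, dominating b & forall k, Normc.normc (zak_term f z k) <= b k.
Proof.
move=> sf.
have [b hb bb] := Ck_family_dom (zak_term_re_Ck 0 0 sf) `|z|.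
have [c hc cc] := Ck_family_dom (zak_term_im_Ck 0 0 sf) `|z|.
exists (fun k => b k + c k); first exact: dominatingD.
by move=> k; apply: le_trans (normc_le_ReIm _) _; rewrite lerD ?bb ?cc.
Qed.

(** The sum defining the Zak transform is a limit along finite sets, which
    absolute convergence provides. *)
Lemma hsum_zak f z : schwartz f -> hsum (zak_term f z) (zak f z).
Proof.
move=> sf; have [b hb hz] := zak_term_dominated z sf.
have h := hsum_dominated hb hz.
by have -> : zak f z = _ := sum_hsum h.
Qed.

Lemma zak_re f z : schwartz f ->
  complex.Re (zak f z) = rsum (fun k => complex.Re (zak_term f z k)).
Proof. by move=> sf; have [h _] := hsum_zak z sf; rewrite (rsum_unique h). Qed.

Lemma zak_im f z : schwartz f ->
  complex.Im (zak f z) = rsum (fun k => complex.Im (zak_term f z k)).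
Proof. by move=> sf; have [_ h] := hsum_zak z sf; rewrite (rsum_unique h). Qed.

Lemma zak_re_Ck f v m : schwartz f -> Ck v m (fun z => complex.Re (zak f z)).
Proof.
move=> sf; have := Ck_family_rsum (zak_term_re_Ck v m sf).
by congr (Ck _ _ _); apply/funext => z; rewrite zak_re.
Qed.

Lemma zak_im_Ck f v m : schwartz f -> Ck v m (fun z => complex.Im (zak f z)).
Proof.
move=> sf; have := Ck_family_rsum (zak_term_im_Ck v m sf).
by congr (Ck _ _ _); apply/funext => z; rewrite zak_im.
Qed.

Lemma zak_ccont f : schwartz f -> ccont (zak f).
Proof.
move=> sf; split; [exact: Ck_cont (zak_re_Ck 0 0 sf)|exact: Ck_cont (zak_im_Ck 0 0 sf)].
Qed.

Lemma zvecD k l : zvec R (k + l) = zvec R k + zvec R l.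
Proof. by apply/rowP => i; rewrite !mxE intrD. Qed.

Lemma zvec0 : zvec R (0 : K) = 0.
Proof. by apply/rowP => i; rewrite !mxE. Qed.

Lemma zak_quasi_periodic f : schwartz f -> quasi_periodic (zak f).
Proof.
move=> sf z k hk.
have [l el] := int_vecE (int_vec_lsub hk).
apply: (hsum_unique (hsum_zak (z + k) sf)).
have h := hsumZ (expi2pi (dotp (rsubmx z) (lsubmx k))) (hsum_zak z sf).
have := hsum_reindex (f := fun j => l + j) (g := fun j => - l + j) (addKr l) (addNKr l) h.
congr (hsum _ _); apply/funext => j.
rewrite /zak_term lsubmxD rsubmxD zvecD -el dotpDl dotpDr mulrA -expi2piD addrA.
congr (_ * _); rewrite opprD addrA subrr add0r opprD expi2piD [X in _ * X]expi2pi_int ?mulr1//.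
by rewrite rpredN dotp_int// ?int_vec_zvec// int_vec_rsub.
Qed.

Lemma zak_modul_transl f x y z : schwartz f ->
  hsum (zak_term (modul y (transl x f)) z)
    (expi2pi (- dotp y (lsubmx z)) * zak f (z + row_mx (- x) y)).
Proof.
move=> sf; have := hsumZ (expi2pi (- dotp y (lsubmx z))) (hsum_zak (z + row_mx (- x) y) sf).
congr (hsum _ _); apply/funext => k.
rewrite /zak_term /modul /transl lsubmxD rsubmxD row_mxKl row_mxKr.
rewrite [lsubmx z - x + _]addrAC !mulrA -!expi2piD; congr (expi2pi _ * _).
by rewrite dotpDl dotpDr !opprD; ring.
Qed.

(** Linear relations between time-frequency shifts become pointwise relations
    between translates of the Zak transform. *)
Lemma zak_relation (I : finType) (c : I -> R[i]) (x y : I -> 'rV[R]_d) f g z s :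
  schwartz f -> (forall t, \sum_i c i * modul (y i) (transl (x i) f) t = g t) ->
  hsum (zak_term g z) s ->
  \sum_i c i * (expi2pi (- dotp (y i) (lsubmx z)) * zak f (z + row_mx (- x i) (y i))) = s.
Proof.
move=> sf rel; apply: hsum_unique.
have h i := hsumZ (c i) (zak_modul_transl (x i) (y i) z sf).
have := hsum_sum h; congr (hsum _ _); apply/funext => k.
rewrite /zak_term -rel big_distrr /=; apply: eq_bigr => i _.
by rewrite mulrA [c i * _]mulrC mulrA.
Qed.

Lemma zak_int_translate f z (x y : K) : schwartz f ->
  zak f (z + row_mx (- zvec R x) (zvec R y)) = expi2pi (- dotp (rsubmx z) (zvec R x)) * zak f z.
Proof.
move=> sf; rewrite (zak_quasi_periodic sf) ?row_mxKl ?dotpNr//.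
apply/forallP => i; case: (split_ordP i) => j ->; rewrite ?row_mxEl ?row_mxEr !mxE ?rpredN; exact: intr_int.
Qed.

Lemma zak_norm_periodic f z v : schwartz f -> int_vec v ->
  Normc.normc (zak f (z + v)) = Normc.normc (zak f z).
Proof.
by move=> sf hk; rewrite (zak_quasi_periodic sf)// Normc.normcM normc_expi2pi mul1r.
Qed.

(** The Fourier series with coefficients [a] converges to zero everywhere. *)
Definition null_series (a : K -> R[i]) := forall xi : 'rV[R]_d,
  hsum (fun k => expi2pi (- dotp xi (zvec R k)) * a k) 0.

Lemma odd_int (m : int) : ~~ (2 %| m)%Z -> exists l : int, m = l * 2 + 1.
Proof.
move=> h; have h0 : (m %% 2)%Z != 0 by apply: contra h => /eqP/dvdz_mod0P.
exists (m %/ 2)%Z; have := divz_eq m 2.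
have : 0 <= (m %% 2)%Z by exact: modz_ge0.
have : (m %% 2)%Z < 2 by exact: (@ltz_pmod m 2).
by move: h0; lia.
Qed.

(** Averaging over the translation of the [i]-th frequency by [2 ^- j.+1] keeps
    the indices divisible by [2 ^ j.+1] among those divisible by [2 ^ j]. *)
Lemma null_series_step (a : K -> R[i]) i j : null_series a ->
  (forall k, ~~ (2 ^+ j %| k ord0 i)%Z -> a k = 0) ->
  null_series (fun k => if (2 ^+ j.+1 %| k ord0 i)%Z then a k else 0).
Proof.
move=> na aj xi.
have h2 : (2 : R) ^+ j.+1 != 0 by rewrite expf_neq0.
have := hsumZ (2^-1) (hsumD (na xi) (na (xi + (2 ^+ j.+1)^-1 *: delta_mx 0 i))).
rewrite addr0 mulr0; congr (hsum _ _); apply/funext => k.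
have [/dvdzP[m em]|nj] := boolP (2 ^+ j %| k ord0 i)%Z; last first.
  by rewrite aj// !mulr0 addr0 mulr0; case: ifP => _; rewrite ?mulr0.
have e1 : dotp ((2 ^+ j.+1)^-1 *: delta_mx 0 i) (zvec R k) = m%:~R / 2.
  rewrite dotpZl dotpC dotp_delta mxE em intrM rmorphXn /= exprS; field.
  by rewrite expf_neq0.
rewrite dotpDl opprD expi2piD e1.
have dv : (2 ^+ j.+1 %| k ord0 i)%Z = (2 %| m)%Z.
  by rewrite em exprS dvdz_mul2r ?expf_neq0.
have half : expi2pi (- 2^-1) = -1 :> R[i].
  rewrite /expi2pi (_ : 2 * pi * - 2^-1 = - pi); last by field.
  by apply/eqP; rewrite cosN sinN cospi sinpi eq_complex /= !oppr0 !eqxx.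
rewrite dv; case: ifPn => [/dvdzP[l el]|odd].
  rewrite el intrM mulfK ?pnatr_eq0// [expi2pi (- l%:~R)]expi2pi_int ?rpredN ?intr_int//.
  by rewrite mulr1; field.
have [l el] := odd_int odd.
have -> : - ((m%:~R : R) / 2) = - l%:~R + - 2^-1 by rewrite el intrD intrM; field.
rewrite expi2piD [expi2pi (- l%:~R)]expi2pi_int ?rpredN ?intr_int// mul1r half.
by rewrite mulrN1 mulNr subrr mulr0 mulr0.
Qed.

Lemma null_series_dvd (a : K -> R[i]) i j : null_series a ->
  null_series (fun k => if (2 ^+ j %| k ord0 i)%Z then a k else 0).
Proof.
move=> na; elim: j => [|j IH].
  by rewrite (_ : (fun k => _) = a)//; apply/funext => k; rewrite expr0 dvd1z.
have := null_series_step IH (i := i) (j := j).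
have -> : (fun k : K => if (2 ^+ j.+1 %| k ord0 i)%Z then
     (if (2 ^+ j %| k ord0 i)%Z then a k else 0) else 0) =
  (fun k => if (2 ^+ j.+1 %| k ord0 i)%Z then a k else 0).
  apply/funext => k; case: ifP => // h; rewrite ifT//.
  by apply: dvdz_trans h; rewrite exprS dvdz_mull.
by apply=> k /negPf ->.
Qed.

Lemma null_series_dvd_all (a : K -> R[i]) j : null_series a ->
  null_series (fun k => if [forall i, (2 ^+ j %| k ord0 i)%Z] then a k else 0).
Proof.
move=> na.
suff h (s : seq 'I_d) : null_series (fun k => if all (fun i => (2 ^+ j %| k ord0 i)%Z) s then a k else 0).
  have := h (enum 'I_d); congr null_series; apply/funext => k.
  congr (if _ then _ else _); apply/allP/forallP => [H i|H i _]; last exact: H.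
  by apply: H; rewrite mem_enum.
elim: s => [|i s IH]; first exact: na.
have := null_series_dvd i j IH; congr null_series; apply/funext => k /=.
by case: ifP.
Qed.

Section NullSeries.
Import finmap.

(** A Fourier series that vanishes identically has zero constant term: filtering
    by large powers of [2] leaves only the constant term and a tail. *)
Lemma null_series0 (a : K -> R[i]) b : dominating b ->
  (forall k, Normc.normc (a k) <= b k) -> null_series a -> a 0 = 0.
Proof.
move=> hb ab na.
have small (e : R) : 0 < e -> Normc.normc (a 0) <= e + e.
  move=> e0; have [A0 hA] := dominating_tail hb e0.
  pose M := (\max_(k <- (A0 : seq K)) \max_i `|k ord0 i|)%N.
  pose a' k := if [forall i, (2 ^+ M %| k ord0 i)%Z] then a k else 0.
  have hM k : k \in A0 -> [forall i, (2 ^+ M %| k ord0 i)%Z] -> k = 0.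
    move=> kA /forallP hk; apply/rowP => i; rewrite mxE.
    have kM : (`|k ord0 i| <= M)%N.
      apply: (@leq_trans (\max_i `|k ord0 i|)%N); first exact: (leq_bigmax (F := fun i => `|k ord0 i|%N)).
      by rewrite /M (big_rem k)//= leq_maxl.
    apply/eqP; rewrite -absz_eq0; apply/negPn/negP; rewrite -lt0n => h0.
    have := hk i; rewrite /dvdz abszX => /dvdn_leq => /(_ h0).
    by rewrite leqNgt (leq_ltn_trans kM)//; exact: ltn_expl.
  have a'0 : a' 0 = a 0 by rewrite /a' ifT//; apply/forallP => i; rewrite mxE dvdz0.
  have ab' k : Normc.normc (a' k) <= b k.
    by rewrite /a'; case: ifP => // _; rewrite Normc.normc0; apply: le_trans (ab k); exact: normc_ge0.
  have [h1 h2] := null_series_dvd_all M na 0.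
  have e1 k : expi2pi (- dotp 0 (zvec R k)) * a' k = a' k.
    by rewrite dotpC dotp0r oppr0 expi2pi0 mul1r.
  have hre : rsum (fun k => complex.Re (a' k)) = 0.
    by have := rsum_unique h1; rewrite (_ : (fun k => _) = fun k => complex.Re (a' k))//; apply/funext => k; rewrite e1.
  have him : rsum (fun k => complex.Im (a' k)) = 0.
    by have := rsum_unique h2; rewrite (_ : (fun k => _) = fun k => complex.Im (a' k))//; apply/funext => k; rewrite e1.
  (* Divisibility by [2 ^+ M] excludes the nonzero indices of [A0], so the partial
     sum over [A1] is the constant term alone. *)
  pose A1 := (0 |` A0)%fset.
  have hA1 A : (A1 `<=` A)%fset -> psum b A - psum b A1 <= e.
    move=> A1A; have s1 : (A0 `<=` A1)%fset by exact: fsubsetU1.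
    have := hA A (fsubset_trans s1 A1A).
    have : psum b A0 <= psum b A1.
      rewrite -subr_ge0 psumD_sub// psumE; apply: sumr_ge0 => k _; exact: (hb.1 k).
    lra.
  have p1 (g : R[i] -> R) : g 0 = 0 -> psum (fun k => g (a' k)) A1 = g (a 0).
    move=> g0; rewrite psumE (big_fsetD1 0)//=; last exact: fset1U1.
    rewrite a'0 big_seq big1 ?addr0// => k; rewrite !inE => /andP[k0].
    rewrite (negPf k0) /= => kA; rewrite /a' ifF//; apply/negbTE; apply: contra k0 => hk.
    by rewrite (hM k kA hk).
  have r1 := rsum_tail (x := fun k => complex.Re (a' k)) hb (fun k => le_trans (normRe_le_normc _) (ab' k)) hA1.
  have r2 := rsum_tail (x := fun k => complex.Im (a' k)) hb (fun k => le_trans (normIm_le_normc _) (ab' k)) hA1.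
  rewrite hre sub0r normrN (p1 (@complex.Re R))// in r1.
  rewrite him sub0r normrN (p1 (@complex.Im R))// in r2.
  by apply: le_trans (normc_le_ReIm _) (lerD r1 r2).
apply/eqP; rewrite -[_ == 0]negbK -normc_gt0; apply/negP => p0.
have := small (Normc.normc (a 0) / 4); rewrite divr_gt0// => /(_ isT); lra.
Qed.

End NullSeries.

(** For fixed [t] the Zak transform is the Fourier series of the values of [f] on
    [t + Z^d]. *)
Lemma zak_neq0 f : schwartz f -> (exists t, f t != 0) -> exists z, zak f z != 0.
Proof.
move=> sf [t ft]; apply: contrapT => nz.
have z0 z : zak f z = 0 by apply/eqP/negPn/negP => h; apply: nz; exists z.
have [b hb hz] := zak_term_dominated (row_mx t 0) sf.
pose a k := f (t + zvec R k).
suff : a 0 = 0 by rewrite /a zvec0 addr0 => /eqP; apply/negP.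
apply: (null_series0 hb) => [k|xi].
  by have := hz k; rewrite /zak_term row_mxKl Normc.normcM normc_expi2pi mul1r.
by have := hsum_zak (row_mx t xi) sf; rewrite z0 /zak_term row_mxKl row_mxKr.
Qed.

End ZakTransform.

(** * Trigonometric polynomials *)
Section TrigonometricPolynomials.
Variable R : realType.

(** An arc of the circle contains more points than the degree. *)
Lemma poly_eq0_arc (Q : {poly R[i]}) (e : R) : 0 < e ->
  (forall s, 0 < s < e -> Q.[expi2pi (- s)] = 0) -> Q = 0.
Proof.
move=> e0 hQ; apply/eqP/negPn/negP => Q0.
pose e1 := Num.min e 1.
have e10 : 0 < e1 by rewrite lt_min e0 ltr01.
pose s (k : nat) : R := e1 / k.+2%:R.
have s0 k : 0 < s k by rewrite divr_gt0.
have s1 k : s k < e1 by rewrite ltr_pdivrMr// ltr_pMr// ltr1n.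
pose rs := [seq expi2pi (- s k) | k <- iota 0 (size Q)].
have ur : uniq rs.
  rewrite map_inj_uniq ?iota_uniq// => k l ekl.
  have : expi2pi (s l - s k) = 1 by rewrite expi2piD ekl -expi2piD subrr expi2pi0.
  move=> /expi2pi_eq1 /int_small h; have : s l - s k = 0.
    apply: h; have := s0 k; have := s0 l; have := s1 k; have := s1 l.
    have : e1 <= 1 by rewrite /e1 ge_min lexx orbT.
    rewrite ltr_norml; lra.
  have e1n : e1 != 0 by rewrite gt_eqF.
  by move=> /eqP; rewrite subr_eq0 /s => /eqP /(mulfI e1n)/invr_inj/eqP; rewrite eqr_nat => /eqP [].
have rr : all (root Q) rs.
  apply/allP => _ /mapP[k _ ->]; rewrite rootE; apply/eqP/hQ.
  by rewrite s0 (lt_le_trans (s1 k))// /e1 ge_min lexx.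
by have := max_poly_roots Q0 rr ur; rewrite size_map size_iota ltnn.
Qed.

Variables (n : nat) (J : finType).
Implicit Types (c : J -> R[i]) (u : J -> 'rV[int]_n) (z : 'rV[R]_n).

Definition trig_poly c u z : R[i] := \sum_j c j * expi2pi (- dotp (zvec R (u j)) z).

(** A generic integral direction keeps distinct frequencies apart: the entries of
    [w] are powers of a number that is not a root of finitely many
    polynomials. *)
Lemma separating_direction u : injective u ->
  exists2 w : 'rV[int]_n, int_vec (zvec R w) &
  exists2 e : J -> int, injective e & forall j, dotp (zvec R (u j)) (zvec R w) = (e j)%:~R.
Proof.
move=> uinj.
(* The [B] with [P a b] nonzero at [B] separate the frequencies [a] and [b]. *)
pose P (a b : J) : {poly int} := if a == b then 1 else rVpoly (u a - u b).
have P0 a b : P a b != 0.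
  rewrite /P; case: (eqVneq a b) => [_|ab]; first exact: oner_neq0.
  apply/negP => /eqP h; have : u a - u b = 0 by rewrite -[LHS]rVpolyK h linear0.
  by move=> /eqP; rewrite subr_eq0 => /eqP /uinj /eqP; apply/negP.
pose Q := \prod_a \prod_b P a b.
have Q0 : Q != 0 by rewrite prodf_seq_neq0; apply/allP => a _ /=; rewrite prodf_seq_neq0; apply/allP => b _ /=.
have [B QB] : exists B : nat, Q.[B%:Z] != 0.
  apply: contrapT => hB.
  have rr : all (root Q) [seq k%:Z | k <- iota 0 (size Q)].
    apply/allP => _ /mapP[k _ ->]; rewrite rootE; apply/negPn/negP => h; apply: hB; by exists k.
  have ur : uniq [seq k%:Z | k <- iota 0 (size Q)] by rewrite map_inj_uniq ?iota_uniq// => k l [].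
  by have := max_poly_roots Q0 rr ur; rewrite size_map size_iota ltnn.
pose w : 'rV[int]_n := \row_i B%:Z ^+ i.
have ev (v : 'rV[int]_n) : dotp (zvec R v) (zvec R w) = ((rVpoly v).[B%:Z])%:~R.
  rewrite (horner_coef_wide _ (size_poly _ _)) rmorph_sum /dotp; apply: eq_bigr => i _.
  by rewrite coef_rVpoly_ord !mxE rmorphM.
exists w; first exact: int_vec_zvec.
exists (fun j => (rVpoly (u j)).[B%:Z]) => [a b|j]; last exact: ev.
move=> eab; apply/eqP/negPn/negP => ab.
move: QB; rewrite /Q horner_prod prodf_seq_neq0 => /allP/(_ a (mem_index_enum a)) /=.
rewrite horner_prod prodf_seq_neq0 => /allP/(_ b (mem_index_enum b)) /=.
by rewrite /P (negPf ab) linearB /= hornerD hornerN eab subrr eqxx.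
Qed.

Section Restriction.
Variables (c : J -> R[i]) (u : J -> 'rV[int]_n) (w : 'rV[int]_n) (e : J -> int).
Hypotheses (einj : injective e)
  (we : forall j, dotp (zvec R (u j)) (zvec R w) = (e j)%:~R).

(** Exponents [e j] may be negative; adding [shift_exp] turns Laurent
    polynomials into polynomials. *)
Definition shift_exp : nat := \max_j `|e j|.
Definition top_exp : nat := (shift_exp + shift_exp)%N.
Definition nat_exp j : nat := `|(e j + shift_exp%:Z)%R|.

Lemma nat_expE j : (nat_exp j)%:Z = e j + shift_exp%:Z.
Proof.
have : (`|e j| <= shift_exp)%N by exact: (leq_bigmax (F := fun j => `|e j|%N)).
rewrite /nat_exp; lia.
Qed.

Lemma nat_exp_le j : (nat_exp j <= top_exp)%N.
Proof.
have : (`|e j| <= shift_exp)%N by exact: (leq_bigmax (F := fun j => `|e j|%N)).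
rewrite /nat_exp /top_exp; lia.
Qed.

Lemma nat_exp_inj : injective nat_exp.
Proof.
move=> a b h; apply: einj; apply: (addIr shift_exp%:Z).
by rewrite -!nat_expE h.
Qed.

Definition line_coef z j := c j * expi2pi (- dotp (zvec R (u j)) z).
Definition line_poly z : {poly R[i]} := \sum_j line_coef z j *: 'X^(nat_exp j).
(** The conjugate on the unit circle, made a polynomial by [X^-1 = conj X]. *)
Definition line_poly_rev z : {poly R[i]} :=
  \sum_j (line_coef z j)^*%C *: 'X^(top_exp - nat_exp j).

Lemma line_polyE z s : (line_poly z).[expi2pi (- s)] =
  expi2pi (- s) ^+ shift_exp * trig_poly c u (z + s *: zvec R w).
Proof.
rewrite /line_poly horner_sum big_distrr; apply: eq_bigr => j _ /=.
rewrite hornerZ hornerXn /line_coef -!expi2piM_nat dotpDr dotpZr we.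
rewrite -mulrA -expi2piD [RHS]mulrCA -expi2piD; congr (_ * expi2pi _).
have -> : (nat_exp j)%:R = (e j)%:~R + shift_exp%:R :> R by rewrite pmulrn nat_expE intrD.
ring.
Qed.

Lemma line_poly_revE z s : (line_poly_rev z).[expi2pi (- s)] =
  expi2pi (- s) ^+ top_exp * ((line_poly z).[expi2pi (- s)])^*%C.
Proof.
rewrite /line_poly /line_poly_rev !horner_sum rmorph_sum big_distrr; apply: eq_bigr => j _ /=.
rewrite !hornerZ !hornerXn; move: (line_coef z j) => a.
rewrite conjcM mulrCA; congr (_ * _).
rewrite -!expi2piM_nat -expi2piN -expi2piD; congr expi2pi.
by rewrite natrB ?nat_exp_le//; ring.
Qed.

Lemma coef_line_poly z j : (line_poly z)`_(nat_exp j) = line_coef z j.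
Proof.
rewrite /line_poly coef_sum (bigD1 j)//= coefZ coefXn eqxx mulr1 big1 ?addr0// => k kj.
by rewrite coefZ coefXn (inj_eq nat_exp_inj) eq_sym (negPf kj) mulr0.
Qed.

Lemma line_coef_eq0 z j : (line_coef z j == 0) = (c j == 0).
Proof. by rewrite /line_coef mulf_eq0 (negPf (expi2pi_neq0 _)) orbF. Qed.

End Restriction.

Lemma near_line (w : 'rV[R]_n) (P : 'rV[R]_n -> Prop) : (\forall z \near (0 : 'rV[R]_n), P z) ->
  exists2 e : R, 0 < e & forall s, 0 < s < e -> P (s *: w).
Proof.
move=> /nbhs_ballP[e /= e0 he]; exists (e / (`|w| + 1)).
  by rewrite divr_gt0// ltr_pwDr.
move=> s /andP[s0 se]; apply: he; rewrite -ball_normE /= sub0r normrN normrZ gtr0_norm//.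
have w0 : 0 < `|w| + 1 by rewrite ltr_pwDr.
move: se; rewrite ltr_pdivlMr//; apply: le_lt_trans; rewrite ler_pM2l// lerDl; exact: ler01.
Qed.

(** On a line of generic direction the frequencies stay distinct, and the
    restriction is a polynomial in a variable of the unit circle that vanishes on
    an arc. *)
Lemma trig_poly_eq0 c u z0 : injective u ->
  (\forall z \near (0 : 'rV[R]_n), trig_poly c u (z0 + z) = 0) -> forall j, c j = 0.
Proof.
move=> uinj hz; have [w wZ [e einj we]] := separating_direction uinj.
have [d d0 hd] := near_line (zvec R w) hz.
have P0 : line_poly c u e z0 = 0.
  apply: (poly_eq0_arc d0) => s sd; rewrite (line_polyE _ we).
  by rewrite hd// mulr0.
move=> j; apply/eqP; rewrite -(line_coef_eq0 c u z0 j) -(coef_line_poly c u einj).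
by rewrite P0 coef0.
Qed.

(** If a product of translates has modulus one on an open set, the restriction of
    each factor to a line is invertible among Laurent polynomials, hence a
    monomial. *)
Lemma trig_poly_monomial c u (m : nat) (zs : 'I_m.+1 -> 'rV[R]_n) : injective u ->
  (\forall z \near (0 : 'rV[R]_n), \prod_i Normc.normc (trig_poly c u (zs i + z)) = 1) ->
  exists k, forall j, j != k -> c j = 0.
Proof.
move=> uinj hz; have [w wZ [e einj we]] := separating_direction uinj.
have [d d0 hd] := near_line (zvec R w) hz.
pose Pz i := line_poly c u e (zs i); pose Qz i := line_poly_rev c u e (zs i).
pose D := (top_exp e * m.+1)%N.
(* On the circle [Pz i * Qz i] is [|Pz i| ^ 2] times a power of the variable. *)
have key : \prod_i (Pz i * Qz i) = 'X^D.
  apply/eqP; rewrite -subr_eq0; apply/eqP; apply: (poly_eq0_arc d0) => s sd.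
  rewrite hornerD hornerN hornerXn horner_prod.
  have -> : \prod_i (Pz i * Qz i).[expi2pi (- s)] =
      \prod_(i < m.+1) (expi2pi (- s) ^+ top_exp e * (Normc.normc (trig_poly c u (zs i + s *: zvec R w)) ^+ 2)%:C).
    apply: eq_bigr => i _; rewrite hornerM line_poly_revE// mulrCA mulc_conj.
    by rewrite (line_polyE _ we) Normc.normcM -(expi2piM_nat _ (shift_exp e)) normc_expi2pi mul1r.
  rewrite big_split /= prodr_const card_ord -exprM -rmorph_prod /= prodrXl hd//.
  by rewrite expr1n mulr1 subrr.
have dv : Pz ord0 %| 'X^D by rewrite -key (bigD1 ord0)//= -mulrA dvdp_mulr.
have [k _ /eqpf_eq[a a0 ea]] : exists2 k, (k <= D)%N & Pz ord0 %= 'X^k.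
  have := @dvdp_exp_XsubCP _ (Pz ord0) 0 D; rewrite subr0 => h.
  by have /h[k kD hk] : Pz ord0 %| 'X^D by []; exists k.
have cz j : nat_exp e j != k -> c j = 0.
  move=> jk; apply/eqP; rewrite -(line_coef_eq0 c u (zs ord0) j) -(coef_line_poly c u einj).
  by rewrite -/(Pz ord0) ea coefZ coefXn (negPf jk) mulr0.
have [[j0 /eqP e0]|nj] := pselect (exists j, nat_exp e j == k); last first.
  have c0 j : c j = 0 by apply: cz; apply/negP => jk; apply: nj; exists j.
  have := nbhs_singleton hz; rewrite big_ord_recl /trig_poly big1 ?Normc.normc0 ?mul0r.
    by move=> /eqP; rewrite eq_sym oner_eq0.
  by move=> j _; rewrite c0 mul0r.
exists j0 => j jj0; apply: cz; apply: contra jj0 => /eqP ej.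
by apply/eqP/(nat_exp_inj einj); rewrite ej e0.
Qed.

End TrigonometricPolynomials.

(** * Invariant means and Fourier coefficients on the torus *)
Section InvariantMean.
Variables (R : realType) (n : nat).
Local Notation T := (torus R n).
Local Notation B := (borel_torus R n).
Variable mu : probability B R.
Implicit Types (phi psi : B -> R) (h : T).

Lemma open_measurable_torus (A : set T) : open A -> measurable (A : set B).
Proof. by move=> oA; exact: sub_sigma_algebra. Qed.

Lemma closed_measurable_torus (A : set T) : closed A -> measurable (A : set B).
Proof.
move=> cA; rewrite -[A]setCK; apply: measurableC; apply: open_measurable_torus.
exact: closed_openC.
Qed.

Lemma continuous_measurable_torus (phi : T -> R) :
  continuous phi -> measurable_fun setT (phi : B -> R).
Proof.
move=> /continuousP cphi; apply: (measurability _ (RGenOpens.measurableE R)).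
move=> _ [_ [a [b ->] <-]]; rewrite setTI; apply: open_measurable_torus.
exact/cphi/interval_open.
Qed.

Definition torus_shift h : B -> B := fun z => (h + (z : T) : T).

Lemma translation_measurable h : measurable_fun setT (torus_shift h).
Proof.
apply: (@measurability _ _ B B setT _ (@open T)) => //.
move=> _ [A oA <-]; rewrite setTI; apply: open_measurable_torus.
by have /continuousP := @torusD_continuous R n h; apply.
Qed.

Definition bounded_measurable phi :=
  measurable_fun setT phi /\ exists M : R, forall x, `|phi x| <= M.

Lemma bounded_measurable_integrable phi : bounded_measurable phi ->
  mu.-integrable setT (EFin \o phi).
Proof.
move=> [mphi [M hM]]; apply: measurable_bounded_integrable => //.
- by rewrite [ltLHS]probability_setT ltry.
- exists M; split; first exact: num_real.
  by move=> t Mt x _ /=; apply: le_trans (hM x) (ltW Mt).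
Qed.

Lemma bounded_measurableD phi psi : bounded_measurable phi -> bounded_measurable psi ->
  bounded_measurable (fun x => phi x + psi x).
Proof.
move=> [m1 [M h1]] [m2 [N h2]]; split; first exact: measurable_funD.
by exists (M + N) => x; apply: le_trans (ler_normD _ _) _; exact: lerD.
Qed.

Lemma bounded_measurableM phi psi : bounded_measurable phi -> bounded_measurable psi ->
  bounded_measurable (fun x => phi x * psi x).
Proof.
move=> [m1 [M h1]] [m2 [N h2]]; split; first exact: measurable_funM.
by exists (M * N) => x; rewrite normrM ler_pM.
Qed.

Lemma bounded_measurable_cst (c : R) : bounded_measurable (fun=> c).
Proof. by split; [exact: measurable_cst|exists `|c|]. Qed.

Lemma continuous_bounded_measurable (phi : T -> R) : continuous phi -> bounded_measurable phi.
Proof.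
move=> cphi; split; first exact: continuous_measurable_torus.
have cK : compact (phi @` [set: T]).
  by apply: continuous_compact; [exact: continuous_subspaceT|exact: torus_compact].
have [M [_ hM]] := compact_bounded cK.
by exists (M + 1) => x; apply: hM; [rewrite ltrDl|exists x].
Qed.

Lemma bounded_measurable_translate phi h : bounded_measurable phi ->
  bounded_measurable (fun x => phi (h + x : T)).
Proof.
move=> [mphi [M hM]]; split; last by exists M.
exact: (measurableT_comp (f := phi) (g := torus_shift h) mphi (translation_measurable h)).
Qed.

(** Invariance and linearity are needed for bounded functions only, and a
    real-valued mean avoids extended reals. *)
Definition mean phi : R := \int[mu]_(x in setT) phi x.

Lemma meanD phi psi : bounded_measurable phi -> bounded_measurable psi ->
  mean (fun x => phi x + psi x) = mean phi + mean psi.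
Proof. by move=> h1 h2; rewrite /mean RintegralD//; exact: bounded_measurable_integrable. Qed.

Lemma meanZ (c : R) phi : bounded_measurable phi -> mean (fun x => c * phi x) = c * mean phi.
Proof. by move=> h; rewrite /mean RintegralZl//; exact: bounded_measurable_integrable. Qed.

Lemma mean_le phi (M : R) : bounded_measurable phi -> (forall x, `|phi x| <= M) ->
  `|mean phi| <= M.
Proof.
move=> hphi hM.
have c1 : mean (fun=> M) = M.
  rewrite /mean Rintegral_cst//.
  by rewrite [X in fine X](_ : _ = 1%E) ?mulr1//; exact: probability_setT.
have c2 : mean (fun=> - M) = - M.
  rewrite /mean Rintegral_cst//.
  by rewrite [X in fine X](_ : _ = 1%E) ?mulr1//; exact: probability_setT.
have ic c : mu.-integrable setT (EFin \o (fun _ : B => c : R)).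
  exact/bounded_measurable_integrable/bounded_measurable_cst.
have ip := bounded_measurable_integrable hphi.
rewrite ler_norml; apply/andP; split.
- rewrite -c2; apply: le_Rintegral => // x _.
  by have := hM x; rewrite ler_norml => /andP[].
- rewrite -[leRHS]c1; apply: le_Rintegral => // x _.
  by have := hM x; rewrite ler_norml => /andP[].
Qed.

Lemma mean_translate (K : set T) h phi : is_haar K mu -> K h -> bounded_measurable phi ->
  mean (fun x => phi (h + x : T)) = mean phi.
Proof.
move=> [_ inv] Kh hphi; rewrite /mean /Rintegral; congr fine.
have mt := translation_measurable h.
have hc := bounded_measurable_translate h hphi.
transitivity (\int[pushforward mu (torus_shift h)]_(x in setT) (phi x)%:E)%E.
  rewrite (@integral_pushforward _ _ _ _ _ _ mt mu setT (EFin \o phi))//.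
  - by apply/measurable_EFinP; case: hphi.
  - exact: bounded_measurable_integrable hc.
by apply: eq_measure_integral => A mA _; exact: inv.
Qed.

Lemma mean_integral phi : bounded_measurable phi ->
  (\int[mu]_x (phi x)%:E)%E = (mean phi)%:E.
Proof.
move=> h; rewrite /mean /Rintegral fineK//.
by apply: integrable_fin_num => //; exact: bounded_measurable_integrable.
Qed.

(** A Haar measure is carried by its subgroup but lives on the whole torus: the
    complement is negligible. *)
Lemma integral_full_measure (K : set T) phi : closed K -> mu K = 1%E -> bounded_measurable phi ->
  mu.-integrable K (EFin \o phi) /\ (\int[mu]_(x in K) (phi x)%:E = (mean phi)%:E)%E.
Proof.
move=> cK muK hphi; have mK := closed_measurable_torus cK.
have ip := bounded_measurable_integrable hphi.
split; first exact: integrableS ip.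
rewrite -mean_integral// (@negligible_integral _ _ _ mu setT (~` K))//.
- by rewrite setTD setCK.
- exact: measurableC.
- by apply: etrans (probability_setC mu mK) _; rewrite [X in (_ - X)%E]muK subee.
Qed.

(** Outside [K] the function may vanish and its logarithm be unbounded, whence the
    restriction. *)
Lemma bounded_measurable_patch (K : set T) (phi : T -> R) (c C : R) : closed K -> continuous phi ->
  0 < c -> (forall x, K x -> c <= phi x <= C) ->
  bounded_measurable ((fun x => ln (phi x)) \_ K).
Proof.
move=> cK cphi c0 hphi; have mK := closed_measurable_torus cK; split.
  apply/(measurable_restrictT _ mK); apply: measurable_funTS.
  exact: (measurableT_comp (f := @ln R) (@measurable_ln R) (continuous_measurable_torus cphi)).
exists (`|ln c| + `|ln C| + `|point : R|) => x; rewrite patchE; case: ifPn => [xK|_]; last first.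
  by rewrite lerDr addr_ge0.
have /andP[h1 h2] := hphi x (set_mem xK).
have p0 : 0 < phi x by exact: lt_le_trans h1.
have l1 : ln c <= ln (phi x) by rewrite ler_ln.
have l2 : ln (phi x) <= ln C by rewrite ler_ln// posrE (lt_le_trans p0).
apply: (@le_trans _ _ (`|ln c| + `|ln C|)); last by rewrite lerDl.
have := ler_norm (ln C); have := lerNnormlW (lexx `|ln c|).
have := normr_ge0 (ln c); have := normr_ge0 (ln C).
rewrite ler_norml; lra.
Qed.

End InvariantMean.

Section Periodicity.
Variables (R : realType) (n : nat).
Local Notation V := 'rV[R]_n.
Implicit Types (g : V -> R) (v z : V).

Definition periodic_fun g := forall z k, int_vec k -> g (z + k) = g z.

Lemma periodic_bounded g : continuous g -> periodic_fun g ->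
  exists2 C : R, 0 <= C & forall z, `|g z| <= C.
Proof.
move=> cg pg.
have cK : compact (g @` @unit_box R n).
  by apply: continuous_compact; [exact: continuous_subspaceT|exact: unit_box_compact].
have [M [_ hM]] := compact_bounded cK.
exists (`|M| + 1); first by rewrite addr_ge0.
move=> z; have [x xz ux] := torus_repr_unit (to_torus z).
have hk : int_vec (z - x) by apply/to_torus_eq.
have -> : z = x + (z - x) by rewrite addrC subrK.
rewrite pg//; apply: hM; last by exists x.
by apply: le_lt_trans (ler_norm M) _; rewrite ltrDl.
Qed.

Lemma periodic_derives v g g' : periodic_fun g -> derives v g g' -> periodic_fun g'.
Proof.
move=> pg dg z k hk; have [_ <-] := dg (z + k); have [_ <-] := dg z.
have e : (fun s : R => g (z + k + s *: v)) = (fun s : R => g (z + s *: v)).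
  by apply/funext => s; rewrite addrAC (pg (z + s *: v) k hk).
exact: (congr1 (fun f : R -> R => derive f (0 : R) (1 : R)) e).
Qed.

Definition delta (h : R) v g : V -> R := fun z => g (z + h *: v) - g z.

Lemma derives_iter_delta v g g' h m : derives v g g' ->
  derives v (iter m (delta h v) g) (iter m (delta h v) g').
Proof.
elim: m => [//|m IH] dg; have := IH dg; rewrite !iterS.
move: (iter m _ g) (iter m _ g') => f f' df z.
have d1 : is_derive (0 : R) 1 (fun s : R => f (z + h *: v + s *: v)) (f' (z + h *: v)) by exact: df.
have := is_deriveB d1 (df z); congr (is_derive _ _ _ _).
by apply/funext => s; rewrite /delta /= addrAC.
Qed.

(** Each application of the mean value theorem trades one difference for one
    derivative and a factor [h]; the last derivative is bounded, being continuous
    and periodic. *)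
Lemma iter_delta_bound v m g : Ck v m g -> periodic_fun g ->
  exists2 C : R, 0 <= C & forall h z, h != 0 -> `|iter m (delta h v) g z| <= C * `|h| ^+ m.
Proof.
elim: m g => [|m IH] g hg pg.
  have [C C0 hC] := periodic_bounded (Ck_cont hg) pg.
  by exists C => // h z _; rewrite expr0 mulr1; exact: hC.
case: hg => [cg [g' dg hg]].
have [C C0 hC] := IH g' hg (periodic_derives pg dg).
exists C => // h z h0; rewrite iterS {1}/delta.
have [c _ ->] := derives_MVT z (derives_iter_delta h m dg) h0.
rewrite normrM exprS mulrCA ler_wpM2l//; exact: hC.
Qed.

End Periodicity.

Section FourierCoefficients.
Variables (R : realType) (r : nat).
Local Notation T := (torus R r).
Local Notation B := (borel_torus R r).
Variables (dx : probability B R) (dxH : is_haar setT dx).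
Implicit Types (phi psi : T -> R) (k : 'rV[int]_r) (h x : T).

Definition chi k x : R[i] := expi2pi (- dotp (zvec R k) (of_torus x)).

Lemma chi_to_torus k (v : 'rV[R]_r) : chi k (to_torus v) = expi2pi (- dotp (zvec R k) v).
Proof.
rewrite /chi -!dotpNl (periodic_of_torus (g := fun v => expi2pi (dotp (- zvec R k) v)))//.
by move=> w l hl; apply: expi2pi_dotp_periodic => //; apply/int_vecN/int_vec_zvec.
Qed.

Lemma chiD k x h : chi k (x + h) = chi k x * chi k h.
Proof.
have [u <-] := to_torus_surj x; have [v <-] := to_torus_surj h.
by rewrite -to_torusD !chi_to_torus dotpDr opprD expi2piD.
Qed.

Lemma chi_ccont k : ccont (chi k).
Proof.
have hc : ccont (fun v : 'rV[R]_r => expi2pi (- dotp (zvec R k) v)).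
  by apply: ccont_expi2pi; apply: (contN (W := R)); exact: dotp_continuous.
have pc v l : int_vec l -> expi2pi (- dotp (zvec R k) (v + l)) = expi2pi (- dotp (zvec R k) v) :> R[i].
  move=> hl; rewrite -!dotpNl; apply: expi2pi_dotp_periodic => //.
  exact/int_vecN/int_vec_zvec.
split.
- apply: (@continuous_of_torus _ _ _ (fun v => complex.Re (expi2pi (- dotp (zvec R k) v)))) => [|v l hl]; first exact: hc.1.
  by rewrite pc.
- apply: (@continuous_of_torus _ _ _ (fun v => complex.Im (expi2pi (- dotp (zvec R k) v)))) => [|v l hl]; first exact: hc.2.
  by rewrite pc.
Qed.

Definition fourier phi k : R[i] :=
  mean dx (fun x => phi x * complex.Re (chi k x)) +i* mean dx (fun x => phi x * complex.Im (chi k x)).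

Lemma bm_chi phi k : continuous phi ->
  bounded_measurable (fun x : B => phi x * complex.Re (chi k x)) /\
  bounded_measurable (fun x : B => phi x * complex.Im (chi k x)).
Proof.
move=> cphi; have [c1 c2] := chi_ccont k.
by split; apply: continuous_bounded_measurable; exact: contM.
Qed.

Lemma fourier_shift phi k h : continuous phi ->
  fourier (fun x => phi (x + h)) k = (chi k h)^*%C * fourier phi k.
Proof.
move=> cphi; have [b1 b2] := bm_chi k cphi.
have e x : chi k x = (chi k h)^*%C * chi k (x + h).
  by rewrite chiD mulrCA [_^*%C * _]mulrC mulc_conj normc_expi2pi expr1n mulr1.
set w := (chi k h)^*%C in e *.
rewrite /fourier.
have eR x : phi (x + h) * complex.Re (chi k x) =
    complex.Re w * (phi (h + x) * complex.Re (chi k (h + x))) +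
    (- complex.Im w) * (phi (h + x) * complex.Im (chi k (h + x))).
  by rewrite e [x + h]addrC ?ReM ?ImM; ring.
have eI x : phi (x + h) * complex.Im (chi k x) =
    complex.Re w * (phi (h + x) * complex.Im (chi k (h + x))) +
    complex.Im w * (phi (h + x) * complex.Re (chi k (h + x))).
  by rewrite e [x + h]addrC ?ReM ?ImM; ring.
have t1 := bounded_measurable_translate h b1.
have t2 := bounded_measurable_translate h b2.
have z1 c := bounded_measurableM (@bounded_measurable_cst R r c) t1.
have z2 c := bounded_measurableM (@bounded_measurable_cst R r c) t2.
have m1 := mean_translate dxH (I : [set: T] h) b1.
have m2 := mean_translate dxH (I : [set: T] h) b2.
under [X in mean dx X]funext do rewrite eR.
under [X in _ +i* mean dx X]funext do rewrite eI.
rewrite (meanD dx (z1 _) (z2 _)) (meanD dx (z2 _) (z1 _)) !(meanZ dx _ t1) !(meanZ dx _ t2) m1 m2.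
by apply/eqP; rewrite eq_complex ReM ImM /=; apply/andP; split; apply/eqP; ring.
Qed.

Lemma fourierB phi psi k : continuous phi -> continuous psi ->
  fourier (fun x => phi x - psi x) k = fourier phi k - fourier psi k.
Proof.
move=> c1 c2; have [b1 b2] := bm_chi k c1; have [b3 b4] := bm_chi k c2.
rewrite /fourier; simpc.
have z3 := bounded_measurableM (@bounded_measurable_cst R r (-1)) b3.
have z4 := bounded_measurableM (@bounded_measurable_cst R r (-1)) b4.
congr (_ +i* _).
- rewrite -[X in _ + X]mulN1r -(meanZ _ (-1) b3) -(meanD _ b1 z3); congr mean.
  by apply/funext => x; rewrite mulrBl mulN1r.
- rewrite -[X in _ + X]mulN1r -(meanZ _ (-1) b4) -(meanD _ b2 z4); congr mean.
  by apply/funext => x; rewrite mulrBl mulN1r.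
Qed.

Lemma fourier_le phi k (M : R) : continuous phi -> (forall x, `|phi x| <= M) ->
  Normc.normc (fourier phi k) <= M + M.
Proof.
move=> cphi hM; have [b1 b2] := bm_chi k cphi.
apply: le_trans (normc_le_ReIm _) _; apply: lerD; apply: mean_le => // x; rewrite normrM -[leRHS]mulr1.
- by apply: ler_pM => //; apply: le_trans (normRe_le_normc _) _; rewrite normc_expi2pi.
- by apply: ler_pM => //; apply: le_trans (normIm_le_normc _) _; rewrite normc_expi2pi.
Qed.

(** A step of [1 / (2 k_i)] along the [i]-th axis changes the sign of the
    character [k], so taking differences multiplies the coefficient by [-2]. *)
Lemma fourier_decay phi i m :
  continuous phi -> Ck (delta_mx 0 i : 'rV[R]_r) m (fun v => phi (to_torus v)) ->
  exists2 C : R, 0 <= C & forall k, k 0 i != 0 ->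
    Normc.normc (fourier phi k) * `|(k 0 i)%:~R| ^+ m <= C.
Proof.
move=> cphi hphi.
set v : 'rV[R]_r := delta_mx 0 i in hphi.
have pphi : periodic_fun (fun v : 'rV[R]_r => phi (to_torus v)).
  by move=> z l hl; rewrite to_torusD [to_torus l]to_torus_int// addr0.
have [C C0 hC] := iter_delta_bound hphi pphi.
exists (C + C); first exact: addr_ge0.
move=> k ki; have ki' : (k 0 i)%:~R != 0 :> R by rewrite intr_eq0.
pose s : R := (2 * (k 0 i)%:~R)^-1.
have s0 : s != 0 by rewrite invr_eq0 mulf_neq0.
pose D (f : T -> R) := fun x => f (x + to_torus (s *: v)) - f x.
have cD f : continuous f -> continuous (D f).
  by move=> cf; apply: contB => //; apply: cont_comp cf; exact: torusDr_continuous.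
have eD m' w : iter m' D phi (to_torus w) = iter m' (delta s v) (fun v => phi (to_torus v)) w.
  by elim: m' w => [//|m' IH] w; rewrite !iterS /delta /D -!IH to_torusD.
have cDm m' : continuous (iter m' D phi) by elim: m' => [//|m' IH]; rewrite iterS; exact: cD.
have chis : chi k (to_torus (s *: v)) = -1.
  rewrite chi_to_torus dotpZr dotp_delta mxE /s.
  have -> : (2 * (k 0 i)%:~R)^-1 * (k 0 i)%:~R = 2^-1 :> R by field.
  rewrite /expi2pi (_ : 2 * pi * - 2^-1 = - pi); last by field.
  by apply/eqP; rewrite cosN sinN cospi sinpi eq_complex /= !oppr0 !eqxx.
have fD m' : fourier (iter m' D phi) k = (- 2) ^+ m' * fourier phi k.
  elim: m' => [|m' IH]; first by rewrite mul1r.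
  rewrite iterS /D fourierB//; last by apply: cont_comp (cDm m'); exact: torusDr_continuous.
  rewrite fourier_shift// chis IH exprS.
  have -> : (-1 : R[i])^*%C = -1 by apply/eqP; rewrite eq_complex /= !oppr0 !eqxx.
  by ring.
have := fourier_le k (cDm m) (M := C * `|s| ^+ m).
rewrite fD Normc.normcM => /(_ _) h.
have {h}h : Normc.normc ((- 2) ^+ m : R[i]) * Normc.normc (fourier phi k) <= C * `|s| ^+ m + C * `|s| ^+ m.
  by apply: h => x; have [w <-] := to_torus_surj x; rewrite eD; exact: hC.
have n2 : Normc.normc ((- 2) ^+ m : R[i]) = 2 ^+ m.
  elim: (m) => [|m' IH]; first by rewrite !expr0 Normc.normc1.
  rewrite !exprS Normc.normcM IH; congr (_ * _).
  have -> : (- 2 : R[i]) = (- 2)%:C by rewrite rmorphN rmorph_nat.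
  by rewrite /= expr0n addr0 sqrtr_sqr normrN ger0_norm.
rewrite n2 -mulrDl in h.
have es : `|s| ^+ m * (2 ^+ m * `|(k 0 i)%:~R| ^+ m) = 1 :> R.
  rewrite -!exprMn /s normfV normrM [`|2|]ger0_norm//.
  by rewrite mulVf ?expr1n// mulf_neq0// normr_eq0.
have p0 : 0 <= (2 ^+ m * `|(k 0 i)%:~R| ^+ m) / 2 ^+ m :> R by rewrite divr_ge0 ?mulr_ge0 ?exprn_ge0.
have := ler_wpM2r p0 h.
have -> : 2 ^+ m * Normc.normc (fourier phi k) * (2 ^+ m * `|(k 0 i)%:~R| ^+ m / 2 ^+ m) =
   2 ^+ m * (Normc.normc (fourier phi k) * `|(k 0 i)%:~R| ^+ m) by field; rewrite expf_neq0.
have -> : (C + C) * `|s| ^+ m * (2 ^+ m * `|(k 0 i)%:~R| ^+ m / 2 ^+ m) =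
   (C + C) * (`|s| ^+ m * (2 ^+ m * `|(k 0 i)%:~R| ^+ m)) / 2 ^+ m by ring.
rewrite es mulr1 => h2.
have h3 : Normc.normc (fourier phi k) * `|(k 0 i)%:~R| ^+ m <= (C + C) / 2 ^+ m / 2 ^+ m.
  by rewrite ler_pdivlMr ?exprn_gt0// mulrC.
apply: le_trans h3 _; rewrite -mulrA ler_piMr ?addr_ge0//.
by rewrite -invfM invf_le1 ?mulr_gt0 ?exprn_gt0// mulr_ege1// exprn_ege1// ler1n.
Qed.

End FourierCoefficients.

(** * One-parameter subgroups of the torus *)
Section OneParameter.
Variables (R : realType) (n : nat).
Local Notation T := (torus R n).
Implicit Types (S : set T) (q : R -> 'rV[R]_n) (v : 'rV[R]_n).

(** The exponential formula: rescaling a curve through the identity recovers the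
    one-parameter subgroup of its velocity. *)
Lemma rescaled_curve_cvg q v (s : R) : s != 0 ->
  h^-1 *: q h @[h --> 0^'] --> v ->
  to_torus (q (s / k.+1%:R) *+ k.+1) @[k --> \oo] --> (to_torus (s *: v) : T).
Proof.
move=> s0 qv.
have c0 : s / k.+1%:R @[k --> \oo] --> (0 : R)^'.
  have h0 : s / k.+1%:R @[k --> \oo] --> (0 : R).
    by rewrite -[X in _ --> X](mulr0 s); apply: cvgM; [exact: cvg_cst|exact: cvg_harmonic].
  move=> A; rewrite /dnbhs /within /= => /h0 hA.
  have {}hA : \forall k \near \oo, s / k.+1%:R != 0 -> A (s / k.+1%:R) by exact: hA.
  have : \forall k \near \oo, A (s / k.+1%:R).
    by apply: filterS hA => k; apply; rewrite mulf_neq0// invr_eq0 pnatr_eq0.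
  by [].
have c1 : s *: ((s / k.+1%:R)^-1 *: q (s / k.+1%:R)) @[k --> \oo] --> s *: v.
  by apply: cvgZ; [exact: cvg_cst|exact: (cvg_comp _ _ c0 qv)].
apply: cvg_comp; last exact: to_torus_continuous.
rewrite (_ : (fun k => _) = fun k => s *: ((s / k.+1%:R)^-1 *: q (s / k.+1%:R)))//.
apply/funext => k; rewrite scalerA -scaler_nat; congr (_ *: _).
by rewrite invf_div mulrC divfK.
Qed.

Lemma near_rescale (P : R -> Prop) (s : R) : (\forall t \near 0, P t) ->
  \forall k \near \oo, P (s / k.+1%:R).
Proof.
have h0 : s / k.+1%:R @[k --> \oo] --> (0 : R).
  by rewrite -[X in _ --> X](mulr0 s); apply: cvgM; [exact: cvg_cst|exact: cvg_harmonic].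
by move/h0.
Qed.

(** The rescaled curve stays in [S], as a multiple of a point of the curve. *)
Lemma one_parameter_closed S q v (s : R) : closed S -> additive_subgroup S ->
  h^-1 *: q h @[h --> 0^'] --> v -> (\forall t \near 0, S (to_torus (q t))) ->
  S (to_torus (s *: v)).
Proof.
move=> cS sS qv hq; have [->|s0] := eqVneq s 0.
  by rewrite scale0r to_torus0; case: sS.
apply: (closed_cvg S cS _ _ (rescaled_curve_cvg s0 qv)).
apply: filterS (near_rescale s hq) => k hk.
by rewrite to_torusMn; exact: subgroup_mulrn.
Qed.

Lemma tangent_space_line S v (s : R) : closed S -> additive_subgroup S ->
  tangent_space S v -> S (to_torus (s *: v)).
Proof.
move=> cS sS [c [dc c0 nc cv]].
apply: (@one_parameter_closed _ c) => //; rewrite -cv.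
have d0 : derivable c 0 1 by exact: (dc 0%N 0).
rewrite derive1E; move: d0; rewrite /derivable /derive.
rewrite (_ : (fun h : R => _) = (fun h : R => h^-1 *: c h)) => [h|]; first exact: h.
by apply/funext => h /=; rewrite addr0 [h *: 1]mulr1 c0 subr0.
Qed.

(** A homomorphism smooth at the identity is determined by its derivative there:
    on each axis it equals its own rescalings, which converge to the one-parameter
    subgroup of the derivative. *)
Lemma lie_isomorphism_linear r (K : set T) (Phi : T -> torus R r) (Psi : torus R r -> T) :
  additive_subgroup K -> lie_isomorphism K Phi Psi ->
  {morph Psi : x y / x + y >-> x + y} /\
  exists v : 'I_r -> 'rV[R]_n, forall u, Psi (to_torus u) = to_torus (\sum_i u 0 i *: v i).
Proof.
move=> [K0 KD KN] [KPsi PsiK PhiK PhiD [_ sPsi]].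
have PsiD : {morph Psi : x y / x + y >-> x + y}.
  move=> x y; rewrite -(PsiK (Psi x + Psi y)); last exact: KD.
  by rewrite PhiD// !PhiK.
have Psi0 : Psi 0 = 0 by apply: (addrI (Psi 0)); rewrite -PsiD !addr0.
have PsiMn x k : Psi (x *+ k) = Psi x *+ k.
  by elim: k => [|k IH]; rewrite ?mulr0n// !mulrS PsiD IH.
split=> //.
have /choice [v hv] : forall i : 'I_r, exists v : 'rV[R]_n,
    forall s, Psi (to_torus (s *: delta_mx 0 i)) = to_torus (s *: v).
  move=> i; have [|g [sg ng]] := sPsi 0; first by [].
  pose q t := g (t *: delta_mx 0 i) - g 0.
  pose v : 'rV[R]_n := \row_j 'D_(delta_mx 0 i) (fun y => g y 0 j) 0.
  have qv : h^-1 *: q h @[h --> 0^'] --> v.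
    apply/cvgrPdist_lt => e e0.
    have : \forall h \near (0 : R)^', forall j, `|v 0 j - (h^-1 *: q h) 0 j| < e.
      apply: filter_forall => j.
      have dj : derivable (fun y => g y 0 j) 0 (delta_mx 0 i).
        by apply: diff_derivable; exact: (sg j [::]).
      have : (h^-1 *: q h) 0 j @[h --> 0^'] --> v 0 j.
        rewrite mxE; move: dj; rewrite /derivable /derive.
        rewrite (_ : (fun h : R => _) = (fun h : R => (h^-1 *: q h) 0 j))//.
        by apply/funext => h; rewrite /q !mxE /= addr0.
      by move=> /cvgrPdist_lt; apply.
    by apply: filterS => h hh; apply: norm_row_lt => // j; have := hh j; rewrite !mxE.
  exists v => s; have [->|s0] := eqVneq s 0; first by rewrite !scale0r !to_torus0.
  have g0 : to_torus (g 0) = 0 by have := nbhs_singleton ng I; rewrite to_torus0 Psi0.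
  have hq : \forall t \near 0, to_torus (q t) = Psi (to_torus (t *: delta_mx 0 i)).
    have cl : continuous (fun t : R => t *: (delta_mx 0 i : 'rV[R]_r)).
      by apply: contZ; [exact: cont_id|exact: cont_cst].
    have c0 : (t : R) *: (delta_mx 0 i : 'rV[R]_r) @[t --> (0 : R)] --> (0 : 'rV[R]_r).
      by have := cl 0; rewrite /continuous_at scale0r.
    have : \forall t \near (0 : R), [set: torus R r] (to_torus (t *: delta_mx 0 i)) ->
        to_torus (g (t *: delta_mx 0 i)) = Psi (to_torus (t *: delta_mx 0 i)) by exact: (c0 _ ng).
    apply: filterS => t /(_ I) ht.
    by rewrite /q to_torusB g0 subr0 ht.
  apply: (cvg_unique (@torus_hausdorff R n) _ (rescaled_curve_cvg s0 qv)).
  apply: cvg_near_cst; apply: filterS (near_rescale s hq) => k hk.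
  rewrite to_torusMn hk -PsiMn -to_torusMn; congr (Psi (to_torus _)).
  by rewrite -scaler_nat scalerA mulrC divfK// pnatr_eq0.
exists v => u; rewrite [in LHS](row_sum_delta u).
elim: (index_enum 'I_r) => [|i s IH]; first by rewrite !big_nil !to_torus0.
by rewrite !big_cons !to_torusD PsiD IH hv.
Qed.

End OneParameter.

(** * The cocycle equation on a torus *)
Section Cocycle.
Variables (R : realType) (n : nat) (g : torus R n) (P F : torus R n -> R).
Local Notation T := (torus R n).
Local Notation H := (orbit_closure g).
Local Notation H0 := (identity_component H).
Hypotheses (cF : continuous F) (F_ge0 : forall z, 0 <= F z)
  (PF : forall z, P z * F z = F (z + g)).
Implicit Types (z h : T).

(** The zero set of [F] is closed and stable under [g], hence a union of cosets of
    the orbit closure. *)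
Lemma coset_nonzero z h : F z != 0 -> H h -> F (z + h) != 0.
Proof.
move=> Fz Hh; apply: contra Fz => /eqP Fzh.
pose Z := [set w : T | F w = 0].
have cZ : closed Z.
  by have /continuous_closedP := cF => /(_ [set 0]); apply; exact: closed_eq.
have sZ w : Z w -> Z (w + g) by rewrite /Z /= -PF => ->; rewrite mulr0.
have HN : H (- h) by have [_ _] := orbit_closure_subgroup g; apply.
have := orbit_closure_stable cZ sZ Fzh HN; rewrite addrK => h0.
by apply/eqP.
Qed.

Lemma coset_pos z h : F z != 0 -> H h -> 0 < F (z + h).
Proof. by move=> Fz Hh; rewrite lt_neqAle eq_sym coset_nonzero//=. Qed.

Lemma shift_in_H h : H h -> H (h + g).
Proof.
move=> Hh; have [_ HD _] := orbit_closure_subgroup g; apply: HD => //.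
exact: orbit_closure_gen.
Qed.

Lemma P_pos z h : F z != 0 -> H h -> 0 < P (z + h).
Proof.
move=> Fz Hh; have := coset_pos Fz (shift_in_H Hh).
by rewrite addrA -PF pmulr_lgt0// coset_pos.
Qed.

Lemma ln_cocycle z h : F z != 0 -> H h ->
  ln (P (z + h)) = ln (F (z + h + g)) - ln (F (z + h)).
Proof.
move=> Fz Hh; rewrite -PF lnM ?posrE ?P_pos ?coset_pos//.
by rewrite addrK.
Qed.

(** A positive continuous function on a compact coset. *)
Lemma coset_bounds z : F z != 0 -> exists c C : R, 0 < c /\ forall h, H h -> c <= F (z + h) <= C.
Proof.
move=> Fz; pose K := (fun h => F (z + h)) @` H.
have cK : compact K.
  apply: continuous_compact.
    by apply: continuous_subspaceT; apply: cont_comp cF; exact: torusD_continuous.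
  apply: (@subclosed_compact _ _ setT) => //; first exact: orbit_closure_closed.
  exact: torus_compact.
have [M [_ hM]] := compact_bounded cK.
have clK : closed K by apply: compact_closed => //; exact: Rhausdorff.
have K0 : ~ K 0 by move=> [h Hh e]; have := coset_pos Fz Hh; rewrite e ltxx.
have : nbhs (0 : R) (~` K) by apply: open_nbhs_nbhs; split => //; exact: closed_openC.
move=> /nbhs_ballP[e /= e0 he]; exists e, (M + 1); split=> // h Hh.
have p0 := coset_pos Fz Hh.
have Kh : K (F (z + h)) by exists h.
apply/andP; split.
  rewrite leNgt; apply/negP => lt; apply: (he (F (z + h))) => //.
  by rewrite -ball_normE /= sub0r normrN gtr0_norm.
apply: le_trans (ler_norm _) _; apply: hM => //.
by rewrite ltrDl.
Qed.

(** By the cocycle equation [ln P] is the difference of [ln F] and its translate by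
    [g], whose means agree by invariance. *)
Lemma log_mean_zero (mH : probability (borel_torus R n) R) z :
  is_haar H mH -> F z != 0 ->
  mH.-integrable H (fun h : borel_torus R n => lne (P (z + (h : T)))%:E) /\
  (\int[mH]_(h in H) lne (P (z + (h : T)))%:E = 0)%E.
Proof.
move=> hH Fz; have [muH _] := hH.
have cH := @orbit_closure_closed R n g.
have mHH := closed_measurable_torus cH.
have [c [C [c0 hb]]] := coset_bounds Fz.
have cFz : continuous (fun h => F (z + h)) by apply: cont_comp cF; exact: torusD_continuous.
pose f : borel_torus R n -> R := (fun h => ln (F (z + h))) \_ H.
have bf : bounded_measurable f by exact: (bounded_measurable_patch cH cFz c0 hb).
have fE h : H h -> f h = ln (F (z + h)) by move=> Hh; rewrite /f patchE mem_set.
have bs := bounded_measurable_translate g bf.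
pose psi (h : borel_torus R n) : R := f ((g + (h : T)) : T) + (-1) * f h.
have bpsi : bounded_measurable psi.
  by apply: bounded_measurableD => //; apply: bounded_measurableM => //; exact: bounded_measurable_cst.
have psi0 : mean mH psi = 0.
  rewrite /psi meanD//; last by apply: bounded_measurableM => //; exact: bounded_measurable_cst.
  by rewrite meanZ// (mean_translate hH (@orbit_closure_gen R n g) bf) mulN1r subrr.
have e h : H h -> (psi h)%:E = lne (P (z + h))%:E.
  move=> Hh; rewrite lne_EFin ?P_pos// ln_cocycle// /psi mulN1r fE; last first.
    by rewrite addrC; exact: shift_in_H.
  by rewrite fE// [g + h]addrC addrA.
have [i1 i2] := integral_full_measure cH muH bpsi.
split.
  apply: (@eq_integrable _ _ _ mH H mHH (EFin \o psi)) => // h /set_mem Hh.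
  exact: e.
rewrite -[RHS]/(0%:E) -psi0 -i2; apply: eq_integral => h /set_mem Hh.
by rewrite e.
Qed.

Section Resonances.
Variables (m r : nat) (Phi : T -> torus R r) (Psi : torus R r -> T).
Hypotheses (card_m : (cosets H H0 #= `I_m)%card) (iso : lie_isomorphism H0 Phi Psi).
Local Notation omega := (Phi (g *+ m)).

Let cH := @orbit_closure_closed R n g.
Let sH := orbit_closure_subgroup g.
Let sH0 := identity_component_subgroup sH.
Let cH0 := identity_component_closed cH.
Let H0H := @identity_component_sub R n H.

Lemma multiple_in_component : H0 (g *+ m).
Proof. by have [] := cosets_orbit_closure cH0 sH0 card_m. Qed.

Lemma Psi_omega : Psi omega = g *+ m.
Proof. by case: iso => _ h _ _ _; apply: h; exact: multiple_in_component. Qed.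

Lemma Psi_continuous : continuous Psi.
Proof.
have [_ [v hv]] := lie_isomorphism_linear sH0 iso.
apply: continuous_torus.
have -> : Psi \o @to_torus R r = fun u => to_torus (\sum_i u 0 i *: v i) by apply/funext => u /=.
apply: (cont_comp (f := fun u : 'rV[R]_r => \sum_i u 0 i *: v i)); last exact: to_torus_continuous.
apply: cont_sum => i; apply: contZ; first exact: coord_continuous.
exact: cont_cst.
Qed.

(** If [k] were a resonance, the kernel of the character [k] would be a closed
    subgroup of finite index in [H], hence open, and would contain [H0]. *)
Lemma no_resonance (k : 'rV[int]_r) : k != 0 ->
  dist_int (dotp (zvec R k) (of_torus omega)) != 0.
Proof.
move=> k0; apply: dist_int_neq0; apply/negP => res.
have [KPsi PsiK PhiK PhiD _] := iso.
have [PsiD _] := lie_isomorphism_linear sH0 iso.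
have Psi0 : Psi 0 = 0 by apply: (addrI (Psi 0)); rewrite -PsiD !addr0.
have PsiN x : Psi (- x) = - Psi x by apply: (addrI (Psi x)); rewrite -PsiD !subrr.
have chi0 : chi k (0 : torus R r) = 1 by have := @chi_to_torus R r k 0; rewrite to_torus0 dotp0r oppr0 expi2pi0.
have chiN (x : torus R r) : chi k x = 1 -> chi k (- x) = 1.
  by move=> h; have := chiD k x (- x); rewrite subrr chi0 h mul1r => <-.
pose A := [set x : torus R r | chi k x = 1].
have cA : closed A.
  have [c1 c2] := @chi_ccont R r k.
  have -> : A = [set x | complex.Re (chi k x) = 1] `&` [set x | complex.Im (chi k x) = 0].
    apply/seteqP; split=> x.
      move=> h; split; first exact: (congr1 (@complex.Re R) h).
      exact: (congr1 (@complex.Im R) h).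
    move=> [h1 h2]; rewrite /A /=; move: h1 h2.
    by rewrite /mkset; case: (chi k x) => a b /= -> ->.
  apply: closedI.
  - by have /continuous_closedP := c1 => /(_ [set 1]); apply; exact: closed_eq.
  - by have /continuous_closedP := c2 => /(_ [set 0]); apply; exact: closed_eq.
(* Finitely many translates of [K] cover [H], and those that avoid the identity
   leave a neighbourhood [U] of it. *)
pose K := Psi @` A.
have cK : closed K.
  apply: compact_closed; first exact: torus_hausdorff.
  apply: continuous_compact; first exact/continuous_subspaceT/Psi_continuous.
  by apply: (@subclosed_compact _ _ setT) => //; exact: torus_compact.
have sK : additive_subgroup K.
  split.
  - by exists 0.
  - move=> _ _ [x Ax <-] [y Ay <-]; exists (x + y); last by rewrite PsiD.
    by rewrite /A /= chiD Ax Ay mulr1.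
  - by move=> _ [x Ax <-]; exists (- x); [exact: chiN|rewrite PsiN].
have KH0 : K `<=` H0 by move=> _ [x _ <-]; exact: KPsi.
have Aom : A omega by rewrite /A /= /chi expi2pi_int// rpredN.
have Kgm : K (g *+ m) by exists omega => //; exact: Psi_omega.
have [_ cov] := cosets_orbit_closure cH0 sH0 card_m.
have m0 : (0 < m)%N.
  by have [HO _ _] := sH; have [j [_ [jm _ _]]] := cov 0 HO; exact: leq_ltn_trans jm.
have [K0 KD KN] := sK.
have cov' := cosets_cover cK sK m0 Kgm.
pose U := \bigcap_(j in [set j | (j < m)%N /\ ~ K (g *+ j)]) ~` [set z | K (- (g *+ j) + z)].
have nU : nbhs (0 : T) U.
  have -> : U = ~` \bigcup_(j in [set j | (j < m)%N /\ ~ K (g *+ j)]) [set z | K (- (g *+ j) + z)].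
    by rewrite setC_bigcup.
  apply: open_nbhs_nbhs; split.
    apply: closed_openC; apply: closed_bigcup => [|j _]; last exact: closed_translate.
    by apply: (sub_finite_set (B := `I_m)) => // j [].
  move=> [j [jm nK] /=]; rewrite addr0 => Kj; apply: nK.
  by rewrite -[g *+ j]opprK; exact: KN.
have HU : H `&` U `<=` K.
  move=> h [Hh Uh]; have [j [jm Kj]] := cov' h Hh.
  have [Kgj|nKgj] := pselect (K (g *+ j)).
    by rewrite -(addNKr (g *+ j) h); exact: KD.
  by have := Uh j (conj jm nKgj).
have H0K := identity_component_min sH sK (subset_trans KH0 H0H) nU HU.
have chi1 (x : torus R r) : chi k x = 1.
  by have [y Ay e] := H0K _ (KPsi x); rewrite -(PhiK x) -e PhiK.
have [i ki] : exists i, k 0 i != 0.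
  apply: contrapT => nk; move/eqP: k0; apply; apply/rowP => i; rewrite mxE.
  by apply/eqP/negPn/negP => ki; apply: nk; exists i.
(* But [chi k] takes the value [-1] at half a period along a coordinate axis. *)
have := chi1 (to_torus ((2 * (k 0 i)%:~R)^-1 *: delta_mx 0 i)).
rewrite chi_to_torus dotpZr dotp_delta mxE.
have -> : (2 * (k 0 i)%:~R)^-1 * (k 0 i)%:~R = 2^-1 :> R by field; rewrite intr_eq0.
move=> /expi2pi_eq1/int_small; rewrite normrN ger0_norm ?invr_ge0//.
move=> h; have /eqP : - 2^-1 = 0 :> R by apply: h; lra.
by rewrite oppr_eq0 invr_eq0 pnatr_eq0.
Qed.

Lemma prod_cocycle z j : \prod_(i < j) P (z + g *+ i) * F z = F (z + g *+ j).
Proof.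
elim: j => [|j IH]; first by rewrite big_ord0 mul1r mulr0n addr0.
by rewrite big_ord_recr /= mulrAC IH mulrC PF -addrA mulrSr.
Qed.

(** The modulus of a smooth complex function need not be smooth at its zeros, but
    its square is. *)
Hypothesis FCk : forall v k, Ck v k (fun x => F (to_torus x) * F (to_torus x)).
Variables (dx : probability (borel_torus R r) R) (dxH : is_haar setT dx).
Variables (z : T) (Fz : F z != 0).

Definition log_F (u : torus R r) : R := ln (F (z + Psi u)).

Lemma H0_Psi u : H (Psi u).
Proof. by apply: H0H; case: iso. Qed.

Lemma log_F_continuous : continuous log_F.
Proof.
move=> u; apply: continuous_comp; last first.
  by apply: continuous_ln; apply: coset_pos => //; exact: H0_Psi.
apply: (cont_comp (f := fun u => z + Psi u)); last exact: cF.
apply: (cont_comp Psi_continuous (g := fun w => z + w)).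
exact: torusD_continuous.
Qed.

Lemma log_F_Ck i k : Ck (delta_mx 0 i : 'rV[R]_r) k (fun u => log_F (to_torus u)).
Proof.
have [_ [v hv]] := lie_isomorphism_linear sH0 iso.
have [z' ez] := to_torus_surj z.
pose A (u : 'rV[R]_r) := z' + \sum_i u 0 i *: v i.
have cA : continuous A.
  apply: contD; first exact: cont_cst.
  by apply: cont_sum => j; apply: contZ; [exact: coord_continuous|exact: cont_cst].
have hA u s : A (u + s *: delta_mx 0 i) = A u + s *: v i.
  rewrite /A -addrA; congr (_ + _).
  rewrite (bigD1 i)//= [in RHS](bigD1 i)//= !mxE !eqxx mulr1 scalerDl -!addrA; congr (_ + _).
  rewrite addrC; congr (_ + _); apply: eq_bigr => j /negPf ji.
  by rewrite !mxE ji andbF mulr0 addr0.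
have := Ck_comp cA hA (FCk (v i) k).
have eA u : to_torus (A u) = z + Psi (to_torus u) by rewrite to_torusD ez hv.
have pos u : 0 < F (to_torus (A u)) by rewrite eA; apply: coset_pos => //; exact: H0_Psi.
move=> /(Ck_ln (fun u => mulr_gt0 (pos u) (pos u))) hl.
have := CkM (Ck_cst (delta_mx 0 i) k 2^-1) hl; congr (Ck _ _ _).
apply/funext => u; rewrite lnM ?posrE// /log_F -eA; field => //.
Qed.

Lemma log_prod_cocycle u :
  lne (\prod_(j < m) P (z + Psi u + g *+ j))%:E = (log_F (u + omega) - log_F u)%:E.
Proof.
have [PsiD _] := lie_isomorphism_linear sH0 iso.
have HD := sH; have p1 : 0 < F (z + Psi u) by apply: coset_pos => //; exact: H0_Psi.
have p2 : 0 < F (z + Psi (u + omega)) by apply: coset_pos => //; exact: H0_Psi.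
have e : \prod_(j < m) P (z + Psi u + g *+ j) = F (z + Psi (u + omega)) / F (z + Psi u).
  rewrite PsiD Psi_omega addrA -prod_cocycle mulfK//; exact: lt0r_neq0.
rewrite e lne_EFin ?divr_gt0//; congr EFin.
by rewrite ln_div ?posrE.
Qed.

Lemma enorm_le (k : 'rV[int]_r) i : (forall j, `|k 0 j| <= `|k 0 i|) ->
  enorm (zvec R k) <= r%:R * `|(k 0 i)%:~R|.
Proof.
move=> ki; rewrite /enorm -(@ger0_norm _ (r%:R * _)) ?mulr_ge0// -sqrtr_sqr ler_sqrt ?sqr_ge0//.
apply: (@le_trans _ _ (\sum_(j < r) `|(k 0 i)%:~R| ^+ 2 : R)).
  rewrite /dotp; apply: ler_sum => j _; rewrite !mxE -expr2 -[leLHS]real_normK ?num_real//.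
  by rewrite lerXn2r ?nnegrE// -!intr_norm ler_int.
rewrite sumr_const card_ord exprMn -[leLHS]mulr_natl ler_wpM2r ?sqr_ge0//.
by rewrite -natrX ler_nat; case: (r) => // r'; rewrite leq_pmulr.
Qed.

(** The small divisor of the coefficient of [b] is cancelled by the factor
    [expi2pi <k, omega> - 1] that a coboundary carries, so the coefficients of
    [log_F], which decay rapidly, give the bound.  The decay in the norm of [k]
    comes from differentiating along the axis of its largest coordinate. *)
Lemma small_divisors_bounded (b : borel_torus R r -> \bar R) M :
  (forall u, b u = lne (\prod_(j < m) P (z + Psi (u : torus R r) + g *+ j))%:E) ->
  dx.-integrable setT b /\
  (ereal_sup [set ((1 + enorm (zvec R k)) ^+ M *
     (Normc.normc (fourier_coef dx b k) / dist_int (dotp (zvec R k) (of_torus omega))))%:E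
     | k in [set k : 'rV[int]_r | (k != 0)%R]] < +oo)%E.
Proof.
move=> hb.
have bE : b = EFin \o (fun u : torus R r => log_F (u + omega) - log_F u).
  by apply/funext => u; rewrite hb log_prod_cocycle.
have cl := log_F_continuous.
have cls : continuous (fun u => log_F (u + omega)).
  by apply: cont_comp cl; exact: torusDr_continuous.
have cb : continuous (fun u => log_F (u + omega) - log_F u) by exact: contB.
split; first by rewrite bE; exact/bounded_measurable_integrable/continuous_bounded_measurable.
have coefE k : fourier_coef dx b k = fourier dx (fun u => log_F (u + omega) - log_F u) k.
  have [b1 b2] := bm_chi k cb.
  rewrite /fourier_coef /fourier; congr (_ +i* _).
  - rewrite -[RHS]/(fine (mean dx _)%:E) -(mean_integral _ b1); congr fine.
    by apply: eq_integral => u _; rewrite bE /= EFinM.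
  - rewrite -[RHS]/(fine (mean dx _)%:E) -(mean_integral _ b2); congr fine.
    by apply: eq_integral => u _; rewrite bE /= EFinM.
have coef_le k : k != 0 -> Normc.normc (fourier_coef dx b k) / dist_int (dotp (zvec R k) (of_torus omega)) <=
    4 * pi * Normc.normc (fourier dx log_F k).
  move=> k0; have d0 : 0 < dist_int (dotp (zvec R k) (of_torus omega)).
    by rewrite lt_neqAle eq_sym no_resonance//= dist_int_ge0.
  rewrite ler_pdivrMr// coefE fourierB// fourier_shift// /chi expi2piN conjcK.
  rewrite -[X in _ - X]mul1r -mulrBl Normc.normcM mulrAC.
  by apply: ler_wpM2r; [exact: normc_ge0|exact: normc_expi2pi_sub1_le].
have /choice [C hC] (i : 'I_r) : exists C : R, 0 <= C /\ forall k : 'rV[int]_r, k 0 i != 0 ->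
    Normc.normc (fourier dx log_F k) * `|(k 0 i)%:~R| ^+ M <= C.
  have [C C0 hC] := fourier_decay dxH cl (log_F_Ck i M).
  by exists C; split.
pose B : R := (1 + r%:R) ^+ M * (4 * pi * \sum_i C i).
apply: (@le_lt_trans _ _ B%:E); last exact: ltry.
apply: ge_ereal_sup => _ [k /= k0 <-]; rewrite lee_fin.
have r1 : (0 < r)%N.
  by case: (r) k k0 => // k /eqP[]; apply/rowP => -[].
pose i0 : 'I_r := Ordinal r1.
pose i := [arg max_(i > i0) `|k ord0 i|%N].
have hi j : `|k 0 j| <= `|k 0 i|.
  rewrite /i; case: arg_maxnP => // i' _ /(_ j isT); by rewrite -!abszE lez_nat.
have ki : k 0 i != 0.
  apply: contra k0 => /eqP ki; apply/eqP/rowP => j; rewrite mxE; apply/eqP.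
  by have := hi j; rewrite ki normr0 normr_le0.
have k1 : 1 <= `|(k 0 i)%:~R| :> R.
  by rewrite -intr_norm ler1z -gtz0_ge1 normr_gt0.
have e1 : 1 + enorm (zvec R k) <= (1 + r%:R) * `|(k 0 i)%:~R|.
  by rewrite mulrDl mul1r lerD// enorm_le.
have e0 : 0 <= 1 + enorm (zvec R k) by rewrite addr_ge0// /enorm sqrtr_ge0.
have e2 : (1 + enorm (zvec R k)) ^+ M <= (1 + r%:R) ^+ M * `|(k 0 i)%:~R| ^+ M.
  by rewrite -exprMn lerXn2r// nnegrE ?mulr_ge0 ?addr_ge0.
have [Ci0 hCi] := hC i.
apply: (@le_trans _ _ (((1 + r%:R) ^+ M * `|(k 0 i)%:~R| ^+ M) * (4 * pi * Normc.normc (fourier dx log_F k)))).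
  apply: ler_pM => //; [by rewrite exprn_ge0|by rewrite divr_ge0 ?normc_ge0 ?dist_int_ge0|exact: coef_le].
have -> : (1 + r%:R) ^+ M * `|(k 0 i)%:~R| ^+ M * (4 * pi * Normc.normc (fourier dx log_F k)) =
  (1 + r%:R) ^+ M * (4 * pi * (Normc.normc (fourier dx log_F k) * `|(k 0 i)%:~R| ^+ M)) by ring.
have p0 := pi_ge0 R.
rewrite /B !ler_wpM2l ?exprn_ge0 ?addr_ge0 ?mulr_ge0//.
apply: le_trans (hCi k ki) _; rewrite (bigD1 i)//= lerDl sumr_ge0// => j _.
by case: (hC j).
Qed.

End Resonances.
End Cocycle.

(** * Linear relations between time-frequency shifts *)
Lemma sum_option (R : nmodType) (I : finType) (g : option I -> R) :
  \sum_i g i = g None + \sum_i g (Some i).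
Proof.
rewrite (bigD1 None)//=; congr (_ + _).
rewrite (reindex_omap Some id)//= => [|[i|]//].
by apply: eq_bigl => i; rewrite eqxx.
Qed.

Lemma near_translate (R : numFieldType) (V : normedModType R) (z : V) (Q : V -> Prop) :
  (\forall u \near z, Q u) -> \forall v \near (0 : V), Q (z + v).
Proof.
move=> /nbhs_ballP[e e0 he]; apply/nbhs_ballP; exists e => // v.
by rewrite -ball_normE /= sub0r normrN => hv; apply: he; rewrite -ball_normE /= opprD addNKr normrN.
Qed.

(** Up to a constant factor, [|f|] is invariant under translation by [a - x];
    following it in the direction in which it does not decrease contradicts decay
    unless [a = x].  The relation then says that a character is constant where [f]
    does not vanish, and a character that is constant near a point is trivial. *)
Lemma shift_rigidity (R : realType) (d : nat) (f : 'rV[R]_d -> R[i]) (c : R[i])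
    (x y a b : 'rV[R]_d) : schwartz f -> (exists t, f t != 0) ->
  (forall t, c * modul y (transl x f) t = modul b (transl a f) t) -> a = x /\ b = y.
Proof.
move=> sf [t0 ft0] rel.
have nrel u : Normc.normc (f (u - (a - x))) = Normc.normc c * Normc.normc (f u).
  have := congr1 (@Normc.normc R) (rel (u + x)).
  rewrite /modul /transl !Normc.normcM !normc_expi2pi !mul1r addrK => ->.
  by rewrite opprB addrA.
have c0 : 0 < Normc.normc c.
  rewrite normc_gt0; apply/eqP => c0; have := nrel (t0 + (a - x)).
  by rewrite addrK c0 Normc.normc0 mul0r => /Normc.eq0_normc/eqP; apply/negP.
have [D D0 hD] : exists2 D : R, 0 <= D & forall (u : 'rV[R]_d) (i : 'I_d),
    `|u 0 i| * Normc.normc (f u) <= D.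
  have [D1 D10 h1] := real_schwartz_decay 1 (schwartz_re sf).
  have [D2 D20 h2] := real_schwartz_decay 1 (schwartz_im sf).
  exists (D1 + D2); first exact: addr_ge0.
  move=> u i; apply: (@le_trans _ _ (weight u * (`|complex.Re (f u)| + `|complex.Im (f u)|))).
    by apply: ler_pM; rewrite ?normc_ge0 ?coord_le_weight ?normc_le_ReIm.
  by rewrite mulrDr lerD//; have := h1 u; have := h2 u; rewrite !expr1.
have far (e : R) : `|e| = 1 -> (forall j : nat, Normc.normc (f t0) <= Normc.normc (f (t0 + (e *: (a - x)) *+ j))) ->
    a = x.
  move=> e1 hj; apply/eqP; rewrite -subr_eq0; apply/eqP/rowP => i; rewrite [RHS]mxE.
  apply/eqP/negPn/negP => ai; set s := (a - x) 0 i in ai.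
  have f0 : 0 < Normc.normc (f t0) by rewrite normc_gt0.
  have s0 : 0 < `|s| by rewrite normr_gt0.
  pose j := (Num.truncn ((D / Normc.normc (f t0) + `|t0 0 i|) / `|s|)).+1.
  have hjj : (D / Normc.normc (f t0) + `|t0 0 i|) / `|s| < j%:R by exact: truncnS_gt.
  rewrite ltr_pdivrMr// in hjj.
  set u := t0 + (e *: (a - x)) *+ j.
  have ui : j%:R * `|s| - `|t0 0 i| <= `|u 0 i|.
    have -> : u 0 i = e * s * j%:R + t0 0 i by rewrite /u mxE mulmxnE mxE -/s mulr_natr addrC.
    have -> : j%:R * `|s| = `|e * s * j%:R| by rewrite !normrM e1 mul1r (ger0_norm (ler0n _ j)) mulrC.
    have := ler_normB (e * s * j%:R + t0 0 i) (t0 0 i); rewrite addrK; lra.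
  have : D < `|u 0 i| * Normc.normc (f u).
    apply: (@lt_le_trans _ _ (`|u 0 i| * Normc.normc (f t0))); last by rewrite ler_wpM2l// hj.
    rewrite -ltr_pdivrMr//; lra.
  by rewrite ltNge hD.
have ax : a = x.
  have [c1|c1] := lerP 1 (Normc.normc c).
  - apply: (far (-1)); first by rewrite normrN normr1.
    elim=> [|j IH]; first by rewrite mulr0n addr0.
    rewrite mulrSr addrA scaleN1r nrel; apply: le_trans IH _; rewrite -scaleN1r.
    by rewrite ler_peMl// normc_ge0.
  - apply: (far 1); first by rewrite normr1.
    elim=> [|j IH]; first by rewrite mulr0n addr0.
    apply: le_trans IH _; rewrite mulrSr addrA scale1r.
    have := nrel (t0 + (a - x) *+ j + (a - x)); rewrite addrK => ->.
    by rewrite ler_piMl ?normc_ge0// ltW.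
split=> //; apply/eqP; rewrite -subr_eq0; apply/eqP/rowP => i; rewrite [RHS]mxE.
have ch u : f u != 0 -> c * expi2pi (dotp (b - y) (u + a)) = 1.
  move=> fu; have := rel (u + a); rewrite /modul /transl -ax addrK.
  rewrite mulrA => /(mulIf fu) e; rewrite dotpDl expi2piD dotpNl mulrCA e -expi2piD subrr.
  exact: expi2pi0.
have nf : \forall u \near t0, f u != 0.
  have cf : continuous (fun u => Normc.normc (f u)).
    apply: ccont_normc; split; apply: smooth_continuous.
    - by case: (schwartz_re sf).
    - by case: (schwartz_im sf).
  have p0 : 0 < Normc.normc (f t0) by rewrite normc_gt0.
  have : \forall u \near t0, 0 < Normc.normc (f u) by move/cvgr_gt : (cf t0); apply.
  by apply: filterS => u; rewrite normc_gt0.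
have [e e0 he] : exists2 e : R, 0 < e & forall s, 0 < s < e -> f (t0 + s *: delta_mx 0 i) != 0.
  apply: (@near_line R d (delta_mx 0 i) (fun v => f (t0 + v) != 0)).
  exact: (near_translate nf).
apply/eqP/negPn/negP => bi; set s := (b - y) 0 i in bi.
pose h := Num.min (e / 2) (2^-1 / `|s|).
have s0 : 0 < `|s| by rewrite normr_gt0.
have h0 : 0 < h by rewrite /h lt_min !divr_gt0.
have he' : h < e by rewrite /h gt_min ltr_pdivrMr// ltr_pMr// ltr1n.
have hs : h * `|s| <= 2^-1 by rewrite -ler_pdivlMr// /h ge_min lexx orbT.
have hi : expi2pi (h * s) = 1.
  have := ch _ (he h _); rewrite h0 he' => /(_ isT).
  rewrite addrAC dotpDr dotpZr dotp_delta -/s expi2piD mulrA.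
  by rewrite ch// mul1r.
have : h * s = 0.
  apply: int_small; first exact: expi2pi_eq1.
  by rewrite normrM (gtr0_norm h0); apply: le_lt_trans hs _; rewrite invf_lt1// ltr1n.
by move/eqP; rewrite mulf_eq0 (gt_eqF h0) (negPf bi).
Qed.

Lemma finite_orbit_closure (R : realType) (n : nat) (g : torus R n) :
  finite_set (orbit_closure g) -> exists k, g *+ k.+1 = 0.
Proof.
move=> /finite_set_leP[N hN]; apply: contrapT => nk.
have inj : {in `I_N.+1 &, injective (fun j => g *+ j)}.
  move=> i j _ _ e; wlog ij : i j e / (i <= j)%N => [hw|].
    by case/orP: (leq_total i j) => ij; [|apply/esym]; apply: hw.
  apply/eqP; rewrite eqn_leq ij /= leqNgt; apply/negP => lij; apply: nk.
  by exists (j - i).-1; rewrite prednK ?subn_gt0// mulrnBr ?e ?subrr// ltnW.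
have : (`I_N.+1 #<= `I_N)%card.
  rewrite -(card_le_eql (inj_card_eq inj)); apply: card_le_trans hN.
  apply: subset_card_le => _ [j _ <-].
  exact: (subgroup_mulrn j (orbit_closure_subgroup g) (orbit_closure_gen (g := g))).
by rewrite card_le_II ltnn.
Qed.

Section Relation.
Variables (R : realType) (d n : nat) (x y : 'I_n -> 'rV[int]_d) (alpha beta : 'rV[R]_d).
Variables (f : 'rV[R]_d -> R[i]) (c : 'I_n -> R[i]).
Hypotheses (d_gt0 : (1 <= d)%N) (nonint : ~ (int_vec alpha /\ int_vec beta))
  (inj : injective (tf_point x y alpha beta)) (sf : schwartz f) (f_neq0 : exists t, f t != 0).
Local Notation V := 'rV[R]_(d + d).
Local Notation T := (torus R (d + d)).
Local Notation F := (zak f).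
Local Notation p := (tf_poly x y c).

Definition freq (k : 'I_n) : 'rV[int]_(d + d) := row_mx (y k) (x k).

Lemma freq_inj : injective freq.
Proof.
move=> k l /eq_row_mx[ey ex]; have : Some k = Some l by apply: inj; rewrite /= ey ex.
by case.
Qed.

Lemma tf_polyE (z : V) : p z = trig_poly c freq z.
Proof.
apply: eq_bigr => k _; rewrite -mulrA -expi2piD; congr (_ * expi2pi _).
rewrite /dotp big_split_ord /= opprD; congr (- _ - _); apply: eq_bigr => i _.
- by rewrite !mxE (unsplitK (inl _)).
- by rewrite !mxE (unsplitK (inr _)) mulrC.
Qed.

Lemma tf_poly_periodic (z k : V) : int_vec k -> p (z + k) = p z.
Proof.
move=> hk; rewrite !tf_polyE; apply: eq_bigr => j _; congr (_ * _).
by rewrite -!dotpNl expi2pi_dotp_periodic//; apply/int_vecN/int_vec_zvec.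
Qed.

Lemma zak_normc_continuous : continuous (fun z : V => Normc.normc (F z)).
Proof. exact/ccont_normc/zak_ccont. Qed.

Lemma zak_near (z : V) : F z != 0 -> \forall v \near (0 : V), F (z + v) != 0.
Proof.
move=> Fz; have p0 : 0 < Normc.normc (F z) by rewrite normc_gt0.
have : \forall u \near z, 0 < Normc.normc (F u) by move/cvgr_gt : (@zak_normc_continuous z); apply.
by move=> /near_translate; apply: filterS => v; rewrite normc_gt0.
Qed.

Lemma zak_combination (g : 'rV[R]_d -> R[i]) (z : V) s :
  (forall t, \sum_k c k * modul (zvec R (y k)) (transl (zvec R (x k)) f) t = g t) ->
  hsum (zak_term g z) s -> p z * F z = s.
Proof.
move=> rel hs; rewrite -(zak_relation sf rel hs) /tf_poly big_distrl; apply: eq_bigr => k _ /=.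
by rewrite zak_int_translate// !mulrA.
Qed.

(** The integral shifts of [f] are linearly independent: their Zak transforms are
    multiples of [F] by distinct characters. *)
Lemma integral_shifts_independent :
  (forall t, \sum_k c k * modul (zvec R (y k)) (transl (zvec R (x k)) f) t = 0) ->
  forall k, c k = 0.
Proof.
move=> rel; have [z0 Fz0] := zak_neq0 sf f_neq0.
apply: (trig_poly_eq0 (z0 := z0) freq_inj).
apply: filterS (zak_near Fz0) => v Fv; rewrite -tf_polyE.
have hs : hsum (zak_term (fun=> 0) (z0 + v)) 0.
  have := @hsum0 R 'rV[int]_d; congr (hsum _ _).
  by apply/funext => k; rewrite /zak_term mulr0.
by have := zak_combination rel hs => /eqP; rewrite mulf_eq0 (negPf Fv) orbF => /eqP.
Qed.

Section Normalized.
Hypothesis rel : forall t,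
  \sum_k c k * modul (zvec R (y k)) (transl (zvec R (x k)) f) t = modul beta (transl alpha f) t.
Local Notation gamma' := (row_mx (- alpha) beta : V).
Local Notation gamma := (to_torus gamma' : T).
Local Notation H := (orbit_closure gamma).
Local Notation H0 := (identity_component H).

(** The left side is the Zak transform of the sum over the integral shifts, the
    right side that of the remaining shift. *)
Lemma zak_cocycle (z : V) :
  p z * F z = expi2pi (- dotp beta (lsubmx z)) * F (z + gamma').
Proof. by apply: (zak_combination rel); exact: zak_modul_transl. Qed.

(** The moduli of [F] and [p] are periodic, so they descend to the torus, where the
    dynamics take place. *)
Definition absF (z : T) : R := Normc.normc (F (of_torus z)).
Definition absP (z : T) : R := Normc.normc (p (of_torus z)).

Lemma absF_to (v : V) : absF (to_torus v) = Normc.normc (F v).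
Proof.
by apply: (periodic_of_torus (g := fun v => Normc.normc (F v))) => w k; exact: zak_norm_periodic.
Qed.

Lemma absP_to (v : V) : absP (to_torus v) = Normc.normc (p v).
Proof.
apply: (periodic_of_torus (g := fun v => Normc.normc (p v))) => w k hk.
by rewrite tf_poly_periodic.
Qed.

Lemma absF_continuous : continuous absF.
Proof.
apply: (@continuous_of_torus _ _ _ (fun v => Normc.normc (F v))); first exact: zak_normc_continuous.
by move=> w k; exact: zak_norm_periodic.
Qed.

Lemma absF_ge0 z : 0 <= absF z. Proof. exact: normc_ge0. Qed.

Lemma absPF z : absP z * absF z = absF (z + gamma).
Proof.
have [v <-] := to_torus_surj z; rewrite -to_torusD !absF_to absP_to -Normc.normcM zak_cocycle.
by rewrite Normc.normcM normc_expi2pi mul1r.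
Qed.

Lemma absF_neq0 z : (absF z != 0) = (F (of_torus z) != 0).
Proof. by rewrite -normc_gt0 lt_neqAle absF_ge0 andbT eq_sym. Qed.

Lemma absF_neq0_to (v : V) : (absF (to_torus v) != 0) = (F v != 0).
Proof. by rewrite absF_to -normc_gt0 lt_neqAle normc_ge0 andbT eq_sym. Qed.

Lemma absF_Ck v k : Ck v k (fun z : V => absF (to_torus z) * absF (to_torus z)).
Proof.
have := CkD (CkM (zak_re_Ck v k sf) (zak_re_Ck v k sf)) (CkM (zak_im_Ck v k sf) (zak_im_Ck v k sf)).
by congr (Ck _ _ _); apply/funext => z; rewrite absF_to -[RHS]expr2 sqr_normc_real !expr2.
Qed.

(** On a finite orbit the moduli of [p] multiply to one, so [p] is a monomial and
    the relation has only two terms. *)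
Lemma orbit_infinite : infinite_set H.
Proof.
move=> /finite_orbit_closure[m gm].
have [z0 Fz0] := zak_neq0 sf f_neq0.
pose zs (i : 'I_m.+1) : V := z0 + gamma' *+ i.
have [k hk] : exists k, forall j, j != k -> c j = 0.
  apply: (trig_poly_monomial (zs := zs) freq_inj).
  apply: filterS (zak_near Fz0) => v Fv.
  have Fv' : absF (to_torus (z0 + v)) != 0 by rewrite absF_neq0_to.
  have e := prod_cocycle absPF (to_torus (z0 + v)) m.+1.
  rewrite gm addr0 in e; apply: (mulIf Fv'); rewrite mul1r -[RHS]e; congr (_ * _).
  apply: eq_bigr => i _.
  rewrite -to_torusMn -to_torusD absP_to -tf_polyE /zs.
  by rewrite addrAC.
have rel1 t : c k * modul (zvec R (y k)) (transl (zvec R (x k)) f) t = modul beta (transl alpha f) t.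
  rewrite -rel (bigD1 k)//= big1 ?addr0// => j jk.
  by rewrite hk// mul0r.
have [ea eb] := shift_rigidity sf f_neq0 rel1.
by apply: nonint; rewrite ea eb; split; exact: int_vec_zvec.
Qed.

(** Without zeros, [curvature_vanishes] would apply with [G] the whole space, and
    the symplectic form would vanish on small vectors, against its nondegeneracy. *)
Lemma zak_has_zero : exists z : V, F z = 0.
Proof.
apply: contrapT => nz.
have Fn z : F z != 0 by apply/eqP => h; apply: nz; exists z.
pose i : 'I_d := Ordinal d_gt0.
pose e1 : 'rV[R]_d := delta_mx 0 i.
have eZ : int_vec e1 by apply/forallP => j; rewrite mxE natr_int.
pose a : V := row_mx e1 0.
have aZ : int_vec a.
  apply/forallP => j; case: (split_ordP j) => k ->; rewrite ?row_mxEl ?row_mxEr.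
    by move/forallP : eZ; apply.
  by rewrite mxE rpred0.
have cT : closed [set z : V | setT (z - 0)] by exact: closedT.
have [|||||e e0 he] := @curvature_vanishes R d F setT 0 a (zak_ccont sf) (zak_quasi_periodic sf) cT; try by [].
pose u : V := row_mx 0 ((e / 2) *: e1).
have un : `|u| < e.
  apply: norm_row_lt => // j; case: (split_ordP j) => k ->; rewrite ?row_mxEl ?row_mxEr !mxE ?normr0//.
  rewrite normrM ger0_norm ?divr_ge0 ?ltW//.
  apply: (@le_lt_trans _ _ (e / 2)); last by rewrite ltr_pdivrMr// ltr_pMr// ltr1n.
  by apply: ler_piMr; [rewrite divr_ge0 ?ltW|case: (_ && _); rewrite ?normr1 ?normr0].
have := he u I un; rewrite /symp !row_mxKl !row_mxKr dotp0r sub0r dotpZl dotp_delta mxE !eqxx mulr1.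
by move=> /eqP; rewrite oppr_eq0 mulf_eq0 invr_eq0 (gt_eqF e0) pnatr_eq0.
Qed.

(** On the whole torus as orbit closure, one nonzero value propagates everywhere. *)
Lemma orbit_proper : H != setT.
Proof.
apply/eqP => HT; have [z0 Fz0] := zak_neq0 sf f_neq0; have [z1 Fz1] := zak_has_zero.
have hz0 : absF (to_torus z0) != 0 by rewrite absF_neq0_to.
have hh : H (to_torus (z1 - z0)) by rewrite HT.
have := coset_nonzero absF_continuous absPF hz0 hh.
by rewrite -to_torusD addrC subrK absF_neq0_to Fz1 eqxx.
Qed.

(** The elements of [H] with a lift orthogonal to [a] form an open subgroup, since
    the curvature vanishes on small elements of [H].  So the multiple [m] of
    [gamma], which lies in [H0], has a lift orthogonal to [a], and two lifts pair
    with the integral [a] to the same value modulo integers. *)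
Lemma component_curvature m (a : 'rV[int]_(d + d)) : (cosets H H0 #= `I_m)%card ->
  tangent_space H0 (zvec R a) ->
  m%:R * (dotp (zvec R (lsubmx a)) beta + dotp (zvec R (rsubmx a)) alpha) \is a Num.int.
Proof.
move=> card_m ta.
have cH := @orbit_closure_closed R _ gamma; have sH := orbit_closure_subgroup gamma.
have sH0 := identity_component_subgroup sH; have cH0 := identity_component_closed cH.
have H0H := @identity_component_sub R _ H.
have [HO HD HN] := sH.
set A := zvec R a; have AZ : int_vec A by exact: int_vec_zvec.
have lineA (s : R) : H (to_torus (s *: A)) by apply: H0H; exact: tangent_space_line.
have [z0 Fz0] := zak_neq0 sf f_neq0.
pose G : set V := [set u | H (to_torus u)].
have [||||e e0 he] := @curvature_vanishes R d F G z0 A (zak_ccont sf) (zak_quasi_periodic sf) _ _ _ _ AZ lineA.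
- have cs : continuous (fun z : V => to_torus (z - z0) : T).
    apply: (cont_comp (f := fun z : V => z - z0)); last exact: to_torus_continuous.
    by apply: contB; [exact: cont_id|exact: cont_cst].
  by have /continuous_closedP := cs; apply.
- by move=> k hk; have kk : to_torus k = 0 := to_torus_int hk; rewrite /G /= kk; exact: HO.
- by move=> u v Gu Gv; rewrite /G /= to_torusD; exact: HD.
- move=> u Gu; rewrite -absF_neq0_to to_torusD.
  by apply: (coset_nonzero absF_continuous absPF) => //; rewrite absF_neq0_to.
pose K : set T := [set h | H h /\ exists2 u : V, to_torus u = h & symp A u = 0].
have sN u : symp A (- u) = - symp A u.
  by apply: (addrI (symp A u)); rewrite -sympDr !subrr -(scale0r (0 : V)) sympC sympZl mul0r oppr0.
have sK : additive_subgroup K.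
  split.
  - split=> //; exists 0; first exact: to_torus0.
    by rewrite -(scale0r (0 : V)) sympC sympZl mul0r oppr0.
  - move=> z w [Hz [u eu su]] [Hw [v ev sv]]; split; first exact: HD.
    by exists (u + v); rewrite ?to_torusD ?eu ?ev// sympDr su sv addr0.
  - move=> z [Hz [u eu su]]; split; first exact: HN.
    by exists (- u); rewrite ?to_torusN ?eu// sN su oppr0.
pose U : set T := @to_torus R (d + d) @` ball (0 : V) e.
have nU : nbhs (0 : T) U by rewrite -to_torus0; apply/nbhs_to_torus/nbhsx_ballx.
have HU : H `&` U `<=` K.
  move=> w [Hu [u bu eu]]; split=> //; exists u => //; apply: he; first by rewrite /G /= eu.
  by move: bu; rewrite -ball_normE /= sub0r normrN.
have KH : K `<=` H by move=> z [].
have H0K := identity_component_min sH sK KH nU HU.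
have [_ [u eu su]] := H0K _ (multiple_in_component card_m).
have kZ : int_vec (gamma' *+ m - u) by apply/to_torus_eq; rewrite to_torusMn eu.
have : symp A (gamma' *+ m) \is a Num.int.
  rewrite -[gamma' *+ m](subrK u) sympDr su addr0 /symp.
  by apply: rpredB; apply: dotp_int; rewrite ?int_vec_rsub ?int_vec_lsub.
rewrite -scaler_nat sympC sympZl -mulrN -sympC /symp row_mxKl row_mxKr.
have -> : rsubmx A = zvec R (rsubmx a) by apply/rowP => j; rewrite !mxE.
have -> : lsubmx A = zvec R (lsubmx a) by apply/rowP => j; rewrite !mxE.
rewrite dotpNr (dotpC beta) -opprD mulrN rpredN.
by rewrite [dotp _ alpha + _]addrC.
Qed.

End Normalized.
End Relation.

Unset Implicit Arguments.

Theorem corollary7p1 (R : realType) (d N : nat)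
    (x y : 'I_N.-1 -> 'rV[int]_d) (alpha beta : 'rV[R]_d)
    (f : 'rV[R]_d -> R[i]) :
  (1 <= d)%N -> (2 <= N)%N ->
  ~ (int_vec alpha /\ int_vec beta) ->
  injective (tf_point x y alpha beta) ->
  schwartz f -> (exists t, f t != 0) ->
  lin_dependent (fun i : option 'I_N.-1 =>
    let q := tf_point x y alpha beta i in modul q.2 (transl q.1 f)) ->
  exists c : 'I_N.-1 -> R[i],
    (forall t, \sum_k c k * modul (zvec R (y k)) (transl (zvec R (x k)) f) t
               = modul beta (transl alpha f) t) /\
    let p := tf_poly x y c in
    let gamma : torus R (d + d) := to_torus (row_mx (- alpha) beta) in
    let H := orbit_closure gamma in
    let H0 := identity_component H in
    let S := [set z : torus R (d + d) | zak f (of_torus z) != 0] in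
    [/\ infinite_set H /\ H != setT,
        forall mH : probability (borel_torus R (d + d)) R, is_haar H mH ->
          let logp (z h : torus R (d + d)) : \bar R :=
            lne (Normc.normc (p (of_torus (z + h))))%:E in
          forall z, S z ->
            mH.-integrable H (logp z) /\ (\int[mH]_(h in H) logp z h = 0)%E,
        forall m : nat, (cosets H H0 #= `I_m)%card ->
          forall (r : nat) (Phi : torus R (d + d) -> torus R r)
            (Psi : torus R r -> torus R (d + d)),
          lie_isomorphism H0 Phi Psi ->
          let omega := Phi (gamma *+ m) in
          forall dx : probability (borel_torus R r) R, is_haar setT dx ->
          forall lambda, S lambda ->
          let b (u : torus R r) : \bar R :=
            lne (\prod_(j < m)
              Normc.normc (p (of_torus (lambda + Psi u + gamma *+ j))))%:E in
          let resonance (k : 'rV[int]_r) : R :=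
            dist_int (dotp (zvec R k) (of_torus omega)) in
          [/\ dx.-integrable setT b,
              forall k, k != 0 -> resonance k != 0 &
              forall M : nat,
                (ereal_sup [set ((1 + enorm (zvec R k)) ^+ M *
                   (Normc.normc (fourier_coef dx b k) / resonance k))%:E
                   | k in [set k : 'rV[int]_r | (k != 0)%R]] < +oo)%E] &
        forall m : nat, (cosets H H0 #= `I_m)%card ->
          forall a : 'rV[int]_(d + d), tangent_space H0 (zvec R a) ->
            m%:R * (dotp (zvec R (lsubmx a)) beta + dotp (zvec R (rsubmx a)) alpha)
              \is a Num.int].
Proof.
move=> d_gt0 _ nonint inj sf f_neq0 [c' [[i0 ci0] dep]].
have dep' t : c' None * modul beta (transl alpha f) t +
    \sum_k c' (Some k) * modul (zvec R (y k)) (transl (zvec R (x k)) f) t = 0.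
  by have := dep t; rewrite sum_option.
have c0 : c' None != 0.
  apply/eqP => c0.
  have z k : c' (Some k) = 0.
    apply: (integral_shifts_independent (c := c' \o Some) inj sf f_neq0) => t.
    by have := dep' t; rewrite c0 mul0r add0r.
  by move: ci0; case: i0 => [k|]; rewrite ?c0 ?z eqxx.
pose c k := - (c' None)^-1 * c' (Some k).
have rel t : \sum_k c k * modul (zvec R (y k)) (transl (zvec R (x k)) f) t =
    modul beta (transl alpha f) t.
  have -> : \sum_k c k * modul (zvec R (y k)) (transl (zvec R (x k)) f) t =
      - (c' None)^-1 * \sum_k c' (Some k) * modul (zvec R (y k)) (transl (zvec R (x k)) f) t.
    by rewrite mulr_sumr; apply: eq_bigr => k _; rewrite /c -mulrA.
  by have /eqP := dep' t; rewrite addrC addr_eq0 => /eqP ->; rewrite mulrNN mulKf.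
exists c; split=> // p gamma H H0 S.
have cF := absF_continuous sf.
have PF := absPF sf rel.
have F_ge0 := @absF_ge0 R d f.
have SF z : S z -> absF f z != 0 by rewrite absF_neq0.
split.
- split; first exact: (orbit_infinite nonint inj sf f_neq0 rel).
  exact: (orbit_proper d_gt0 sf f_neq0 rel).
- move=> mH hH logp z /SF Fz.
  have [i1 i2] := log_mean_zero cF F_ge0 PF hH Fz.
  split; first exact: i1.
  exact: i2.
- move=> m card_m r Phi Psi iso omega dx dxH z /SF Fz b resonance.
  have res k : k != 0 -> resonance k != 0 by exact: (no_resonance card_m iso).
  have sd M := small_divisors_bounded cF F_ge0 PF card_m iso (absF_Ck sf) dxH Fz (b := b) M (fun=> erefl).
  split=> // [|M]; first by case: (sd 0).
  by case: (sd M).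
- by move=> m card_m a ta; exact: (component_curvature sf f_neq0 rel card_m ta).
Qed.
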